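(* Let $\tilde w\in\mathbb{O}'_1$, and let $m\geqslant1$ be the integer with $\ell(\tilde w)\in\{6m-1,\,6m-3,\,6m-5\}$. Then for every conjugacy class $\mathbb{O}$ of $\widetilde W$, $$\deg(f_{\tilde w,\mathbb{O}})=\begin{cases}3,&\mathbb{O}\in\{\mathbb{O}_\lambda\mid\lambda\in\Lambda^{\leqslant}_{\lambda(\tilde w)}\},\\2,&\mathbb{O}\in\mathcal{C}(\tilde w),\\1,&\ell(\tilde w)>1\text{ and }\mathbb{O}\in\{\mathbb{O}_2\}\cup\{\mathbb{O}_{i\Lambda_2}\mid1\leqslant i\leqslant m-1\},\\0,&\mathbb{O}=\mathbb{O}'_1,\\-\infty,&\text{otherwise},\end{cases}$$ where $$\lambda(\tilde w)=\begin{cases}m\Lambda_2-\Lambda_1,&\ell(\tilde w)=6m-1,\\(m-1)\Lambda_2,&\ell(\tilde w)=6m-3,\\(m-1)\Lambda_2-\Lambda_1,&\ell(\tilde w)=6m-5,\end{cases}$$ and $\mathcal{C}(\tilde w)=\{\mathbb{O}_{4i+1}\mid1\leqslant i\leqslant N\}\cup\{\mathbb{O}'_{6i+3}\mid0\leqslant i\leqslant N'\}\cup\{\mathbb{O}'_{6i+1}\mid1\leqslant i\leqslant N''\}$ with $$(N,N',N'')=\begin{cases}(m-1,\,m-1,\,m-1),&\ell(\tilde w)=6m-1,\\(m-1,\,m-2,\,m-1),&\ell(\tilde w)=6m-3,\\(m-2,\,m-2,\,m-2),&\ell(\tilde w)=6m-5.\end{cases}$$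
   Context: Type $C_2$ data: simple roots $\alpha_1=(1,-1)$, $\alpha_2=(0,2)$ in $\mathbb{R}^2$; $\epsilon_1=(1,0)$, $\epsilon_2=(\frac12,\frac12)$, $\Lambda_1=\epsilon_1$, $\Lambda_2=2\epsilon_2$; $P=\mathbb{Z}\epsilon_1\oplus\mathbb{Z}\epsilon_2$, $Q=\mathbb{Z}\Lambda_1\oplus\mathbb{Z}\Lambda_2$. $W=\langle s_1,s_2\rangle$ is the Weyl group (dihedral of order 8): $s_1(\Lambda_1)=\Lambda_2-\Lambda_1$, $s_1(\Lambda_2)=\Lambda_2$, $s_2(\Lambda_1)=\Lambda_1$, $s_2(\Lambda_2)=2\Lambda_1-\Lambda_2$. $\widetilde W=P\rtimes W$, with $t^\lambda$ the translation by $\lambda$. $W_a=Q\rtimes W$ is the Coxeter group generated by $\widetilde{\mathbb{S}}=\{s_0,s_1,s_2\}$, $s_0=t^{\Lambda_1}s_1s_2s_1$. $\tau=t^{\epsilon_2}s_2s_1s_2$ satisfies $\tau^2=1$, $\tau s_0\tau^{-1}=s_2$, $\tau s_1\tau^{-1}=s_1$, and $\widetilde W=W_a\rtimes\{1,\tau\}$. $\ell$ is the Coxeter length on $W_a$, extended by $\ell(x\tau)=\ell(x)$. $\mathbb{N}=\{0,1,2,\dots\}$. Class polynomials: $A=\mathbb{Z}[v,v^{-1}]$; $\widetilde H$ is the associative $A$-algebra with basis $T_{\tilde w}$ ($\tilde w\in\widetilde W$) and relations $T_{\tilde x}T_{\tilde y}=T_{\tilde x\tilde y}$ if $\ell(\tilde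 x)+\ell(\tilde y)=\ell(\tilde x\tilde y)$, $(T_s-v)(T_s+v^{-1})=0$ for $s\in\widetilde{\mathbb{S}}$. $[\widetilde H,\widetilde H]$ is the $A$-submodule generated by all $hh'-h'h$. For a conjugacy class $\mathbb{O}$ of $\widetilde W$, $T_{\mathbb{O}}$ denotes the image in $\widetilde H/[\widetilde H,\widetilde H]$ of $T_x$ for any minimal length element $x\in\mathbb{O}$ (independent of the choice); the $T_{\mathbb{O}}$ form an $A$-basis of $\widetilde H/[\widetilde H,\widetilde H]$ (He–Nie). The class polynomials $f_{\tilde w,\mathbb{O}}\in A$ are defined by $T_{\tilde w}\equiv\sum_{\mathbb{O}}f_{\tilde w,\mathbb{O}}T_{\mathbb{O}}$ modulo $[\widetilde H,\widetilde H]$; they are polynomials in $v-v^{-1}$, $\deg$ is the degree in $v-v^{-1}$, and $\deg 0=-\infty$. Conjugacy classes of $\widetilde W$ (for $k\in\mathbb{N}$, $\lambda\in Q_+=\{a\Lambda_1+b\Lambda_2\mid a,b\in\mathbb{N}\}$): $\mathbb{O}_2=\{t^\lambda s_1s_2,\ t^\lambda s_2s_1\mid\lambda\in Q\}$; $\mathbb{O}_\lambda=\{t^{w(\lambda)}\mid w\in W\}$; $\mathbb{O}_{4k+1}=\{t^{\pm k(\Lambda_2-\Lambda_1)+m'\Lambda_1}s_1s_2s_1,\ t^{\pm k\Lambda_1+m'(\Lambda_2-\Lambda_1)}s_2\mid m'\in\mathbb{Z}\}$; $\mathbb{O}'_{6k+1}=\{t^{\pm k\Lambda_2+m'(2\Lambda_1-\Lambda_2)}s_1,\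 t^{\pm k(2\Lambda_1-\Lambda_2)+m'\Lambda_2}s_2s_1s_2\mid m'\in\mathbb{Z}\}$ (so $\mathbb{O}'_1$ is the case $k=0$); $\mathbb{O}'_{6k+3}=\{t^{\pm(k\Lambda_2+\Lambda_1)+m'(2\Lambda_1-\Lambda_2)}s_1,\ t^{\pm(k(2\Lambda_1-\Lambda_2)+\Lambda_1)+m'\Lambda_2}s_2s_1s_2\mid m'\in\mathbb{Z}\}$. Sets of coweights: $Q_{++}=\{a\Lambda_1+b\Lambda_2\mid a,b\in\mathbb{Z},\ a,b\geqslant1\}$. For $\lambda=a\Lambda_1+b\Lambda_2$ with $a,b\in\mathbb{Z}$, $\diamondsuit_\lambda$ is the convex hull of $0,\ (\frac a2+b)\Lambda_2,\ (a+b)\Lambda_1,\ \lambda$; and $\Lambda^{\leqslant}_\lambda=Q_{++}\cap\diamondsuit_\lambda$. *)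

(* Defs.v *)
From HB Require Import structures.
From mathcomp Require Import all_boot all_algebra.
From mathcomp Require Import boolp classical_sets cardinality fsbigop.

Set Implicit Arguments.
Unset Strict Implicit.
Unset Printing Implicit Defensive.

Import GRing.Theory.

Notation tofrac := (@FracField.tofrac _).

Local Open Scope classical_set_scope.
Local Open Scope ring_scope.

(* Z[v, v^-1] is realized inside the fraction field of Z[v]. *)

Definition is_laurent : {pred {fraction {poly int}}} :=
  fun x => `[< exists (p : {poly int}) (n : nat), x * tofrac 'X ^+ n = tofrac p >].

Lemma is_laurent_subring : subring_closed is_laurent.
Proof.
split=> [|x y /asboolP[p [m px]] /asboolP[q [n qy]]
         |x y /asboolP[p [m px]] /asboolP[q [n qy]]].
- by apply/asboolP; exists 1, 0%N; rewrite expr0 mulr1 tofrac1.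
- apply/asboolP; exists (p * 'X ^+ n - q * 'X ^+ m), (m + n)%N.
  rewrite tofracB !tofracM !tofracXn -px -qy mulrBl exprD.
  by congr (_ - _); rewrite mulrA // mulrAC.
- apply/asboolP; exists (p * q), (m + n)%N.
  by rewrite tofracM -px -qy exprD mulrACA.
Qed.

HB.instance Definition _ :=
  GRing.isSubringClosed.Build {fraction {poly int}} is_laurent is_laurent_subring.

Record laurent :=
  Laurent { laurent_val : {fraction {poly int}}; _ : is_laurent laurent_val }.

HB.instance Definition _ := [isSub for laurent_val].
HB.instance Definition _ := [Choice of laurent by <:].
HB.instance Definition _ := [SubChoice_isSubComNzRing of laurent by <:].

Lemma v_subproof : is_laurent (tofrac 'X).
Proof. by apply/asboolP; exists 'X, 0%N; rewrite expr0 mulr1. Qed.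

Lemma vinv_subproof : is_laurent (tofrac 'X)^-1.
Proof.
apply/asboolP; exists 1, 1%N; rewrite expr1 mulVf ?tofrac1 //.
by rewrite tofrac_eq0 polyX_eq0.
Qed.

Definition v : laurent := Laurent v_subproof.
Definition vinv : laurent := Laurent vinv_subproof.

Lemma mulvV : v * vinv = 1.
Proof. by apply: val_inj; rewrite /= mulfV // tofrac_eq0 polyX_eq0. Qed.

(* [vdeg f d] : f is a polynomial in v - v^-1, of degree d there; [None] is
   the degree -oo of 0.  As v - v^-1 is transcendental over Z, d is unique. *)
Definition vdeg (f : laurent) (d : option nat) : Prop :=
  exists2 p : {poly int}, f = (map_poly intr p).[v - vinv] &
    size p = if d is Some n then n.+1 else 0%N.

(* Vectors of P are columns of coordinates in the basis (eps1, eps2). *)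
Definition coweight := 'cV[int]_2.

Definition eps1 : coweight := delta_mx 0 0.
Definition eps2 : coweight := delta_mx 1 0.
Definition Lambda1 : coweight := eps1.
Definition Lambda2 : coweight := 2 *: eps2.

(* The columns are the images of eps1 = Lambda1 and eps2 = Lambda2 / 2. *)
Definition s1_mx : 'M[int]_2 := row_mx (Lambda2 - Lambda1) eps2.
Definition s2_mx : 'M[int]_2 := row_mx eps1 (eps1 - eps2).

Lemma s1_mxE i j : s1_mx i j = nth 0 (nth [::] [:: [:: -1; 0]; [:: 2; 1]] i) j.
Proof.
rewrite mxE; case: splitP => k; rewrite !mxE ord1 => ->;
  by case: i => [[|[|[]]]].
Qed.

Lemma s2_mxE i j : s2_mx i j = nth 0 (nth [::] [:: [:: 1; 1]; [:: 0; -1]] i) j.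
Proof.
rewrite mxE; case: splitP => k; rewrite !mxE ord1 => ->;
  by case: i => [[|[|[]]]].
Qed.

Lemma s1_Lambda1 : s1_mx *m Lambda1 = Lambda2 - Lambda1.
Proof.
apply/colP=> i; rewrite !mxE big_ord_recl big_ord1 !s1_mxE !mxE.
by case: i => [[|[|[]]]].
Qed.

Lemma s1_Lambda2 : s1_mx *m Lambda2 = Lambda2.
Proof.
apply/colP=> i; rewrite !mxE big_ord_recl big_ord1 !s1_mxE !mxE.
by case: i => [[|[|[]]]].
Qed.

Lemma s2_Lambda1 : s2_mx *m Lambda1 = Lambda1.
Proof.
apply/colP=> i; rewrite !mxE big_ord_recl big_ord1 !s2_mxE !mxE.
by case: i => [[|[|[]]]].
Qed.

Lemma s2_Lambda2 : s2_mx *m Lambda2 = 2 *: Lambda1 - Lambda2.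
Proof.
apply/colP=> i; rewrite !mxE big_ord_recl big_ord1 !s2_mxE !mxE.
by case: i => [[|[|[]]]].
Qed.

Lemma s1_mxK : s1_mx * s1_mx = 1.
Proof.
apply/matrixP=> i j; rewrite !mxE big_ord_recl big_ord1 !s1_mxE.
by case: i => [[|[|[]]]] // ?; case: j => [[|[|[]]]].
Qed.

Lemma s2_mxK : s2_mx * s2_mx = 1.
Proof.
apply/matrixP=> i j; rewrite !mxE big_ord_recl big_ord1 !s2_mxE.
by case: i => [[|[|[]]]] // ?; case: j => [[|[|[]]]].
Qed.

Definition weyl : {pred 'M[int]_2} := fun g =>
  `[< exists2 r : seq 'M[int]_2,
        all (mem [:: s1_mx; s2_mx]) r & g = \prod_(s <- r) s >].

Lemma weyl1 : 1 \in weyl.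
Proof. by apply/asboolP; exists [::]; rewrite ?big_nil. Qed.

Lemma weyl_s1 : s1_mx \in weyl.
Proof.
by apply/asboolP; exists [:: s1_mx]; rewrite ?big_seq1 //= inE eqxx.
Qed.

Lemma weyl_s2 : s2_mx \in weyl.
Proof.
by apply/asboolP; exists [:: s2_mx]; rewrite ?big_seq1 //= !inE eqxx orbT.
Qed.

Lemma weylM g h : g \in weyl -> h \in weyl -> g * h \in weyl.
Proof.
move=> /asboolP[r rS ->] /asboolP[r' r'S ->]; apply/asboolP.
by exists (r ++ r'); rewrite ?all_cat ?rS // big_cat.
Qed.

Lemma weyl_inv_ex g : g \in weyl ->
  exists2 h, h \in weyl & (g * h = 1) /\ (h * g = 1).
Proof.
move=> /asboolP[r + ->]; elim: r => [_|s r IH /= /andP[sS /IH[h hW [gh hg]]]].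
  by exists 1; [exact: weyl1|rewrite big_nil mulr1].
have [sW sK] : s \in weyl /\ s * s = 1.
  move: sS; rewrite !(in_cons, in_nil, orbF) => /orP[] /eqP->.
    by split; [exact: weyl_s1|exact: s1_mxK].
  by split; [exact: weyl_s2|exact: s2_mxK].
exists (h * s); first exact: weylM.
rewrite big_cons; split; last by rewrite mulrA -(mulrA h) sK mulr1.
by rewrite mulrA -(mulrA s) gh mulr1.
Qed.

Lemma weyl_unit g : g \in weyl -> g \is a GRing.unit.
Proof. by case/weyl_inv_ex=> h _ [gh hg]; apply/unitrP; exists h. Qed.

Lemma weylV g : g \in weyl -> g^-1 \in weyl.
Proof.
move=> gW; have [h hW [gh _]] := weyl_inv_ex gW.
suff -> : g^-1 = h by [].
by rewrite -[h](mulKr (weyl_unit gW)) gh mulr1.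
Qed.

(* The pair (x, g) stands for t^x g. *)
Record ext_affine :=
  ExtAffine { ea_val : coweight * 'M[int]_2; ea_weyl : ea_val.2 \in weyl }.

HB.instance Definition _ := [isSub for ea_val].
HB.instance Definition _ := [Choice of ext_affine by <:].

Definition transl (w : ext_affine) : coweight := (ea_val w).1.
Definition lin (w : ext_affine) : 'M[int]_2 := (ea_val w).2.

Definition ea_one : ext_affine := @ExtAffine (0, 1) weyl1.
Definition ea_mul (w z : ext_affine) : ext_affine :=
  @ExtAffine (transl w + lin w *m transl z, lin w * lin z)
             (weylM (ea_weyl w) (ea_weyl z)).
Definition ea_inv (w : ext_affine) : ext_affine :=
  @ExtAffine (- ((lin w)^-1 *m transl w), (lin w)^-1) (weylV (ea_weyl w)).

Fact ea_mulA : associative ea_mul.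
Proof.
move=> x y z; apply: val_inj; congr (_, _) => /=; last by rewrite mulrA.
by rewrite mulmxDr mulmxA addrA.
Qed.

Fact ea_mul1 : left_id ea_one ea_mul.
Proof.
by move=> [[x g] gW]; apply: val_inj; congr (_, _); rewrite /= ?mul1r // mul1mx add0r.
Qed.

Fact ea_mulx1 : right_id ea_one ea_mul.
Proof.
by move=> [[x g] gW]; apply: val_inj; congr (_, _); rewrite /= ?mulr1 // mulmx0 addr0.
Qed.

Fact ea_mulV : left_inverse ea_one ea_inv ea_mul.
Proof.
move=> [[x g] gW]; apply: val_inj; congr (_, _) => /=; first by rewrite addNr.
by rewrite mulVr // weyl_unit.
Qed.

Fact ea_mulxV : right_inverse ea_one ea_inv ea_mul.
Proof.
move=> [[x g] gW]; have gU := weyl_unit gW.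
apply: val_inj; congr (_, _) => /=; last by rewrite mulrV.
by rewrite mulmxN mulmxA -[_ *m _^-1]/(g * g^-1) mulrV // mul1mx subrr.
Qed.

HB.instance Definition _ :=
  isGroup.Build ext_affine ea_mulA ea_mul1 ea_mulx1 ea_mulV ea_mulxV.

Definition t (x : coweight) : ext_affine := @ExtAffine (x, 1) weyl1.
Definition s1 : ext_affine := @ExtAffine (0, s1_mx) weyl_s1.
Definition s2 : ext_affine := @ExtAffine (0, s2_mx) weyl_s2.
Definition s0 : ext_affine := (t Lambda1 * s1 * s2 * s1)%g.
Definition tau : ext_affine := (t eps2 * s2 * s1 * s2)%g.

Definition simple_refls : seq ext_affine := [:: s0; s1; s2].

Definition affine_weyl : set ext_affine :=
  [set w | exists a b : int, transl w = a *: Lambda1 + b *: Lambda2].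

Definition has_word (w : ext_affine) (n : nat) : Prop :=
  exists r : seq ext_affine,
    [/\ all (mem simple_refls) r, size r = n & w = (\prod_(s <- r) s)%g].

(* The default value 0 of [xget] is not used on [affine_weyl], which is
   generated by [simple_refls]. *)
Definition cox_length (w : ext_affine) : nat :=
  xget 0%N [set n | has_word w n /\ forall k, has_word w k -> (n <= k)%N].

Definition ext_length (w : ext_affine) : nat :=
  if `[< affine_weyl w >] then cox_length w else cox_length (w * tau^-1)%g.

Record hecke_algebra (H : algType laurent) (T : ext_affine -> H) : Prop := {
  hecke_basis : forall h : H, exists! c : ext_affine -> laurent,
    finite_set [set w | c w != 0] /\ h = \sum_(w \in setT) c w *: T w;
  hecke_mul : forall x y : ext_affine,
    (ext_length x + ext_length y = ext_length (x * y)%g)%N -> T x * T y = T (x * y)%g;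
  hecke_quadratic : forall s : ext_affine, s \in simple_refls ->
    (T s - v%:A) * (T s + vinv%:A) = 0 }.

Definition commutator_submodule (H : algType laurent) : set H :=
  [set h | exists r : seq (laurent * (H * H)),
     h = \sum_(p <- r) p.1 *: (p.2.1 * p.2.2 - p.2.2 * p.2.1)].

Definition conj_class (O : set ext_affine) : Prop :=
  exists x : ext_affine, O = [set (x ^ g)%g | g in setT].

Definition min_length_elt (O : set ext_affine) (x : ext_affine) : Prop :=
  O x /\ forall y, O y -> (ext_length x <= ext_length y)%N.

(* T_O is the image of T_x for any x of minimal length in O, so the congruence
   is required for every choice r of such representatives. *)
Definition class_polynomials (H : algType laurent) (T : ext_affine -> H)
    (w : ext_affine) (f : set ext_affine -> laurent) : Prop :=
  [/\ finite_set [set O | f O != 0],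
      forall O, ~ conj_class O -> f O = 0 &
      forall r : set ext_affine -> ext_affine,
        (forall O, conj_class O -> min_length_elt O (r O)) ->
        commutator_submodule (T w - \sum_(O \in conj_class) f O *: T (r O))].

(* By the theorem of He and Nie, exactly one family satisfies
   [class_polynomials T w]. *)
Definition class_poly (H : algType laurent) (T : ext_affine -> H)
    (w : ext_affine) : set ext_affine -> laurent :=
  xget (fun=> 0) (class_polynomials T w).

Definition O_2 : set ext_affine :=
  [set w | exists a b : int, let x := a *: Lambda1 + b *: Lambda2 in
     w = (t x * s1 * s2)%g \/ w = (t x * s2 * s1)%g].

Definition O_transl (x : coweight) : set ext_affine :=
  [set t (g *m x) | g in [set` weyl]].

(* In the next three families, the boolean e encodes the sign +-. *)
Definition O_4k1 (k : nat) : set ext_affine :=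
  [set w | exists (e : bool) (m : int), let k' := (-1) ^+ e * k%:Z in
     w = (t (k' *: (Lambda2 - Lambda1) + m *: Lambda1) * s1 * s2 * s1)%g \/
     w = (t (k' *: Lambda1 + m *: (Lambda2 - Lambda1)) * s2)%g].

Definition O'_6k1 (k : nat) : set ext_affine :=
  [set w | exists (e : bool) (m : int), let k' := (-1) ^+ e * k%:Z in
     w = (t (k' *: Lambda2 + m *: (2 *: Lambda1 - Lambda2)) * s1)%g \/
     w = (t (k' *: (2 *: Lambda1 - Lambda2) + m *: Lambda2) * s2 * s1 * s2)%g].

Definition O'_6k3 (k : nat) : set ext_affine :=
  [set w | exists (e : bool) (m : int), let sg : int := (-1) ^+ e in
     w = (t (sg *: (k%:Z *: Lambda2 + Lambda1)
             + m *: (2 *: Lambda1 - Lambda2)) * s1)%g \/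
     w = (t (sg *: (k%:Z *: (2 *: Lambda1 - Lambda2) + Lambda1)
             + m *: Lambda2) * s2 * s1 * s2)%g].

Definition Q_pp : set coweight :=
  [set x | exists a b : int,
     [/\ 1 <= a, 1 <= b & x = a *: Lambda1 + b *: Lambda2]].

(* Rational barycentric coordinates suffice, as all points are rational. *)
Definition convex_hull (r : seq 'cV[rat]_2) : set 'cV[rat]_2 :=
  [set x | exists c : 'I_(size r) -> rat,
     [/\ forall i, 0 <= c i, \sum_i c i = 1 & x = \sum_i c i *: r`_i]].

Definition ratv (x : coweight) : 'cV[rat]_2 := map_mx intr x.

Definition diamond (a b : int) : set 'cV[rat]_2 :=
  convex_hull [:: 0; (a%:~R / 2 + b%:~R) *: ratv Lambda2;
                  (a + b)%:~R *: ratv Lambda1;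
                  ratv (a *: Lambda1 + b *: Lambda2)].

Definition Lambda_le (a b : int) : set coweight :=
  Q_pp `&` [set x | diamond a b (ratv x)].

(* The coordinates (a, b) of lambda = a Lambda1 + b Lambda2. *)
Definition lambda_coord (m l : nat) : int * int :=
  if l == (6 * m - 1)%N then (-1, m%:Z)
  else if l == (6 * m - 3)%N then (0, m%:Z - 1)
  else (-1, m%:Z - 1).

(* The bounds (N, N', N''), which may be -1. *)
Definition class_bounds (m l : nat) : int * int * int :=
  if l == (6 * m - 1)%N then (m%:Z - 1, m%:Z - 1, m%:Z - 1)
  else if l == (6 * m - 3)%N then (m%:Z - 1, m%:Z - 2, m%:Z - 1)
  else (m%:Z - 2, m%:Z - 2, m%:Z - 2).

Definition C_classes (m l : nat) : set (set ext_affine) :=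
  let: (N, N', N'') := class_bounds m l in
  [set O | exists2 i : nat, 1 <= i%:Z <= N & O = O_4k1 i] `|`
  [set O | exists2 i : nat, i%:Z <= N' & O = O'_6k3 i] `|`
  [set O | exists2 i : nat, 1 <= i%:Z <= N'' & O = O'_6k1 i].

(* Main.v *)
Require Import Defs.
From HB Require Import structures.
From mathcomp Require Import all_boot all_order all_algebra.
From mathcomp Require Import boolp classical_sets cardinality fsbigop.
From mathcomp Require Import zify ring lra.

(** The class polynomials of [w] are read off from a reduction of [T w], modulo
commutators, to elements of minimal length. This needs the reduction itself
and the uniqueness of its coefficients.

Reduction. Put h = v - v^-1. For a simple reflection s, modulo commutators,
T_sxs = T_x if sxs and x have the same length, and T_x = T_sxs + h T_sx if sxs
is shorter than x ([ceq_conj], [ceq_down]). In the coordinates (a, b) of the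
plane the class O'_1 consists of the reflections in the lines a - b = k and
a + b = k. Folding such a line towards the origin splits off h times a product
of two reflections, which is either a translation along a multiple of Lambda2
or a rotation of order 4. A rotation in turn gets shorter by splitting off h
times a glide reflection. The glide reflections whose axis is parallel to a
mirror of O'_1 have minimal length; the others, of translation length j, fold
further and split off h times one translation in the class of
(j - c) Lambda1 + c Lambda2 for each c. So every class receives the coefficient
n h^d with n a natural number and d determined by the class; no cancellation
can occur, and the degree of the class polynomial is d. The lemmas
[expansion_glide], [expansion_rot] and [expansion_ref] keep track of the
classes that occur.

Uniqueness. The elements T_x, with one minimal length x in each conjugacy
class, are linearly independent modulo commutators ([cocenter_free]). Indeed
the trace of every representation of the Hecke algebra kills commutators. Five
families of representations suffice: the principal series, the modules induced
from characters of the two maximal parabolic subalgebras, the one-dimensional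
ones, and one of dimension two. At v = 1 they become representations of the
group, whose characters separate its conjugacy classes ([separation]). Hence
in a linear relation all coefficients vanish at v = 1; division by v - 1 and
iteration show that they are divisible by all powers of v - 1, so they are 0.

The group is handled in integral coordinates ([elt]), in which the length is a
sum of four absolute values ([len]) and conjugacy is decided by an explicit
invariant ([cls_inv]), so that the combinatorics becomes linear arithmetic. *)

Set Implicit Arguments.
Unset Strict Implicit.
Unset Printing Implicit Defensive.
Import Order.TTheory GRing.Theory Num.Theory.
Local Open Scope classical_set_scope.
Local Open Scope ring_scope.

(** [(p, q, (s, e, f))] stands for t^(p eps1 + q eps2) g, where g swaps the
coordinates of (a, b) if [s] holds and then changes the sign of the first one
if [e], of the second one if [f]. As a = p + q/2 and b = q/2, the integers
2a, 2b, a - b, a + b are 2p + q, q, p, p + q. *)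
Definition elt : Type := (int * int * (bool * bool * bool))%type.

Definition negif (b : bool) (x : int) : int := if b then - x else x.

(** First eps-coordinate of g (p eps1 + q eps2); it is a - b for the image point
(a, b). *)
Definition actp (g : bool * bool * bool) (p q : int) : int :=
  let: (s, e, f) := g in
  negif (if e (+) f then e else e (+) s) (if e (+) f then p + q else p).
Definition actq (g : bool * bool * bool) (p q : int) : int :=
  let: (s, e, f) := g in negif f (if s then 2 * p + q else q).

Definition idw : bool * bool * bool := (false, false, false).

Definition mulw (g k : bool * bool * bool) : bool * bool * bool :=
  let: (s, e, f) := g in let: (s', e', f') := k in
  (s (+) s', e (+) (if s then f' else e'), f (+) (if s then e' else f')).

Definition mule (x y : elt) : elt :=
  (x.1.1 + actp x.2 y.1.1 y.1.2, x.1.2 + actq x.2 y.1.1 y.1.2, mulw x.2 y.2).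

Inductive gen := S0 | S1 | S2 | Tau.
Definition is_refl (i : gen) : bool := if i is Tau then false else true.

Definition elt1 : elt := (0, 0, (false, false, false)).
Definition gen_elt (i : gen) : elt :=
  match i with
  | S0 => (1, 0, (false, true, false))
  | S1 => (0, 0, (true, false, false))
  | S2 => (0, 0, (false, false, true))
  | Tau => (0, 1, (true, true, true))
  end.

Definition lmul_gen (i : gen) (x : elt) : elt :=
  let: (p, q, (s, e, f)) := x in
  match i with
  | S0 => (1 - p - q, q, (s, ~~ e, f))
  | S1 => (- p, 2 * p + q, (~~ s, f, e))
  | S2 => (p + q, - q, (s, e, ~~ f))
  | Tau => (p, 1 - 2 * p - q, (~~ s, ~~ f, ~~ e))
  end.

Lemma triple_eq (T1 T2 T3 : Type) (a a' : T1) (b b' : T2) (c c' : T3) :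
  a = a' -> b = b' -> c = c' -> (a, b, c) = (a', b', c').
Proof. by move=> -> -> ->. Qed.

Lemma mul_gen_elt i x : mule (gen_elt i) x = lmul_gen i x.
Proof.
case: x => [[p q] [[s e] f]]; rewrite /mule.
by case: i; case: s; case: e; case: f; apply: triple_eq; rewrite //= /actp /actq /=; lia.
Qed.

Definition mk2 (a b c d : int) : 'M[int]_2 :=
  \matrix_(i, j) (if i == 0 then if j == 0 then a else b
                  else if j == 0 then c else d).
Definition cv (a b : int) : coweight := \col_i (if i == 0 then a else b).

Lemma mk2M a b c d a' b' c' d' :
  mk2 a b c d * mk2 a' b' c' d' =
  mk2 (a * a' + b * c') (a * b' + b * d') (c * a' + d * c') (c * b' + d * d').
Proof.
apply/matrixP=> i j; rewrite !mxE big_ord_recl big_ord1 !mxE.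
by case: i => [[|[|[]]]] //= ?; case: j => [[|[|[]]]].
Qed.

Lemma mk2cv a b c d x y :
  mk2 a b c d *m cv x y = cv (a * x + b * y) (c * x + d * y).
Proof.
apply/matrixP=> i j; rewrite !mxE big_ord_recl big_ord1 !mxE.
by case: i => [[|[|[]]]].
Qed.

Lemma cvD x y x' y' : cv x y + cv x' y' = cv (x + x') (y + y').
Proof. by apply/matrixP=> i j; rewrite !mxE; case: ifP. Qed.
Lemma cvN x y : - cv x y = cv (- x) (- y).
Proof. by apply/matrixP=> i j; rewrite !mxE; case: ifP. Qed.
Lemma cvZ a x y : a *: cv x y = cv (a * x) (a * y).
Proof. by apply/matrixP=> i j; rewrite !mxE; case: ifP. Qed.
Lemma cv_inj x y x' y' : cv x y = cv x' y' -> x = x' /\ y = y'.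
Proof. by move/matrixP => h; split; [have := h 0 0|have := h 1 0]; rewrite !mxE. Qed.
Lemma cv_ex (u : coweight) : u = cv (u 0 0) (u 1 0).
Proof.
apply/matrixP=> i j; rewrite !mxE ord1.
case: i => [[|[|[]]]] //= ?; congr (u _ _); exact: val_inj.
Qed.
Lemma Lambda1E : Lambda1 = cv 1 0.
Proof. by apply/matrixP=> i j; rewrite !mxE ord1; case: i => [[|[|[]]]]. Qed.
Lemma eps2E : eps2 = cv 0 1.
Proof. by apply/matrixP=> i j; rewrite !mxE ord1; case: i => [[|[|[]]]]. Qed.
Lemma Lambda2E : Lambda2 = cv 0 2.
Proof. by rewrite /Lambda2 eps2E cvZ. Qed.
Lemma zero_cv : 0 = cv 0 0.
Proof. by apply/matrixP=> i j; rewrite !mxE; case: ifP. Qed.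
Lemma one_mk2 : 1 = mk2 1 0 0 1.
Proof.
apply/matrixP=> i j; rewrite !mxE.
by case: i => [[|[|[]]]] //= ?; case: j => [[|[|[]]]].
Qed.
Lemma s1_mk2 : s1_mx = mk2 (-1) 0 2 1.
Proof.
apply/matrixP=> i j; rewrite s1_mxE mxE.
by case: i => [[|[|[]]]] //= ?; case: j => [[|[|[]]]].
Qed.
Lemma s2_mk2 : s2_mx = mk2 1 1 0 (-1).
Proof.
apply/matrixP=> i j; rewrite s2_mxE mxE.
by case: i => [[|[|[]]]] //= ?; case: j => [[|[|[]]]].
Qed.

Definition smat (g : bool * bool * bool) : 'M[int]_2 :=
  mk2 (actp g 1 0) (actp g 0 1) (actq g 1 0) (actq g 0 1).

Lemma smat_mul g k : smat g * smat k = smat (mulw g k).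
Proof.
by move: g k => [[s e] f] [[s' e'] f']; rewrite /smat mk2M;
  case: s; case: e; case: f; case: s'; case: e'; case: f'.
Qed.

Lemma smat_act g p q : smat g *m cv p q = cv (actp g p q) (actq g p q).
Proof.
move: g => [[s e] f]; rewrite /smat mk2cv.
by congr cv; case: s; case: e; case: f; rewrite /actp /actq /=; lia.
Qed.

Lemma smat1 : smat (false, false, false) = 1. Proof. by rewrite one_mk2. Qed.
Lemma smat_s1 : smat (true, false, false) = s1_mx. Proof. by rewrite s1_mk2. Qed.
Lemma smat_s2 : smat (false, false, true) = s2_mx. Proof. by rewrite s2_mk2. Qed.

Lemma smat_inj g k : smat g = smat k -> g = k.
Proof.
move/matrixP=> h.
have := h 0 0; have := h 1 0; have := h 0 1; have := h 1 1; clear h; rewrite !mxE /=.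
by move: g k => [[s e] f] [[s' e'] f'];
  case: s; case: e; case: f; case: s'; case: e'; case: f'.
Qed.

Lemma smat_weyl g : smat g \in weyl.
Proof.
have h1 := weyl_s1; have h2 := weyl_s2; rewrite -smat_s1 -smat_s2 in h1 h2.
have h3 : smat (false, true, false) \in weyl.
  by have := weylM (weylM h1 h2) h1; rewrite !smat_mul.
move: g => [[s e] f].
have -> : smat (s, e, f) =
    (if e then smat (false, true, false) else 1) *
    (if f then smat (false, false, true) else 1) *
    (if s then smat (true, false, false) else 1).
  by case: s; case: e; case: f; rewrite -?smat1 !smat_mul.
by do 2?apply: weylM; case: ifP => // _; exact: weyl1.
Qed.

Definition dec (x : elt) : ext_affine :=
  @ExtAffine (cv x.1.1 x.1.2, smat x.2) (smat_weyl x.2).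

Lemma ea_eq (x y : ext_affine) : transl x = transl y -> lin x = lin y -> x = y.
Proof.
case: x y => [[u g] gW] [[u' g'] gW'] h1 h2; apply: val_inj; congr pair; assumption.
Qed.

Lemma dec_mul x y : dec (mule x y) = (dec x * dec y)%g.
Proof.
apply: ea_eq => /=; last by rewrite /lin /= smat_mul.
by rewrite /transl /lin /= smat_act cvD.
Qed.

Lemma dec1 : dec elt1 = 1%g.
Proof. by apply: ea_eq; rewrite /transl /lin /= -?zero_cv ?smat1. Qed.

Lemma dec_injective : injective dec.
Proof.
move=> [[p q] g] [[p' q'] g'] /(congr1 ea_val) [/cv_inj[-> ->]].
by move/smat_inj => ->.
Qed.

Lemma weyl_smat m : m \in weyl -> exists g, m = smat g.
Proof.
move=> /asboolP[r + ->]; elim: r => [_|s r IH /= /andP[sS /IH[g eg]]].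
  by exists (false, false, false); rewrite big_nil smat1.
rewrite big_cons eg; move: sS; rewrite !(in_cons, in_nil, orbF) => /orP[] /eqP->.
  by rewrite -smat_s1 smat_mul; eexists.
by rewrite -smat_s2 smat_mul; eexists.
Qed.

Lemma dec_surj w : exists x, w = dec x.
Proof.
have [g eg] := weyl_smat (ea_weyl w).
exists (transl w 0 0, transl w 1 0, g); apply: ea_eq => //; exact: cv_ex.
Qed.

Definition enc (w : ext_affine) : elt := projT1 (cid (dec_surj w)).
Lemma encK w : dec (enc w) = w.
Proof. by rewrite /enc; case: cid. Qed.
Lemma decK x : enc (dec x) = x.
Proof. by apply: dec_injective; rewrite encK. Qed.

Lemma muleA : associative mule.
Proof. by move=> x y z; apply: dec_injective; rewrite !dec_mul mulgA. Qed.
Lemma mul1e : left_id elt1 mule.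
Proof. by move=> x; apply: dec_injective; rewrite dec_mul dec1 mul1g. Qed.
Lemma mule1 : right_id elt1 mule.
Proof. by move=> x; apply: dec_injective; rewrite dec_mul dec1 mulg1. Qed.

Lemma dec_t u : t u = dec (u 0 0, u 1 0, (false, false, false)).
Proof. by apply: ea_eq; rewrite /transl /lin /= ?smat1 -?cv_ex. Qed.
Lemma dec_tcv a b : t (cv a b) = dec (a, b, (false, false, false)).
Proof. by rewrite dec_t !mxE. Qed.
Lemma dec_s1 : s1 = dec (gen_elt S1).
Proof. by apply: ea_eq; rewrite /transl /lin /= ?smat_s1 -?zero_cv. Qed.
Lemma dec_s2 : s2 = dec (gen_elt S2).
Proof. by apply: ea_eq; rewrite /transl /lin /= ?smat_s2 -?zero_cv. Qed.
Lemma dec_s0 : s0 = dec (gen_elt S0).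
Proof. by rewrite /s0 Lambda1E dec_tcv dec_s1 dec_s2 -!dec_mul. Qed.
Lemma dec_tau : tau = dec (gen_elt Tau).
Proof. by rewrite /tau eps2E dec_tcv dec_s1 dec_s2 -!dec_mul. Qed.

Lemma dec_lmul_gen i x : dec (lmul_gen i x) = (dec (gen_elt i) * dec x)%g.
Proof. by rewrite -mul_gen_elt dec_mul. Qed.

Lemma lmul_genK i : involutive (lmul_gen i).
Proof.
move=> x; rewrite -!mul_gen_elt muleA -[RHS]mul1e; congr mule.
by rewrite mul_gen_elt; case: i.
Qed.

(** * The length function *)
(** The number of lines 2a = n, 2b = n, a - b = n, a + b = n separating the
fundamental alcove 0 < b < a < 1/2 from its image under [x]. For each of the
four positive roots, this is the absolute value of the integer part of the
root on the image alcove, and the booleans subtract 1 where the linear part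
makes the root negative on the alcove. *)
Definition len (x : elt) : nat :=
  let: (p, q, (s, e, f)) := x in
  let u := (if s then ~~ f else e) in
  let w := (if s then f else e) in
  (absz (2 * p + q - e%:Z)%R + absz (q - f%:Z)%R + absz (p - u%:Z)%R
   + absz (p + q - w%:Z)%R)%N.

Lemma len_lmul_gen i x : is_refl i ->
  (len (lmul_gen i x) = (len x).+1 \/ (len (lmul_gen i x)).+1 = len x)%N.
Proof.
case: x => [[p q] [[s e] f]].
by case: i => //; case: s; case: e; case: f; rewrite /=; lia.
Qed.

Lemma len_tau x : len (lmul_gen Tau x) = len x.
Proof.
by case: x => [[p q] [[s e] f]]; case: s; case: e; case: f; rewrite /=; lia.
Qed.

Definition desc i x := is_refl i && (len (lmul_gen i x) < len x)%N.

(** Multiplication by the longest element of the dihedral group generated by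
[i] and [j], of length [dih_len i j]. *)
Definition dih (i j : gen) (x : elt) : elt :=
  match i, j with
  | S0, S2 | S2, S0 => lmul_gen i (lmul_gen j x)
  | _, _ => lmul_gen i (lmul_gen j (lmul_gen i (lmul_gen j x)))
  end.
Definition dih_len (i j : gen) : nat :=
  match i, j with S0, S2 | S2, S0 => 2 | _, _ => 4 end.

(** An element with two distinct left descents is reduced on the left by the
whole longest element of the dihedral group that they generate. This is the
geometric input of the independence of the operators of a word from the
choice of the word. *)
Lemma desc2 i j x : i <> j -> desc i x -> desc j x ->
  (len (dih i j x) + dih_len i j = len x)%N.
Proof.
case: x => [[p q] [[s e] f]]; rewrite /desc.
by case: i; case: j=> //; case: s; case: e; case: f; rewrite /=; move=> _; lia.
Qed.

(** An alcove on the same side of the three walls as the fundamental one is the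
fundamental one, and only 1 and tau fix it. *)
Lemma no_desc x : ~~ desc S0 x -> ~~ desc S1 x -> ~~ desc S2 x ->
  x = elt1 \/ x = gen_elt Tau.
Proof.
case: x => [[p q] [[s e] f]]; rewrite /desc.
case: s; case: e; case: f; rewrite /= => ???; (try (exfalso; lia)); [right|left];
  by apply: triple_eq => //; lia.
Qed.

Lemma lenE0 x : len x = 0%N -> x = elt1 \/ x = gen_elt Tau.
Proof. by move=> h; apply: no_desc; rewrite /desc h ltn0 andbF. Qed.

Lemma desc_ex x : (0 < len x)%N -> exists i, desc i x.
Proof.
move=> h; case: (boolP (desc S0 x)) => h0; first by exists S0.
case: (boolP (desc S1 x)) => h1; first by exists S1.
case: (boolP (desc S2 x)) => h2; first by exists S2.
by move: h; have [->|->] := no_desc h0 h1 h2.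
Qed.

Lemma desc_len i x : desc i x -> len x = (len (lmul_gen i x)).+1.
Proof. by case/andP=> hi; have [] := len_lmul_gen x hi; lia. Qed.

Lemma simple_reflsP w : w \in simple_refls -> exists2 i, is_refl i & w = dec (gen_elt i).
Proof.
rewrite !in_cons in_nil orbF => /or3P[] /eqP->;
  [exists S0|exists S1|exists S2] => //; [exact: dec_s0|exact: dec_s1|exact: dec_s2].
Qed.

Lemma is_refl_simple i : is_refl i -> dec (gen_elt i) \in simple_refls.
Proof.
by case: i => // _; rewrite !in_cons -?dec_s0 -?dec_s1 -?dec_s2 eqxx ?orbT.
Qed.

Lemma word_bound x n : has_word (dec x) n -> (len x <= n)%N.
Proof.
move=> [r [+ <- +]]; elim: r x => [|s r IH] x /=.
  by rewrite big_nil -dec1 => _ /dec_injective ->.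
case/andP=> /simple_reflsP[i hi ->] hr; rewrite big_cons => ex.
suff /(IH _ hr) : dec (lmul_gen i x) = (\prod_(s <- r) s)%g.
  by have [] := len_lmul_gen x hi; lia.
by rewrite dec_lmul_gen ex mulgA -dec_mul mul_gen_elt -[gen_elt i]mule1 mul_gen_elt lmul_genK dec1 mul1g.
Qed.

Definition oddp (x : elt) : bool := odd (absz x.1.1).
Definition oddq (x : elt) : bool := odd (absz x.1.2).

Lemma oddq_lmul_gen i x : oddq (lmul_gen i x) = ~~ is_refl i (+) oddq x.
Proof. by case: x => [[p q] [[s e] f]]; rewrite /oddq; case: i; rewrite /=; lia. Qed.

Lemma word_ex x : ~~ oddq x -> has_word (dec x) (len x).
Proof.
elim: {x}(len x) {-2}x (erefl (len x)) => [|n IH] x hx ex.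
  exists [::]; rewrite big_nil; split=> //.
  by have [|->|ex'] := lenE0 (x := x); rewrite ?dec1 //; move: ex; rewrite ex'.
have [|i di] := desc_ex (x := x); first by rewrite hx.
have ri : is_refl i by case/andP: di.
have [| |r [h1 h2 h3]] := IH (lmul_gen i x).
- by have := desc_len di; lia.
- by rewrite oddq_lmul_gen ri.
exists (dec (gen_elt i) :: r); split.
- by rewrite /= h1 andbT; move: (is_refl_simple ri).
- by rewrite /= h2 -(desc_len di).
- by rewrite big_cons -h3 -dec_lmul_gen lmul_genK.
Qed.

Lemma cox_lengthE x : ~~ oddq x -> cox_length (dec x) = len x.
Proof.
move=> ex; rewrite /cox_length.
have h : has_word (dec x) (len x) /\ forall k, has_word (dec x) k -> (len x <= k)%N.
  by split; [exact: word_ex|move=> k; exact: word_bound].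
apply: xget_unique => //= n [hn1 hn2].
by apply/eqP; rewrite eqn_leq (hn2 _ h.1) (h.2 _ hn1).
Qed.

Lemma affine_weylE x : affine_weyl (dec x) <-> ~~ oddq x.
Proof.
case: x => [[p q] g]; rewrite /affine_weyl /transl /oddq /= Lambda1E Lambda2E; split.
  by move=> [a [b]]; rewrite !cvZ cvD => /cv_inj[_ ->]; lia.
move=> h; exists p, (q %/ 2)%Z; rewrite !cvZ cvD; congr cv; lia.
Qed.

Lemma len_rtau x : len (mule x (gen_elt Tau)) = len x.
Proof.
case: x => [[p q] [[s e] f]].
by case: s; case: e; case: f; rewrite /= /actp /actq /=; lia.
Qed.

Lemma tauV : (tau^-1)%g = tau.
Proof.
apply: (@mulgI _ tau); rewrite mulgV dec_tau -dec_mul -dec1; congr dec.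
Qed.

(** Multiplication by tau permutes the alcove walls, so the extension of the
length by tau-invariance is still the number of separating lines. *)
Lemma ext_lengthE x : ext_length (dec x) = len x.
Proof.
rewrite /ext_length; case: asboolP => [/affine_weylE/cox_lengthE //|hx].
rewrite tauV dec_tau -dec_mul cox_lengthE ?len_rtau //.
have: ~~ ~~ oddq x by apply/negP => /affine_weylE.
case: x {hx} => [[p q] [[s e] f]]; rewrite /oddq.
by case: s; case: e; case: f; rewrite /= /actp /actq /=; lia.
Qed.

(** * The cocenter of the Hecke algebra *)

(** The indeterminate v - v^-1 of class polynomials. *)
Definition hv : laurent := v - vinv.

Definition ceq (H : algType laurent) (a b : H) : Prop := commutator_submodule (a - b).

Lemma csub0 (H : algType laurent) : commutator_submodule (0 : H).
Proof. by exists [::]; rewrite big_nil. Qed.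

Lemma csubD (H : algType laurent) (a b : H) :
  commutator_submodule a -> commutator_submodule b -> commutator_submodule (a + b).
Proof. by move=> [r ->] [r' ->]; exists (r ++ r'); rewrite big_cat. Qed.

Lemma csubZ (H : algType laurent) c (a : H) :
  commutator_submodule a -> commutator_submodule (c *: a).
Proof.
move=> [r ->]; exists [seq (c * p.1, p.2) | p <- r].
by rewrite big_map scaler_sumr; apply: eq_bigr => p _; rewrite scalerA.
Qed.

Lemma csub_comm (H : algType laurent) (a b : H) :
  commutator_submodule (a * b - b * a).
Proof. by exists [:: (1, (a, b))]; rewrite big_seq1 scale1r. Qed.

Lemma ceq_refl (H : algType laurent) (a : H) : ceq a a.
Proof. by rewrite /ceq subrr; exact: csub0. Qed.

Lemma ceq_sym (H : algType laurent) (a b : H) : ceq a b -> ceq b a.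
Proof. by move/(csubZ (-1)); rewrite scaleN1r opprB. Qed.

Lemma ceq_trans (H : algType laurent) (b a c : H) : ceq a b -> ceq b c -> ceq a c.
Proof. by move=> h1 h2; have := csubD h1 h2; rewrite addrA subrK. Qed.

Lemma ceqD (H : algType laurent) (a b a' b' : H) :
  ceq a b -> ceq a' b' -> ceq (a + a') (b + b').
Proof. by move=> h1 h2; have := csubD h1 h2; rewrite /ceq opprD addrACA. Qed.

Lemma ceqZ (H : algType laurent) c (a b : H) : ceq a b -> ceq (c *: a) (c *: b).
Proof. by move/(csubZ c); rewrite scalerBr. Qed.

Definition rmul_gen (x : elt) (i : gen) : elt := mule x (gen_elt i).
Definition conj_gen (i : gen) (x : elt) : elt := rmul_gen (lmul_gen i x) i.

Lemma rmul_genK i : involutive (rmul_gen^~ i).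
Proof.
move=> x; rewrite /rmul_gen -muleA mul_gen_elt -[RHS]mule1; congr mule; by case: i.
Qed.

Lemma len_gen_elt i : len (gen_elt i) = is_refl i.
Proof. by case: i. Qed.

Lemma len_rmul_gen i x : is_refl i ->
  (len (rmul_gen x i) = (len x).+1 \/ (len (rmul_gen x i)).+1 = len x)%N.
Proof.
case: x => [[p q] [[s e] f]].
by case: i => //; case: s; case: e; case: f; rewrite /= /actp /actq /=; lia.
Qed.

Section HeckeRelations.
Variables (H : algType laurent) (T : ext_affine -> H) (HT : hecke_algebra T).

Definition Tm (x : elt) : H := T (dec x).

Lemma TmM x y : (len x + len y = len (mule x y))%N -> Tm x * Tm y = Tm (mule x y).
Proof. by move=> h; rewrite /Tm dec_mul hecke_mul // -dec_mul !ext_lengthE. Qed.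

Lemma Tm_lup i x : len (lmul_gen i x) = (is_refl i + len x)%N ->
  Tm (gen_elt i) * Tm x = Tm (lmul_gen i x).
Proof. by move=> h; rewrite TmM mul_gen_elt // len_gen_elt. Qed.

Lemma Tm_rup i x : len (rmul_gen x i) = (is_refl i + len x)%N ->
  Tm x * Tm (gen_elt i) = Tm (rmul_gen x i).
Proof. by move=> h; rewrite TmM // len_gen_elt h addnC. Qed.

Lemma Tm1 : Tm elt1 = 1.
Proof.
have T1 : Tm elt1 * Tm elt1 = Tm elt1 by rewrite TmM.
have Ts x : Tm elt1 * Tm x = Tm x by rewrite TmM mul1e.
have [c [[cfin c1] _]] := hecke_basis HT 1.
have h : Tm elt1 * 1 = 1.
  rewrite {1}c1 {1}c1 mulr_sumr; apply: eq_bigr => w _.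
  by rewrite -scalerAr -[w]encK -/(Tm _) Ts.
by rewrite mulr1 in h.
Qed.

Lemma Tm_quad i : is_refl i -> Tm (gen_elt i) * Tm (gen_elt i) = hv *: Tm (gen_elt i) + 1.
Proof.
move/is_refl_simple/(hecke_quadratic HT); rewrite -/(Tm _).
rewrite mulrDr !mulrBl !mulr_algl !mulr_algr scalerA mulvV scale1r => h.
apply/eqP; rewrite -subr_eq0 -[X in _ == X]h /hv scalerBl; apply/eqP.
by rewrite !opprD !opprK !addrA; congr (_ - _); rewrite addrAC.
Qed.

Lemma Tm_tau : Tm (gen_elt Tau) * Tm (gen_elt Tau) = 1.
Proof. by rewrite Tm_lup // -Tm1. Qed.

(** The quadratic relation, in the form T_s T_x = h T_x + T_sx for sx < x. *)
Lemma Tm_ldown i x : desc i x ->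
  Tm (gen_elt i) * Tm x = hv *: Tm x + Tm (lmul_gen i x).
Proof.
move=> di; have ri : is_refl i by case/andP: di.
have e : Tm (gen_elt i) * Tm (lmul_gen i x) = Tm x.
  by rewrite Tm_lup lmul_genK // ri (desc_len di).
by rewrite -e mulrA Tm_quad // mulrDl mul1r -scalerAl e.
Qed.

(** If sx < x then T_x = T_s T_sx and T_sxs = T_sx T_s are exchanged by swapping
factors. If sx > x then T_s T_x = T_sxs T_s, and T_s is invertible with inverse
T_s - h. *)
Lemma ceq_conj i x : len (conj_gen i x) = len x -> ceq (Tm x) (Tm (conj_gen i x)).
Proof.
case ri: (is_refl i); last first.
  have -> : i = Tau by case: i ri.
  move=> h; have e : Tm (gen_elt Tau) * Tm x = Tm (lmul_gen Tau x) by rewrite Tm_lup // len_tau.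
  have e' : Tm (lmul_gen Tau x) * Tm (gen_elt Tau) = Tm (conj_gen Tau x).
    by rewrite Tm_rup // -/(conj_gen _ _) h len_tau.
  rewrite -e' -e; have := csub_comm (Tm (gen_elt Tau) * Tm x) (Tm (gen_elt Tau)).
  by rewrite mulrA Tm_tau mul1r => /(csubZ (-1)); rewrite scaleN1r opprB.
move=> h; case: (len_lmul_gen x ri) => hl; last first.
  have e : Tm (gen_elt i) * Tm (lmul_gen i x) = Tm x by rewrite Tm_lup lmul_genK // ri -hl.
  have e' : Tm (lmul_gen i x) * Tm (gen_elt i) = Tm (conj_gen i x).
    by rewrite Tm_rup // -/(conj_gen _ _) h -hl ri.
  by rewrite -e -e'; exact: csub_comm.
set y := conj_gen i x in h *.
have ey : rmul_gen y i = lmul_gen i x by rewrite /y /conj_gen rmul_genK.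
have e : Tm (gen_elt i) * Tm x = Tm y * Tm (gen_elt i).
  by rewrite Tm_lup ?ri // Tm_rup ey // ri hl h.
have q := Tm_quad ri.
have := csub_comm (Tm (gen_elt i) - hv%:A) (Tm y * Tm (gen_elt i)).
rewrite -{1}e mulrA mulrBl q mulr_algl (addrAC (_ *: _)) subrr add0r mul1r.
by rewrite -mulrA mulrBr q mulr_algr (addrAC (_ *: _)) subrr add0r mulr1.
Qed.

(** T_x = T_s T_sxs T_s is T_sxs T_s^2 modulo commutators. *)
Lemma ceq_down i x : is_refl i -> (len (conj_gen i x)).+2 = len x ->
  ceq (Tm x) (Tm (conj_gen i x) + hv *: Tm (lmul_gen i x)).
Proof.
move=> ri; set y := conj_gen i x => h.
have ey : rmul_gen y i = lmul_gen i x by rewrite /y /conj_gen rmul_genK.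
have l1 : (len (lmul_gen i x)).+1 = len x.
  by have := len_lmul_gen x ri; have := len_rmul_gen y ri; rewrite ey; lia.
have e : Tm (gen_elt i) * Tm (lmul_gen i x) = Tm x by rewrite Tm_lup lmul_genK // ri -l1.
have e' : Tm y * Tm (gen_elt i) = Tm (lmul_gen i x) by rewrite Tm_rup ey // ri; lia.
rewrite -{1}e -e'.
apply: (ceq_trans (csub_comm _ _)).
rewrite -mulrA Tm_quad // mulrDr mulr1 -scalerAr e' addrC; exact: ceq_refl.
Qed.

End HeckeRelations.

(** * Five families of representations *)

(** Position of an alcove with respect to one of its walls, seen from infinity:
on the positive side, on the negative side, or next to a wall that all
translates in the chosen direction share. In the last case the generator acts
by a scalar, v or - v^-1. *)
Inductive wall_side := Above | Below | Wall of bool.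

(** The combinatorial part of a representation: an index set with a right action
of the group and, for each index and generator, the position of the wall. The
representations are limits of the regular one far away in a direction of the
plane, where only the side of each wall matters and translations act by
scalars; the indices are the alcoves modulo translation. *)
Record rep_pattern := RepPattern {
  pidx : finType;
  pact : pidx -> elt -> pidx;
  pside : gen -> pidx -> wall_side }.

Section Operators.
Variables (F : fieldType) (u : F) (X : rep_pattern) (c : gen -> pidx X -> F).

(** Generators act on functions on the index set; [c i k] is the scalar by which
the translation that brings the neighbour back to its representative acts. *)
Definition op (i : gen) (m : pidx X -> F) : pidx X -> F := fun k =>
  match pside i k with
  | Wall b => (if b then u else - u^-1) * m k
  | Below => c i k * m (pact k (gen_elt i))
  | Above => (u - u^-1) * m k + c i k * m (pact k (gen_elt i))
  end.

Definition gtau (i : gen) : gen :=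
  match i with S0 => S2 | S2 => S0 | _ => i end.

Definition opdih (i j : gen) (m : pidx X -> F) : pidx X -> F :=
  match i, j with
  | S0, S2 | S2, S0 => op i (op j m)
  | _, _ => op i (op j (op i (op j m)))
  end.

(** The defining relations of the Hecke algebra, for the generators S1, S2, S0
and Tau. *)
Record is_rep : Prop := IsRep {
  rep_quad : forall i m, is_refl i -> op i (op i m) = fun k => (u - u^-1) * op i m k + m k;
  rep_tau : forall m, op Tau (op Tau m) = m;
  rep_gtau : forall i m, op Tau (op i m) = op (gtau i) (op Tau m);
  rep_dih : forall i j m, is_refl i -> is_refl j -> i <> j -> opdih i j m = opdih j i m }.
End Operators.

(** The principal series: the direction at infinity is regular and the indices
are the eight alcoves at the origin. *)
Definition princ : rep_pattern := @RepPattern (bool * bool * bool)%type (fun k x => mulw k x.2)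
  (fun i k => let: (s, e, f) := k in
     match i with
     | S0 => if (if s then f else e) then Above else Below
     | S1 => if s (+) e then Below else Above
     | S2 => if (if s then e else f) then Below else Above
     | Tau => Below
     end).
(** The character of P whose values on (1/2, 1/2) and (1/2, -1/2) are y and z. *)
Definition princ_char (F : fieldType) (y z : F) (k : bool * bool * bool) (x : elt) : F :=
  let p := actp k x.1.1 x.1.2 in let q := actq k x.1.1 x.1.2 in
  y ^ (p + q) * z ^ p.

Lemma princ_rep (F : fieldType) (u y z : F) : u != 0 -> y != 0 -> z != 0 ->
  @is_rep F u princ (fun i k => princ_char y z k (gen_elt i)).
Proof.
move=> u0 y0 z0.
set c := fun i k => _.
have: forall i k, c i k = let: (s, e, f) := k in
    match i with
    | S0 => if s then if f then z / y else y / z else if e then (y * z)^-1 else y * z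
    | Tau => if s then if e then if f then y^-1 else z^-1 else if f then z else y
             else if e then if f then y^-1 else z^-1 else if f then z else y
    | _ => 1
    end.
  by move=> i [[[] []] []]; case: i;
    rewrite /c /princ_char /actp /actq /= ?expr0z ?expr1z ?exprN1 ?invfM ?mulr1 ?mul1r // mulrC.
move: c => c g.
apply: IsRep => [i m ri|m|i m|i j m ri rj ij]; apply/funext => k; move: k => [[s e] f].
- by case: i ri => // _; case: s; case: e; case: f; rewrite /op /= ?g /=; field; rewrite ?u0 ?y0 ?z0.
- by case: s; case: e; case: f; rewrite /op /= ?g /=; field; rewrite ?u0 ?y0 ?z0.
- by case: i; case: s; case: e; case: f; rewrite /op /= ?g /=; field; rewrite ?u0 ?y0 ?z0.
- by case: i ri ij; case: j rj => // _ _ _; case: s; case: e; case: f; rewrite /opdih /op /= ?g /=; field; rewrite ?u0 ?y0 ?z0.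
Qed.

(** Induction from the parabolic subalgebra of s1: far away in the direction
(1, 1), where the walls a - b = n remain visible. An index is the linear form
a + b up to the signs of a and b. *)
Definition levi1 : rep_pattern := @RepPattern (bool * bool)%type
  (fun k x => let: (a, b) := k in let: (s, e, f) := x.2 in
     if s then (b (+) f, a (+) e) else (a (+) e, b (+) f))
  (fun i k => let: (a, b) := k in
     match i with
     | S0 => if a then Above else Below
     | S1 => if a == b then Wall true else if a then Below else Above
     | S2 => if b then Below else Above
     | Tau => Below
     end).
Definition levi1_exp (k : bool * bool) (x : elt) : int :=
  let: (a, b) := k in negif a (if a == b then x.1.1 + x.1.2 else x.1.1).
(** The sign separates the two cosets of Q in P. *)
Definition levi1_char (F : fieldType) (d : bool) (z : F) (k : bool * bool) (x : elt) : F :=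
  (-1) ^+ (d && odd (absz x.1.2)) * z ^ (levi1_exp k x).

Lemma levi1_rep (F : fieldType) (u z : F) d : u != 0 -> z != 0 ->
  @is_rep F u levi1 (fun i k => levi1_char d z k (gen_elt i)).
Proof.
move=> u0 z0.
set sg : F := (-1) ^+ d.
have sg2 : sg * sg = 1 by rewrite -expr2 sqrr_sign.
set c := fun i k => _.
have: forall i k, c i k = let: (a, b) := k in
    match i with
    | S0 => if a then z^-1 else z
    | Tau => sg * (if a == b then if a then z^-1 else z else 1)
    | _ => 1
    end.
  by move=> i [[] []]; case: i;
    rewrite /c /levi1_char /levi1_exp /= ?andbT ?andbF ?expr0z ?expr1z ?exprN1 ?invfM ?mulr1 ?mul1r.
move: c => c g.
apply: IsRep => [i m ri|m|i m|i j m ri rj ij]; apply/funext => k; move: k => [a b].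
- by case: i ri => // _; case: a; case: b; rewrite /op /= ?g /=; field; rewrite ?u0 ?z0.
- by case: a; case: b; rewrite /op /= ?g /= !mulrA ?mulr1 ?(mulrAC _ _ sg) ?sg2; field; rewrite ?z0.
- by case: i; case: a; case: b; rewrite /op /= ?g /=; field; rewrite ?u0 ?z0.
- by case: i ri ij; case: j rj => // _ _ _; case: a; case: b; rewrite /opdih /op /= ?g /=; field; rewrite ?u0 ?z0.
Qed.

(** Induction from the parabolic subalgebra of s2: far away in the direction
(1, 0), where the walls 2b = n remain visible. An index is the linear form a or
b up to sign. *)
Definition levi2 : rep_pattern := @RepPattern (bool * bool)%type
  (fun k x => let: (s, e) := k in let: (s', e', f') := x.2 in
     (s (+) s', e (+) (if s then f' else e')))
  (fun i k => let: (s, e) := k in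
     match i with
     | S0 => if s then Wall true else if e then Above else Below
     | S1 => if s == e then Above else Below
     | S2 => if s then if e then Below else Above else Wall true
     | Tau => Below
     end).
Definition levi2_exp (k : bool * bool) (x : elt) : int :=
  let: (s, e) := k in negif e (if s then x.1.2 else 2 * x.1.1 + x.1.2).
Definition levi2_char (F : fieldType) (z : F) (k : bool * bool) (x : elt) : F :=
  z ^ (levi2_exp k x).

Lemma levi2_rep (F : fieldType) (u z : F) : u != 0 -> z != 0 ->
  @is_rep F u levi2 (fun i k => levi2_char z k (gen_elt i)).
Proof.
move=> u0 z0.
set c := fun i k => _.
have: forall i k, c i k = let: (s, e) := k in
    match i with
    | S0 => if s then 1 else if e then (z * z)^-1 else z * z
    | Tau => if e then z^-1 else z
    | _ => 1
    end.
  move=> i [[] []]; case: i;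
    rewrite /c /levi2_char /levi2_exp /= ?expr0z ?expr1z ?exprN1 // -?exprnP //.
move: c => c g.
apply: IsRep => [i m ri|m|i m|i j m ri rj ij]; apply/funext => k; move: k => [a b].
- by case: i ri => // _; case: a; case: b; rewrite /op /= ?g /=; field; rewrite ?u0 ?z0.
- by case: a; case: b; rewrite /op /= ?g /=; field; rewrite ?z0.
- by case: i; case: a; case: b; rewrite /op /= ?g /=; field; rewrite ?u0 ?z0.
- by case: i ri ij; case: j rj => // _ _ _; case: a; case: b; rewrite /opdih /op /= ?g /=; field; rewrite ?u0 ?z0.
Qed.

(** T_S1 acts by v or - v^-1 according to [a], T_S0 and T_S2 according to [b], and
T_Tau by the sign of [c]. *)
Definition line (a b : bool) : rep_pattern := @RepPattern unit
  (fun k _ => k)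
  (fun i k => match i with S1 => Wall a | Tau => Below | _ => Wall b end).
Definition line_char (F : fieldType) (a b c : bool) (k : unit) (x : elt) : F :=
  let: (s, e, f) := x.2 in
  (-1) ^+ ((odd (absz x.1.2) && (c (+) ~~ a)) (+) (s && ~~ a) (+) ((e (+) f) && ~~ b)).

Lemma line_rep (F : fieldType) (u : F) a b c : u != 0 ->
  @is_rep F u (line a b) (fun i k => line_char F a b c k (gen_elt i)).
Proof.
move=> u0.
have sg2 : (-1) ^+ c * (-1) ^+ c = 1 :> F by rewrite -expr2 sqrr_sign.
have g k : line_char F a b c k (gen_elt Tau) = (-1) ^+ c.
  by case: a; case: b; case: c {sg2}.
case: a g; case: b => g.
all: apply: IsRep => [i m ri|m|i m|i j m ri rj ij]; apply/funext => -[].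
all: try by case: i ri => // _; rewrite /op /= ?g /=; field; rewrite ?u0.
all: try by rewrite /op /= ?g /= mulrA sg2 mul1r.
all: try by case: i; rewrite /op /= ?g /=; field; rewrite ?u0.
all: by case: i ri ij; case: j rj => // _ _ _; rewrite /opdih /op /= ?g /=; field; rewrite ?u0.
Qed.

(** T_S0 and T_S2 act by different eigenvalues, which T_Tau exchanges. This one
is needed to distinguish the two classes of half-turns with even coordinates. *)
Definition plane : rep_pattern := @RepPattern bool
  (fun k x => k (+) odd (absz x.1.2))
  (fun i k => match i with S1 => Wall true | S2 => Wall k | S0 => Wall (~~ k)
              | Tau => Below end).
Definition plane_char (F : fieldType) (k : bool) (x : elt) : F :=
  let: (s, e, f) := x.2 in
  (-1) ^+ (odd (absz x.1.1) (+) (~~ (k (+) odd (absz x.1.2)) && (e (+) f))).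

Lemma plane_rep (F : fieldType) (u : F) : u != 0 ->
  @is_rep F u plane (fun i k => plane_char F k (gen_elt i)).
Proof.
move=> u0.
set c := fun i k => _.
have: forall k, c Tau k = 1 by case.
move: c => c g.
apply: IsRep => [i m ri|m|i m|i j m ri rj ij]; apply/funext => k; move: k => [].
1,2: by case: i ri => // _; rewrite /op /= ?g /=; field; rewrite ?u0.
1,2: by rewrite /op /= ?g /= !mul1r.
1,2: by case: i; rewrite /op /= ?g /=; field; rewrite ?u0.
all: by case: i ri ij; case: j rj => // _ _ _; rewrite /opdih /op /= ?g /=; field; rewrite ?u0.
Qed.

(** * Operators attached to reduced words *)

(** The value S2 is meant for elements of positive length without the descents
S0 and S1; see [fdescP]. *)
Definition fdesc (x : elt) : gen :=
  if desc S0 x then S0 else if desc S1 x then S1 else S2.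

Fixpoint rword (n : nat) (x : elt) : seq gen :=
  if n is n'.+1 then fdesc x :: rword n' (lmul_gen (fdesc x) x)
  else if x == gen_elt Tau then [:: Tau] else [::].

(** A canonical reduced word, read off from a first left descent. *)
Definition word (x : elt) : seq gen := rword (len x) x.

Lemma fdescP x : (0 < len x)%N -> desc (fdesc x) x.
Proof.
move=> h; rewrite /fdesc; case: (boolP (desc S0 x)) => // h0.
case: (boolP (desc S1 x)) => // h1; case: (boolP (desc S2 x)) => // h2.
by move: h; have [->|->] := no_desc h0 h1 h2.
Qed.

Lemma word_cons x : (0 < len x)%N -> word x = fdesc x :: word (lmul_gen (fdesc x) x).
Proof. by move=> h; rewrite {1}/word (desc_len (fdescP h)). Qed.

Lemma wordTau : word (gen_elt Tau) = [:: Tau]. Proof. by []. Qed.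

Lemma dih_sym i j x : is_refl i -> is_refl j -> i <> j -> dih i j x = dih j i x.
Proof.
case: x => [[p q] [[s e] f]].
by case: i => //; case: j => // _ _ _; rewrite /dih /lmul_gen; apply: triple_eq;
   rewrite ?negbK //; lia.
Qed.

Lemma gen_dec (i j : gen) : i = j \/ i <> j.
Proof. by case: i; case: j; (try by left); right. Qed.

Lemma drop4 (a0 a1 a2 a3 a4 : nat) :
  (a1 = a0.+1 \/ a1.+1 = a0) -> (a2 = a1.+1 \/ a2.+1 = a1) ->
  (a3 = a2.+1 \/ a3.+1 = a2) -> (a4 = a3.+1 \/ a4.+1 = a3) ->
  (a4 + 4 = a0)%N -> [/\ (a2 < a1)%N, (a3 < a2)%N & (a4 < a3)%N].
Proof. by move=> ? ? ? ? ?; split; lia. Qed.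

(** Each multiplication changes the length by one, so a total drop by the length
of the longest dihedral element forces a drop at every step. *)
Lemma desc_chain k l x : k <> l -> desc k x -> desc l x ->
  if dih_len l k == 2%N then is_true (desc l (lmul_gen k x)) else
  [/\ desc l (lmul_gen k x), desc k (lmul_gen l (lmul_gen k x)) &
      desc l (lmul_gen k (lmul_gen l (lmul_gen k x)))].
Proof.
move=> kl dk dl; have e := desc2 (nesym kl) dl dk.
have [rk rl] : is_refl k /\ is_refl l by case/andP: dk; case/andP: dl.
have h1 := len_lmul_gen x rk; have h2 := len_lmul_gen (lmul_gen k x) rl.
have h3 := len_lmul_gen (lmul_gen l (lmul_gen k x)) rk.
have h4 := len_lmul_gen (lmul_gen k (lmul_gen l (lmul_gen k x))) rl.
have d4 := drop4 h1 h2 h3 h4.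
case: k l kl rk rl {dk dl h3 h4} d4 h1 h2 e => [] [] // _ _ _ d4 h1 h2 e; rewrite /= /desc /=;
  by [apply: d4|move: e h1 h2; rewrite /=; clear; lia].
Qed.

Section Image.
Variables (F : fieldType) (u : F) (X : rep_pattern) (c : gen -> pidx X -> F).
Hypothesis HR : is_rep u c.
Local Notation op := (op u c).

(** The operator by which T_x acts. *)
Definition opw (x : elt) (m : pidx X -> F) : pidx X -> F := foldr op m (word x).

Lemma opw_fdesc x m : (0 < len x)%N ->
  opw x m = op (fdesc x) (opw (lmul_gen (fdesc x) x) m).
Proof. by move=> h; rewrite /opw word_cons. Qed.

(** The operator of [x] can be computed from any left descent, by induction on
the length. If [i] differs from the first letter [j], then [x] is reduced on the
left by the longest element of the dihedral group of [i] and [j]; both words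
can be continued through it, and the braid relation identifies the operators. *)
Lemma opw_desc i x m : desc i x -> opw x m = op i (opw (lmul_gen i x) m).
Proof.
elim/ltn_ind: {x}(len x) {-2}x (erefl (len x)) i => n IH x en i di.
have lx : (0 < len x)%N by rewrite (desc_len di).
rewrite opw_fdesc //; have := fdescP lx; set j := fdesc x => dj.
have [->//|ij] := gen_dec i j.
have [ri rj] : is_refl i /\ is_refl j by case/andP: di; case/andP: dj.
have drop k y : desc k y -> (len (lmul_gen k y) < len y)%N by case/andP.
have step k y : desc k y -> (len y < n)%N ->
      opw y m = op k (opw (lmul_gen k y) m) /\ (len (lmul_gen k y) < n)%N.
  by move=> dk ly; split; [exact: (IH _ ly y)|exact: ltn_trans (drop _ _ dk) ly].
(* Continue the word of x along the whole dihedral element, starting with k. *)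
have chain k l : k <> l -> desc k x -> desc l x ->
    op k (opw (lmul_gen k x) m) = opdih u c k l (opw (dih l k x) m).
  move=> kl dk dl; have := desc_chain kl dk dl.
  have l0 : (len (lmul_gen k x) < n)%N by rewrite -en drop.
  case: k l kl dk dl l0 => [] [] // _ dk dl l0 /=; rewrite /opdih /dih;
    by [move=> d; have [-> _] := step _ _ d l0
       |case=> d1 d2 d3; have [-> l1] := step _ _ d1 l0;
        have [-> l2] := step _ _ d2 l1; have [-> _] := step _ _ d3 l2].
rewrite (chain j i (nesym ij)) // (chain i j ij) // (dih_sym x ri rj ij).
by apply: (rep_dih HR) => //; exact: nesym.
Qed.

Lemma lmul_gen_gtau i x : lmul_gen Tau (lmul_gen i x) = lmul_gen (gtau i) (lmul_gen Tau x).
Proof.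
case: x => [[p q] [[s e] f]].
by case: i; rewrite /lmul_gen /=; apply: triple_eq; rewrite ?negbK //; lia.
Qed.

Lemma opw_tau x m : opw (lmul_gen Tau x) m = op Tau (opw x m).
Proof.
elim: {x}(len x) {-2}x (erefl (len x)) => [|n IH] x lx.
  have [->|->] := lenE0 lx; first by rewrite -mul_gen_elt mule1.
  by rewrite /opw wordTau /= (rep_tau HR).
have [i di] : exists i, desc i x by apply: desc_ex; rewrite lx.
have di' : desc (gtau i) (lmul_gen Tau x).
  move: di; rewrite /desc -lmul_gen_gtau !len_tau => /andP[ri ->].
  by rewrite andbT; case: (i) ri.
rewrite (opw_desc _ di') -lmul_gen_gtau IH; last by move: (desc_len di); rewrite lx => -[].
by rewrite -(rep_gtau HR) -(opw_desc _ di).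
Qed.

Lemma opw_up i x m : len (lmul_gen i x) = (is_refl i + len x)%N ->
  opw (lmul_gen i x) m = op i (opw x m).
Proof.
case ri: (is_refl i) => h; last first.
  have -> : i = Tau by case: (i) ri.
  exact: opw_tau.
have di : desc i (lmul_gen i x) by rewrite /desc ri lmul_genK h ltnSn.
by rewrite (opw_desc _ di) lmul_genK.
Qed.

Lemma opw_down i x m : desc i x ->
  op i (opw x m) = fun k => (u - u^-1) * opw x m k + opw (lmul_gen i x) m k.
Proof.
by move=> di; rewrite (opw_desc m di) (rep_quad HR) //; case/andP: di.
Qed.

Lemma op_lin i a m m' :
  op i (fun k => a * m k + m' k) = fun k => a * op i m k + op i m' k.
Proof.
by apply/funext => k; rewrite /op; case: (pside i k) => [||b]; ring.
Qed.

Lemma opw_lin x a m m' :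
  opw x (fun k => a * m k + m' k) = fun k => a * opw x m k + opw x m' k.
Proof. by rewrite /opw; elim: (word x) => //= i r ->; rewrite op_lin. Qed.

End Image.

(** * Characters at v = 1 *)
Section Specialization.
Variables (F : fieldType) (X : rep_pattern) (chi : pidx X -> elt -> F).

(** At v = 1 the operators are monomial: they permute the indices and multiply
by scalars [chi], which must then satisfy the cocycle identity of an induced
representation. *)
Definition is_cocycle : Prop :=
  (forall k, pact k elt1 = k /\ chi k elt1 = 1) /\
  forall i k x, match pside i k with
    | Wall b => pact k (lmul_gen i x) = pact k x /\
                chi k (lmul_gen i x) = (if b then 1 else -1) * chi k x
    | _ => pact k (lmul_gen i x) = pact (pact k (gen_elt i)) x /\
           chi k (lmul_gen i x) = chi k (gen_elt i) * chi (pact k (gen_elt i)) x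
    end.

Lemma opw_cocycle x m k : is_cocycle ->
  opw 1 (fun i k => chi k (gen_elt i)) x m k = chi k x * m (pact k x).
Proof.
move=> [h1 hs]; rewrite /opw.
have {2 3}-> : x = foldr lmul_gen elt1 (word x).
  elim: {x}(len x) {-2}x (erefl (len x)) => [|n IH] x lx.
    by have [->|->] := lenE0 lx; rewrite ?wordTau //= -mul_gen_elt mule1.
  have l0 : (0 < len x)%N by rewrite lx.
  rewrite word_cons //= -IH ?lmul_genK //.
  by move: (desc_len (fdescP l0)); rewrite lx => -[].
elim: (word x) k => [|i r IH] k /=; first by have [-> ->] := h1 k; rewrite mul1r.
move: (hs i k (foldr lmul_gen elt1 r)); rewrite {1}/op; case: (pside i k) => [||b] [-> ->].
- by rewrite invr1 subrr mul0r add0r IH mulrA.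
- by rewrite IH mulrA.
- by rewrite invr1 IH mulrA.
Qed.
End Specialization.

Lemma mulwA g h k : mulw (mulw g h) k = mulw g (mulw h k).
Proof. exact: esym (congr1 snd (muleA (0, 0, g) (0, 0, h) (0, 0, k))). Qed.

Lemma actpD g p q p' q' : actp g (p + p') (q + q') = actp g p q + actp g p' q'.
Proof. by move: g => [[[] []] []]; rewrite /actp /=; ring. Qed.

Lemma actqD g p q p' q' : actq g (p + p') (q + q') = actq g p q + actq g p' q'.
Proof. by move: g => [[[] []] []]; rewrite /actq /=; ring. Qed.

Lemma act_mul g h p q :
  actp (mulw g h) p q = actp g (actp h p q) (actq h p q) /\
  actq (mulw g h) p q = actq g (actp h p q) (actq h p q).
Proof.
by move: g h => [[[] []] []] [[[] []] []]; rewrite /actp /actq /=; split; ring.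
Qed.

Lemma princ_cocycle (F : fieldType) (y z : F) : y != 0 -> z != 0 ->
  @is_cocycle F princ (princ_char y z).
Proof.
move=> y0 z0; split=> [[[s e] f]|i k x].
  by rewrite /princ_char /=; case: s; case: e; case: f; rewrite ?expr0z ?mulr1.
suff h : pact k (lmul_gen i x) = pact (pact k (gen_elt i)) x /\
    princ_char y z k (lmul_gen i x) = princ_char y z k (gen_elt i) * princ_char y z (pact k (gen_elt i)) x.
  have: forall b, pside i k <> Wall b.
    by move: k {h} => [[[] []] []]; case: i.
  by case: (pside i k) => [//|//|b] /(_ b).
rewrite -mul_gen_elt; split; first by rewrite /= mulwA.
rewrite /princ_char /= mulrACA -!expfzDr // actpD actqD.
have [-> ->] := act_mul k (gen_elt i).2 x.1.1 x.1.2.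
by rewrite addrACA.
Qed.

Lemma levi1_lmul i k x : pact (r := levi1) k (lmul_gen i x) = pact (pact k (gen_elt i)) x /\
  levi1_exp k (lmul_gen i x) = levi1_exp k (gen_elt i) + levi1_exp (pact (r := levi1) k (gen_elt i)) x.
Proof.
case: x k => [[p q] w] [a b]; split.
  by move: w => [[s e] f]; case: i; case: a; case: b; case: s; case: e; case: f.
by case: i; case: a; case: b; case: w => [[s e] f]; rewrite /levi1_exp /=; ring.
Qed.

Lemma levi2_lmul i k x : pact (r := levi2) k (lmul_gen i x) = pact (pact k (gen_elt i)) x /\
  levi2_exp k (lmul_gen i x) = levi2_exp k (gen_elt i) + levi2_exp (pact (r := levi2) k (gen_elt i)) x.
Proof.
case: x k => [[p q] w] [a b]; split.
  by move: w => [[s e] f]; case: i; case: a; case: b; case: s; case: e; case: f.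
by case: i; case: a; case: b; case: w => [[s e] f]; rewrite /levi2_exp /=; ring.
Qed.

Lemma oddp_lmul_gen i x : oddp (lmul_gen i x) =
  match i with S0 => ~~ (oddp x (+) oddq x) | S2 => oddp x (+) oddq x | _ => oddp x end.
Proof. by case: x => [[p q] [[s e] f]]; rewrite /oddp /oddq; case: i; rewrite /=; lia. Qed.

Lemma levi1_cocycle (F : fieldType) (z : F) d : z != 0 -> @is_cocycle F levi1 (levi1_char d z).
Proof.
move=> z0; split=> [[a b]|i k x].
  by rewrite /levi1_char /levi1_exp /= andbF !addbF; case: a; case: b; rewrite ?expr0z ?mulr1.
have [h1 h2] := levi1_lmul i k x.
have h3 : levi1_char d z k (lmul_gen i x) = levi1_char d z k (gen_elt i) * levi1_char d z (pact (r := levi1) k (gen_elt i)) x.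
  rewrite /levi1_char h2 expfzDr // mulrACA -signr_addb -!/(oddq _) oddq_lmul_gen.
  by congr ((-1) ^+ _ * _); case: i {h1 h2}; case: d.
have: forall b, pside (r := levi1) i k = Wall b -> b = true /\ i = S1 /\ k.1 = k.2.
  by move: (k) => [[] []]; case: (i) => //= b [<-].
case E: (pside i k) => [||b] => [//|//|/(_ b erefl) [-> [ei ek]]].
have pk : pact (r := levi1) k (gen_elt i) = k by rewrite ei /=; case: (k) ek => a b' /= ->; rewrite !addbF.
rewrite {1}h1 h3 pk; split => //; congr (_ * _).
by rewrite ei /levi1_char /levi1_exp /= andbF; case: (k) => [[] []]; rewrite ?expr0z mulr1.
Qed.

Lemma levi2_cocycle (F : fieldType) (z : F) : z != 0 -> @is_cocycle F levi2 (levi2_char z).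
Proof.
move=> z0; split=> [[a b]|i k x].
  by rewrite /levi2_char /levi2_exp /=; case: a; case: b; rewrite ?expr0z ?mulr1.
have [h1 h2] := levi2_lmul i k x.
have h3 : levi2_char z k (lmul_gen i x) = levi2_char z k (gen_elt i) * levi2_char z (pact (r := levi2) k (gen_elt i)) x.
  by rewrite /levi2_char h2 expfzDr.
have: forall b, pside (r := levi2) i k = Wall b -> b = true /\ pact (r := levi2) k (gen_elt i) = k /\ levi2_char z k (gen_elt i) = 1.
  by move: (k) => [[] []]; case: (i) => //= b [<-]; rewrite /levi2_char /levi2_exp /= ?expr0z.
case E: (pside i k) => [||b] => [//|//|/(_ b erefl) [-> [ei ek]]].
by rewrite {1}h1 h3 ei ek.
Qed.

Lemma line_cocycle (F : fieldType) a b c : @is_cocycle F (line a b) (line_char F a b c).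
Proof.
split=> [[]|i [] x]; first by rewrite /line_char.
have h i' : line_char F a b c tt (lmul_gen i' x) =
    (if i' is Tau then (-1) ^+ c else if i' is S1 then (-1) ^+ (~~ a) else (-1) ^+ (~~ b)) * line_char F a b c tt x.
  rewrite /line_char -!/(oddq _) oddq_lmul_gen; case: x => [[p q] [[s e] f]] /=.
  by case: i'; rewrite /= -signr_addb; congr (_ ^+ _); move: (oddq _) => o;
    case: a; case: b; case: c; case: o; case: s; case: e; case: f.
case: i; rewrite /= h; split=> //; clear h;
  try by case: (a); case: (b); rewrite ?expr0 ?expr1.
by congr (_ * _); rewrite /line_char; case: (a); case: (b); case: (c).
Qed.

Lemma plane_cocycle (F : fieldType) : @is_cocycle F plane (plane_char F).
Proof.
split=> [k|i k x]; first by rewrite /plane_char /= addbF andbF.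
have h k' : plane_char F k' (lmul_gen i x) =
   (match i with S0 => (-1) ^+ k' | S2 => (-1) ^+ ~~ k' | _ => 1 end) *
   plane_char F (k' (+) ~~ is_refl i) x.
  rewrite /plane_char -!/(oddq _) -!/(oddp _) oddq_lmul_gen oddp_lmul_gen.
  case: x => [[p q] [[s e] f]] /=; move: (oddq _) (oddp _) => o o'.
  by case: i; rewrite /= ?mul1r -?signr_addb; congr (_ ^+ _);
    case: k'; case: o; case: o'; case: s; case: e; case: f.
have g j : odd (absz (lmul_gen j x).1.2) = ~~ is_refl j (+) odd (absz x.1.2) := oddq_lmul_gen j x.
case: i h => h; rewrite /= h g /= ?addbF ?addbT ?addFb ?addTb; split => //; try by case: k {h}.
by case: k {h} (odd _) => [] [].
Qed.

(** * Linear forms on the Hecke algebra *)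

Lemma fsum_seq (J : choiceType) (V : zmodType) (P : set J) (f : J -> V) (s : seq J) :
  uniq s -> (forall i, i \in s -> P i) -> (forall i, P i -> i \notin s -> f i = 0) ->
  \sum_(i \in P) f i = \sum_(i <- s) f i.
Proof.
move=> us sP h; rewrite (fsbig_seq _ _ us); apply/esym/fsbig_widen.
  by move=> i /= /sP.
by move=> i [Pi /= /negP iS]; exact: h.
Qed.

Lemma fsumT (V : zmodType) (f : ext_affine -> V) (s : seq ext_affine) :
  uniq s -> (forall w, w \notin s -> f w = 0) ->
  \sum_(w \in setT) f w = \sum_(w <- s) f w.
Proof. by move=> us h; apply: fsum_seq => // w _; exact: h. Qed.

Lemma finite_seq (A : set ext_affine) : finite_set A ->
  exists2 s : seq ext_affine, uniq s & forall w, A w -> w \in s.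
Proof.
by move=> /finite_seqP[s ->]; exists (undup s); rewrite ?undup_uniq // => w; rewrite mem_undup.
Qed.

Lemma sum_widen (J : eqType) (V : zmodType) (f : J -> V) (s s' : seq J) :
  uniq s -> uniq s' -> {subset s <= s'} -> (forall x, x \notin s -> f x = 0) ->
  \sum_(x <- s) f x = \sum_(x <- s') f x.
Proof.
move=> us us' ss h; rewrite [RHS](bigID (mem s)) /= [X in _ + X]big1 // addr0.
rewrite -[RHS]big_filter; apply: perm_big; apply: uniq_perm => //.
  exact: filter_uniq.
by move=> x; rewrite mem_filter; case: (boolP (x \in s)) => //= /ss ->.
Qed.

Section Coordinates.
Variables (H : algType laurent) (T : ext_affine -> H) (HT : hecke_algebra T).
Local Notation TT := (Tm T).

Lemma basis_ex (h : H) : exists cs : (elt -> laurent) * seq elt,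
  [/\ uniq cs.2, forall x, x \notin cs.2 -> cs.1 x = 0 &
      h = \sum_(x <- cs.2) cs.1 x *: TT x].
Proof.
have [c [[cfin eh] _]] := hecke_basis HT h.
have [s us hs] := finite_seq cfin.
exists (c \o dec, map enc s); split => /=.
- by rewrite (map_inj_uniq (can_inj encK)).
- move=> x hx; apply/eqP/negPn/negP => /hs hx'.
  by move/negP: hx; apply; rewrite -[x]decK map_f.
- rewrite eh big_map (fsumT us).
    by apply: eq_bigr => w _; rewrite /Tm /= encK.
  move=> w hw; suff -> : c w = 0 by rewrite scale0r.
  by apply/eqP/negPn/negP => /hs; rewrite (negbTE hw).
Qed.

(** The uniqueness of coordinates in [hecke_basis], for the coordinates of 0. *)
Lemma basis_free (s : seq elt) (c : elt -> laurent) : uniq s ->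
  \sum_(x <- s) c x *: TT x = 0 -> forall x, x \in s -> c x = 0.
Proof.
move=> us h0 x xs.
have [c0 [_ uc]] := hecke_basis HT 0.
pose c' w := if enc w \in s then c (enc w) else 0.
have hc' : c0 = c'.
  apply: uc; split.
    apply/finite_seqP; exists [seq w <- map dec s | c' w != 0].
    apply/seteqP; split => w /=; rewrite mem_filter; last by case/andP.
    move=> hw; rewrite hw /=; apply/mapP; exists (enc w); rewrite ?encK //.
    by move: hw; rewrite /c'; case: ifP => //; rewrite eqxx.
  have u' : uniq (map dec s) by rewrite (map_inj_uniq dec_injective).
  rewrite (fsumT u'); last first.
    move=> w hw; rewrite /c'; case: (boolP (enc w \in s)); rewrite ?scale0r // => hw'.
    by move/negP: hw; case; apply/mapP; exists (enc w); rewrite ?encK.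
  rewrite big_map -[LHS]h0 big_seq [RHS]big_seq; apply: eq_bigr => y ys.
  by rewrite /c' decK ys.
have hc0 : c0 = fun=> 0.
  apply: uc; split.
    by apply/finite_seqP; exists [::]; apply/seteqP; split => w /=; rewrite ?eqxx.
  by rewrite (fsumT (s := [::])) ?big_nil // => w _; rewrite scale0r.
by have := congr1 (fun f => f (dec x)) hc'; rewrite hc0 /c' decK xs.
Qed.

Definition crd (h : H) : elt -> laurent := (projT1 (cid (basis_ex h))).1.
Definition csupp (h : H) : seq elt := (projT1 (cid (basis_ex h))).2.

Lemma crdP h : [/\ uniq (csupp h), forall x, x \notin csupp h -> crd h x = 0 &
      h = \sum_(x <- csupp h) crd h x *: TT x].
Proof. by rewrite /crd /csupp; case: cid. Qed.

Lemma crd_uniq h (s : seq elt) (c : elt -> laurent) : uniq s ->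
  (forall x, x \notin s -> c x = 0) -> h = \sum_(x <- s) c x *: TT x -> crd h = c.
Proof.
move=> us hs eh; have [us' hs' eh'] := crdP h.
(* Both expansions of h are compared over a common index set. *)
pose s2 := undup (s ++ csupp h).
have hd : forall x, x \in s2 -> crd h x - c x = 0.
  apply: basis_free; first exact: undup_uniq.
  under eq_bigr do rewrite scalerBl.
  have e1 : \sum_(x <- s2) crd h x *: TT x = h.
    rewrite {2}eh'; apply/esym/sum_widen => //; first exact: undup_uniq.
      by move=> x hx; rewrite mem_undup mem_cat hx orbT.
    by move=> x hx; rewrite hs' // scale0r.
  have e2 : \sum_(x <- s2) c x *: TT x = h.
    rewrite eh; apply/esym/sum_widen => //; first exact: undup_uniq.
      by move=> x hx; rewrite mem_undup mem_cat hx.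
    by move=> x hx; rewrite hs // scale0r.
  by rewrite sumrB e1 e2 subrr.
apply/funext => x; case: (boolP (x \in s2)) => [/hd/eqP|].
  by rewrite subr_eq0 => /eqP.
by rewrite mem_undup mem_cat negb_or => /andP[/hs -> /hs' ->].
Qed.

Definition lval (a : laurent) : {fraction {poly int}} := laurent_val a.

Lemma lvalD a b : lval (a + b) = lval a + lval b. Proof. by []. Qed.
Lemma lvalM a b : lval (a * b) = lval a * lval b. Proof. by []. Qed.
Lemma lval1 : lval 1 = 1. Proof. by []. Qed.
Lemma lval0 : lval 0 = 0. Proof. by []. Qed.

(** The linear form with values [G] on the basis T_x. The values lie in the
fraction field of Z[v], to which scalars are moved by [lval]. *)
Definition lext (G : elt -> {fraction {poly int}}) (h : H) : {fraction {poly int}} :=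
  \sum_(x <- csupp h) lval (crd h x) * G x.

Lemma lextE G h s c : uniq s -> (forall x, x \notin s -> c x = 0) ->
  h = \sum_(x <- s) c x *: TT x -> lext G h = \sum_(x <- s) lval (c x) * G x.
Proof.
move=> us hs eh; have [us' hs' _] := crdP h.
have e := crd_uniq us hs eh; rewrite /lext e.
rewrite (sum_widen us' (undup_uniq (s ++ csupp h))); first last.
- by move=> x hx; rewrite -e hs' // lval0 mul0r.
- by move=> x hx; rewrite mem_undup mem_cat hx orbT.
rewrite [RHS](sum_widen us (undup_uniq (s ++ csupp h))) //.
- by move=> x hx; rewrite mem_undup mem_cat hx.
- by move=> x hx; rewrite hs // lval0 mul0r.
Qed.

Lemma lextD G a b : lext G (a + b) = lext G a + lext G b.
Proof.
have [us hs eh] := crdP a; have [us' hs' eh'] := crdP b.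
set s := undup (csupp a ++ csupp b).
have us2 : uniq s by exact: undup_uniq.
have sub1 : {subset csupp a <= s} by move=> x hx; rewrite mem_undup mem_cat hx.
have sub2 : {subset csupp b <= s} by move=> x hx; rewrite mem_undup mem_cat hx orbT.
rewrite (@lextE G (a + b) s (fun x => crd a x + crd b x)) //; last 2 first.
- by move=> x; rewrite mem_undup mem_cat negb_or => /andP[/hs -> /hs' ->]; rewrite addr0.
- under eq_bigr do rewrite scalerDl.
  rewrite big_split {1}eh {1}eh'; congr (_ + _); apply: sum_widen => // x hx.
    by rewrite hs // scale0r.
  by rewrite hs' // scale0r.
under eq_bigr do rewrite lvalD mulrDl.
rewrite big_split /lext; congr (_ + _); apply/esym/sum_widen => // x hx.
  by rewrite hs // lval0 mul0r.
by rewrite hs' // lval0 mul0r.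
Qed.

Lemma lextZ G c a : lext G (c *: a) = lval c * lext G a.
Proof.
have [us hs eh] := crdP a.
rewrite (@lextE G (c *: a) (csupp a) (fun x => c * crd a x)) //; first last.
- by rewrite {1}eh scaler_sumr; apply: eq_bigr => x _; rewrite scalerA.
- by move=> x hx; rewrite hs // mulr0.
by rewrite /lext mulr_sumr; apply: eq_bigr => x _; rewrite lvalM mulrA.
Qed.

Lemma lextT G x : lext G (TT x) = G x.
Proof.
rewrite (@lextE G (TT x) [:: x] (fun y => (y == x)%:R)) //; first last.
- by rewrite big_seq1 eqxx scale1r.
- by move=> y; rewrite inE => /negbTE ->.
by rewrite big_seq1 eqxx lval1 mul1r.
Qed.

(** Linearity over the Laurent polynomials, with values in the fraction field. *)
Definition lform (A : H -> {fraction {poly int}}) : Prop :=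
  (forall a b, A (a + b) = A a + A b) /\ forall c a, A (c *: a) = lval c * A a.

Lemma lext_form G : lform (lext G).
Proof. by split; [exact: lextD|exact: lextZ]. Qed.

Lemma lform_sum A (J : Type) (s : seq J) (c : J -> laurent) (F : J -> H) : lform A ->
  A (\sum_(x <- s) c x *: F x) = \sum_(x <- s) lval (c x) * A (F x).
Proof.
move=> [AD AZ]; elim: s => [|x s IH].
  by rewrite !big_nil -[X in A X](scale0r (0 : H)) AZ lval0 mul0r.
by rewrite !big_cons AD AZ IH.
Qed.

Lemma lform_ext A B : lform A -> lform B -> (forall x, A (TT x) = B (TT x)) -> A =1 B.
Proof.
move=> hA hB e h; have [_ _ ->] := crdP h; rewrite !lform_sum //.
by apply: eq_bigr => x _; rewrite e.
Qed.
End Coordinates.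

(** * Traces of the representations *)

Lemma lvalN a : lval (- a) = - lval a. Proof. by []. Qed.
Lemma fracX_neq0 : tofrac 'X != 0 :> {fraction {poly int}}.
Proof. by rewrite tofrac_eq0 polyX_eq0. Qed.

Section Traces.
Variables (H : algType laurent) (T : ext_affine -> H) (HT : hecke_algebra T).
Local Notation K := {fraction {poly int}}.
Local Notation u := (tofrac 'X : K).
Variables (X : rep_pattern) (c : gen -> pidx X -> K).
Hypothesis HR : is_rep u c.
Local Notation TT := (Tm T).

(** The representation of the Hecke algebra given by the operators [opw], applied
to the function [m]. *)
Definition rho (h : H) (m : pidx X -> K) : pidx X -> K :=
  fun k => lext HT (fun x => opw u c x m k) h.

Lemma rho_form m k : lform (fun h => rho h m k).
Proof. exact: lext_form. Qed.

Lemma rhoT x m : rho (TT x) m = opw u c x m.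
Proof. by apply/funext => k; rewrite /rho lextT. Qed.

Lemma rhoD a b m : rho (a + b) m = fun k => rho a m k + rho b m k.
Proof. by apply/funext => k; exact: (rho_form m k).1. Qed.

Lemma rhoZ a h m : rho (a *: h) m = fun k => lval a * rho h m k.
Proof. by apply/funext => k; exact: (rho_form m k).2. Qed.

Lemma rho_lin h a m m' :
  rho h (fun k => a * m k + m' k) = fun k => a * rho h m k + rho h m' k.
Proof.
apply/funext => k; rewrite /rho /lext mulr_sumr -big_split; apply: eq_bigr => x _.
by rewrite opw_lin mulrDr mulrCA.
Qed.

(** Both sides are linear in [h], and on the basis this is the multiplication
rule of T_s T_x, which the operators satisfy by [opw_up] and [opw_down]. *)
Lemma rho_gen_elt i h m : rho (TT (gen_elt i) * h) m = op u c i (rho h m).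
Proof.
apply/funext => k.
apply: (@lform_ext _ _ HT (fun h => rho (TT (gen_elt i) * h) m k) (fun h => op u c i (rho h m) k)).
- split=> [a b|a b]; first by rewrite mulrDr rhoD.
  by rewrite -scalerAr rhoZ.
- split=> [a b|a b].
    have -> : rho (a + b) m = fun k => 1 * rho a m k + rho b m k.
      by rewrite rhoD; apply/funext => j; rewrite mul1r.
    by rewrite op_lin mul1r.
  have -> : rho (a *: b) m = fun k => (lval a - 1) * rho b m k + rho b m k.
    by rewrite rhoZ; apply/funext => j; ring.
  by rewrite op_lin; ring.
move=> x /=; rewrite rhoT.
case: (boolP (desc i x)) => di.
  by rewrite (Tm_ldown HT) // rhoD rhoZ !rhoT (opw_down HR).
have e : len (lmul_gen i x) = (is_refl i + len x)%N.
  case ri: (is_refl i); last by have -> : i = Tau by [case: (i) ri]; rewrite len_tau.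
  by move: di; rewrite /desc ri /=; have [] := len_lmul_gen x ri; lia.
by rewrite (Tm_lup HT) // rhoT (opw_up HR).
Qed.

(** T_x is a product of generators along a reduced word. *)
Lemma rhoM_elt x h m : rho (TT x * h) m = rho (TT x) (rho h m).
Proof.
elim: {x}(len x) {-2}x (erefl (len x)) h m => [|n IH] x lx h m.
  have [->|->] := lenE0 lx; first by rewrite (Tm1 HT) mul1r -(Tm1 HT) rhoT.
  by rewrite rho_gen_elt rhoT /opw wordTau.
have [i di] : exists i, desc i x by apply: desc_ex; rewrite lx.
have e : TT x = TT (gen_elt i) * TT (lmul_gen i x).
  rewrite (Tm_lup HT) lmul_genK //; have := desc_len di.
  by case/andP: di => -> _ ->.
have lx' : len (lmul_gen i x) = n by move: (desc_len di); rewrite lx => -[].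
by rewrite e -mulrA rho_gen_elt IH // rho_gen_elt.
Qed.

Lemma rhoM a b m : rho (a * b) m = rho a (rho b m).
Proof.
apply/funext => k.
apply: (@lform_ext _ _ HT (fun h => rho (h * b) m k) (fun h => rho h (rho b m) k)).
- split=> [x y|x y]; first by rewrite mulrDl rhoD.
  by rewrite -scalerAl rhoZ.
- exact: rho_form.
by move=> x; rewrite rhoM_elt.
Qed.

Definition delta (k : pidx X) : pidx X -> K := fun j => (j == k)%:R.

Lemma rho_delta h m k : rho h m k = \sum_j m j * rho h (delta j) k.
Proof.
have -> : m = fun k => \sum_j m j * delta j k.
  apply/funext => i; rewrite (bigD1 i) //= big1 ?addr0 /delta ?eqxx ?mulr1 //.
  by move=> j ji; rewrite eq_sym (negbTE ji) mulr0.
have gen s : rho h (fun k => \sum_(j <- s) m j * delta j k) k =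
             \sum_(j <- s) m j * rho h (delta j) k.
  elim: s => [|j s IH].
    rewrite big_nil /rho /lext big1 // => x _.
    have -> : (fun k => \sum_(j <- [::]) m j * delta j k) =
              fun k => (-1) * (0 : K) + 0.
      by apply/funext => i; rewrite big_nil mulr0 addr0.
    by rewrite (opw_lin u c x (-1) (fun=> 0) (fun=> 0)) mulN1r addNr mulr0.
  rewrite big_cons -IH.
  rewrite -[RHS]/((fun k => m j * rho h (delta j) k + _) k) -rho_lin.
  by congr (rho h _ k); apply/funext => i; rewrite big_cons.
rewrite gen; apply: eq_bigr => j _; congr (_ * _).
rewrite (bigD1 j) //= big1 ?addr0 /delta ?eqxx ?mulr1 //.
by move=> i ij; rewrite eq_sym (negbTE ij) mulr0.
Qed.

Definition rho_tr (h : H) : K := \sum_k rho h (delta k) k.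

Lemma rho_tr_form : lform rho_tr.
Proof.
split=> [a b|a b]; rewrite /rho_tr.
  by rewrite -big_split; apply: eq_bigr => k _; rewrite rhoD.
by rewrite mulr_sumr; apply: eq_bigr => k _; rewrite rhoZ.
Qed.

Lemma rho_tr_comm a b : rho_tr (a * b) = rho_tr (b * a).
Proof.
rewrite /rho_tr.
under eq_bigr do rewrite rhoM rho_delta.
under [RHS]eq_bigr do rewrite rhoM rho_delta.
rewrite exchange_big; apply: eq_bigr => k _; apply: eq_bigr => j _.
by rewrite mulrC.
Qed.

(** Traces vanish on commutators; this makes them linear forms on the cocenter. *)
Lemma rho_tr_csub h : commutator_submodule h -> rho_tr h = 0.
Proof.
move=> [r ->]; rewrite (lform_sum _ _ _ rho_tr_form) big1 // => p _.
have [hD hZ] := rho_tr_form.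
by rewrite -[- _]scaleN1r hD hZ rho_tr_comm lvalN lval1 mulN1r subrr mulr0.
Qed.

Lemma rho_trT x : rho_tr (TT x) = \sum_k opw u c x (delta k) k.
Proof. by apply: eq_bigr => k _; rewrite rhoT. Qed.

End Traces.

(** * Separation of conjugacy classes by characters *)

(** A complete conjugacy invariant. The first entry is the type: translation,
reflection or glide reflection with linear part conjugate to s1 or to s2,
rotation of order 4, half-turn. A translation is determined by the unordered
pair of |2a| and |2b|; a glide reflection by its translation length along the
axis and, for the first kind, the coset of Q; a rotation by the coset of Q; a
half-turn by its center modulo P and W. *)
Definition cls_inv (x : elt) : nat * nat * nat :=
  let: (p, q, (s, e, f)) := x in
  if s then
    if e == f then (1, absz (if e then p else (p + q)%R), odd (absz q) : nat)%N
    else (3, odd (absz q) : nat, 0)%N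
  else
    if e then if f then (4, if odd (absz q) then 2 else odd (absz p) : nat, 0)%N
              else (2, absz q, 0)%N
    else if f then (2, absz (2 * p + q)%R, 0)%N
         else (0, maxn (absz (2 * p + q)%R) (absz q), minn (absz (2 * p + q)%R) (absz q))%N.

(** A Laurent polynomial that vanishes at all positive integers is 0. The
exponents are shifted by [M] to become natural numbers. *)
Lemma exp_sum1 (J : eqType) (s : seq J) (b : J -> rat) (e : J -> int) :
  (forall y : nat, (0 < y)%N -> \sum_(j <- s) b j * y%:R ^ (e j) = 0) ->
  forall E : int, \sum_(j <- s | e j == E) b j = 0.
Proof.
move=> h E; pose M := (\sum_(j <- s) absz (e j) + absz E)%N.
have hM j : j \in s -> (absz (e j) <= M)%N.
  by move=> js; rewrite /M (big_rem j) //= -addnA leq_addr.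
pose Q : {poly rat} := \sum_(j <- s) b j *: 'X^(absz (e j + M%:Z)).
have hQ y : (0 < y)%N -> Q.[y%:R] = 0.
  move=> y0; have y0' : (y%:R : rat) != 0 by rewrite pnatr_eq0 -lt0n.
  rewrite -[RHS](mulr0 (y%:R ^ M%:Z)) -(h y y0) mulr_sumr horner_sum.
  rewrite big_seq [RHS]big_seq; apply: eq_bigr => j js.
  rewrite hornerZ hornerXn mulrCA -expfzDr // exprnP; congr (_ * _ ^ _).
  by have := hM j js; lia.
have Q0 : Q = 0.
  apply/eqP/negPn/negP => Q0.
  pose rs := [seq (i%:R : rat) | i <- iota 1 (size Q)].
  have : (size rs < size Q)%N.
    apply: max_poly_roots => //.
      by apply/allP => _ /mapP[i + ->]; rewrite mem_iota /root => /andP[i0 _]; rewrite hQ.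
    by rewrite map_inj_uniq ?iota_uniq // => i j /eqP; rewrite eqr_nat => /eqP.
  by rewrite size_map size_iota ltnn.
have := congr1 (fun q : {poly rat} => q`_(absz (E + M%:Z))) Q0.
rewrite /= coef0 coef_sum => e0; rewrite -[RHS]e0 big_mkcond [LHS]big_seq [RHS]big_seq.
apply: eq_bigr => j js; rewrite coefZ coefXn.
have -> : (absz (E + M%:Z) == absz (e j + M%:Z)) = (e j == E).
  have := hM j js; have : (absz E <= M)%N by rewrite /M leq_addl.
  by lia.
by case: eqP; rewrite ?mulr1 ?mulr0.
Qed.

Lemma exp_sum2 (J : eqType) (s : seq J) (b : J -> rat) (e f : J -> int) :
  (forall y z : nat, (0 < y)%N -> (0 < z)%N ->
     \sum_(j <- s) b j * (y%:R ^ (e j) * z%:R ^ (f j)) = 0) ->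
  forall E F : int, \sum_(j <- s | (e j == E) && (f j == F)) b j = 0.
Proof.
move=> h E F; rewrite -big_filter_cond; apply: exp_sum1 => z z0.
rewrite big_filter; apply: exp_sum1 => y y0.
by rewrite -[RHS](h y z y0 z0); apply: eq_bigr => j _; rewrite -mulrA [_ * y%:R ^ _]mulrC.
Qed.

Definition char1 (X : rep_pattern) (chi : pidx X -> elt -> rat) (x : elt) : rat :=
  \sum_k chi k x * (pact k x == k)%:R.

(** At v = 1 the traces are exponential sums in the parameters of the
representation; this compares the coefficients of a monomial. *)
Lemma coef_extract (X : rep_pattern) (S : seq elt) (b : elt -> rat)
    (e f : pidx X -> elt -> int) :
  (forall y z : nat, (0 < y)%N -> (0 < z)%N ->
    \sum_(x <- S) b x * char1 (fun k x => y%:R ^ (e k x) * z%:R ^ (f k x)) x = 0) ->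
  forall E F : int, \sum_(x <- S) b x *
    #|[pred k | [&& pact k x == k, e k x == E & f k x == F]]|%:R = 0.
Proof.
move=> h E F.
pose s := [seq (x, k) | x <- S, k <- enum (pidx X)].
pose bb (j : elt * pidx X) := b j.1 * (pact j.2 j.1 == j.2)%:R.
have := @exp_sum2 _ s bb (fun j => e j.2 j.1) (fun j => f j.2 j.1) _ E F.
rewrite big_mkcond big_allpairs_dep /= => e0; rewrite -[RHS]e0; first last.
  move=> y z y0 z0; rewrite big_allpairs_dep -[RHS](h y z y0 z0); apply: eq_bigr => x _.
  by rewrite big_enum mulr_sumr; apply: eq_bigr => k _; rewrite /bb /= -mulrA [_%:R * _]mulrC.
apply: eq_bigr => x _; rewrite big_enum -sum1_card natr_sum mulr_sumr big_mkcond.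
apply: eq_bigr => k _; rewrite /bb /= inE; case: (pact k x == k) => /=; last by rewrite mulr0 if_same.
by rewrite mulr1.
Qed.

Lemma single (S : seq elt) (G : elt -> rat) x0 : uniq S -> x0 \in S ->
  (forall x, x \in S -> x != x0 -> G x = 0) -> \sum_(x <- S) G x = G x0.
Proof.
move=> uS xS h; rewrite (bigD1_seq x0) //= big_seq_cond big1 ?addr0 // => x /andP[].
exact: h.
Qed.

Section Separation.
Variables (S : seq elt) (r : elt -> rat).
Hypothesis uS : uniq (map cls_inv S).
Hypothesis hP : forall y z : nat, (0 < y)%N -> (0 < z)%N ->
  \sum_(x <- S) r x * char1 (X := princ) (princ_char y%:R z%:R) x = 0.
Hypothesis h1 : forall d (z : nat), (0 < z)%N ->
  \sum_(x <- S) r x * char1 (X := levi1) (levi1_char d z%:R) x = 0.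
Hypothesis h2 : forall (z : nat), (0 < z)%N ->
  \sum_(x <- S) r x * char1 (X := levi2) (levi2_char z%:R) x = 0.
Hypothesis hX : forall a b c,
  \sum_(x <- S) r x * char1 (X := line a b) (line_char rat a b c) x = 0.
Hypothesis hY : \sum_(x <- S) r x * char1 (X := plane) (plane_char rat) x = 0.

Let uS' : uniq S := map_uniq uS.

Lemma cls_inv_in x y : x \in S -> y \in S -> cls_inv x = cls_inv y -> x = y.
Proof.
elim: S uS => //= z s IH /andP[zs us]; rewrite !inE.
case/orP=> [/eqP ->|xs]; case/orP=> [/eqP ->|ys] // e; last exact: IH.
  by case/negP: zs; rewrite e map_f.
by case/negP: zs; rewrite -e map_f.
Qed.

(** If a monomial occurs in the character of [x0], and otherwise only in the
characters of elements with zero coefficient, then the coefficient of [x0] is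
multiplied by a positive number of fixed indices, and must vanish. *)
Lemma sep_by_cls_inv (b : elt -> rat) (X : rep_pattern) (e f : pidx X -> elt -> int) x0 k0 :
  (forall E F : int, \sum_(x <- S) b x *
    #|[pred k | [&& pact k x == k, e k x == E & f k x == F]]|%:R = 0) ->
  x0 \in S -> pact k0 x0 = k0 ->
  (forall x k, x \in S -> pact k x = k -> e k x = e k0 x0 -> f k x = f k0 x0 ->
     b x = 0 \/ cls_inv x = cls_inv x0) -> b x0 = 0.
Proof.
move=> h x0S fx0 hk; have := h (e k0 x0) (f k0 x0).
rewrite (single uS' x0S).
  move/eqP; rewrite mulf_eq0 pnatr_eq0 => /orP[/eqP //|/eqP/card0_eq/(_ k0)].
  by rewrite inE fx0 !eqxx.
move=> x xS xx0; case: (eqVneq (b x) 0) => [->|bx]; first by rewrite mul0r.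
rewrite eq_card0 ?mulr0 // => k; rewrite inE; apply/negP => /and3P[/eqP fx /eqP ex /eqP fx'].
have [b0|ek] := hk x k xS fx ex fx'; first by rewrite b0 eqxx in bx.
by move/eqP: xx0; apply; apply: cls_inv_in.
Qed.

(** The principal series at v = 1 is induced from P, so its character is
supported on translations, where it is an orbit sum. *)
Lemma sep_transl x0 : x0 \in S -> x0.2 = idw -> r x0 = 0.
Proof.
move=> x0S ex0.
apply: (@sep_by_cls_inv r princ (fun k x => actp k x.1.1 x.1.2 + actq k x.1.1 x.1.2)
   (fun k x => actp k x.1.1 x.1.2) x0 idw) => //; first exact: coef_extract.
  by rewrite /= ex0.
move=> [[p q] w] k xS fx; case: x0 x0S ex0 => [[p0 q0] w0] x0S /= -> e1 e2; right.
have -> : w = idw.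
  by move: fx => /=; move: (k) (w) => [[[] []] []] [[[] []] []].
move: e1 e2; move: k {fx} => [[[] []] []]; rewrite /actp /actq /cls_inv /idw /= => e1 e2;
  by congr (_, _, _); clear -e1 e2; lia.
Qed.

(** The characters of the first parabolic family see translations, which are
already excluded, and conjugates of s1-type elements. The monomial gives the
translation length; half the sum over the two signs of [levi1_char] selects a
coset of Q. *)
Lemma sep_s1 x0 : x0 \in S -> x0.2 = (true, false, false) \/ x0.2 = (true, true, true) -> r x0 = 0.
Proof.
move=> x0S ex0.
(* Twice the coefficient on the coset of Q of x0, and 0 on the other one. *)
pose b x := r x * (1 + (-1) ^+ (oddq x0 (+) oddq x)).
suff : b x0 = 0.
  by rewrite /b addbb expr0 => /eqP; rewrite mulf_eq0 orbF => /eqP.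
pose k0 : pidx levi1 := if x0.2 is (_, true, _) then (false, true) else (false, false).
apply: (@sep_by_cls_inv b levi1 (fun k x => levi1_exp k x) (fun _ _ => 0) x0 k0) => //.
- apply: coef_extract => y z y0 z0.
  have := h1 false y0; have := h1 true y0 => ht hf.
  transitivity (\sum_(x <- S) r x * char1 (X := levi1) (levi1_char false y%:R) x +
      (-1) ^+ oddq x0 * \sum_(x <- S) r x * char1 (X := levi1) (levi1_char true y%:R) x).
    rewrite mulr_sumr -big_split; apply: eq_bigr => x _ /=.
    rewrite /b /char1 /levi1_char -!/(oddq _) !mulr_sumr -big_split; apply: eq_bigr => k _ /=.
    by rewrite signr_addb /= expr0 expr0z; ring.
  by rewrite ht hf mulr0 addr0.
- by rewrite /k0 /=; case: ex0 => ->.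
move=> [[p q] w] k xS fx; case: x0 x0S ex0 @b @k0 => [[p0 q0] w0] x0S ex0 b k0 e1 _; rewrite /= in ex0.
case: (boolP (w == idw)) => [/eqP ew|wk].
  by left; rewrite /b (sep_transl xS) ?mul0r.
case: (boolP (oddq (p0, q0, w0) == oddq (p, q, w))) => [/eqP eo|]; last first.
  by move=> eo; left; rewrite /b; move: eo; case: (oddq _); case: (oddq _) => //= _; rewrite addrN mulr0.
right; move: eo e1 fx wk; rewrite /oddq /= => eo.
clear -ex0 eo; subst k0.
case: ex0 => ->; move: k w => [[] []] [[[] []] []] //=; rewrite /levi1_exp /cls_inv /= => e1 _ _;
  by congr (_, _, _); clear -e1 eo; lia.
Qed.

(** As for [sep_s1]; here the translation length determines the coset of Q. *)
Lemma sep_s2 x0 : x0 \in S -> x0.2 = (false, false, true) \/ x0.2 = (false, true, false) -> r x0 = 0.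
Proof.
move=> x0S ex0.
pose k0 : pidx levi2 := if x0.2 is (_, true, _) then (true, false) else (false, false).
apply: (@sep_by_cls_inv r levi2 (fun k x => levi2_exp k x) (fun _ _ => 0) x0 k0) => //.
- apply: coef_extract => y z y0 z0; rewrite -[RHS](h2 y0); apply: eq_bigr => x _.
  by congr (_ * _); apply: eq_bigr => k _; rewrite /levi2_char expr0z mulr1.
- by rewrite /k0 /=; case: ex0 => ->.
move=> [[p q] w] k xS fx e1 _.
case: (boolP (w == idw)) => [/eqP ew|wk]; first by left; rewrite (sep_transl xS).
right; case: x0 x0S ex0 @k0 e1 => [[p0 q0] w0] x0S ex0 k0; rewrite /= in ex0; subst k0.
move: fx wk; case: ex0 => -> /=.
  by move: k w xS => [[] []] [[[] []] []] //= _; rewrite /levi2_exp /cls_inv /= => _ _ e1;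
    congr (_, _, _); clear -e1; lia.
by move: k w xS => [[] []] [[[] []] []] //= _; rewrite /levi2_exp /cls_inv /= => _ _ e1;
    congr (_, _, _); clear -e1; lia.
Qed.

Definition elliptic (x : elt) : bool :=
  let: (s, e, f) := x.2 in if s then e != f else e && f.

Definition ell_sum (k : nat * nat * nat) : rat := \sum_(x <- S | cls_inv x == k) r x.

Lemma nonelliptic_r0 x : x \in S -> ~~ elliptic x -> r x = 0.
Proof.
move: x => [[p q] w] xS; rewrite /elliptic /= => hw.
have [ew|[ew|ew]] : w = idw \/ (w = (true, false, false) \/ w = (true, true, true)) \/
    (w = (false, false, true) \/ w = (false, true, false)).
  by move: w hw {xS} => [[[] []] []]; auto.
- exact: sep_transl.
- exact: sep_s1.
- exact: sep_s2.
Qed.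

(** Only the five classes of rotations and half-turns are left. *)
Lemma elliptic_sum (g : elt -> rat) (G : nat * nat * nat -> rat) :
  (forall x, elliptic x -> g x = G (cls_inv x)) ->
  \sum_(x <- S) r x * g x =
  ell_sum (3, 0, 0)%N * G (3, 0, 0)%N + ell_sum (3, 1, 0)%N * G (3, 1, 0)%N +
  ell_sum (4, 0, 0)%N * G (4, 0, 0)%N + ell_sum (4, 1, 0)%N * G (4, 1, 0)%N +
  ell_sum (4, 2, 0)%N * G (4, 2, 0)%N.
Proof.
move=> hg; pose t k x := (if cls_inv x == k then r x else 0) * G k.
have et k : ell_sum k * G k = \sum_(x <- S) t k x by rewrite /ell_sum big_mkcond mulr_suml.
rewrite !et; transitivity (\sum_(x <- S) (t (3, 0, 0)%N x + t (3, 1, 0)%N x +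
   t (4, 0, 0)%N x + t (4, 1, 0)%N x + t (4, 2, 0)%N x)); last by rewrite !big_split.
rewrite big_seq [RHS]big_seq; apply: eq_bigr => x xS; rewrite /t.
case: (boolP (elliptic x)) => ex; last by rewrite (nonelliptic_r0 xS ex) !if_same !mul0r !addr0.
rewrite (hg _ ex); have : cls_inv x \in [:: (3,0,0); (3,1,0); (4,0,0); (4,1,0); (4,2,0)]%N.
  move: x ex {xS} => [[p q] [[s e] f]]; rewrite /elliptic /= !inE.
  by case: s; case: e; case: f => //= _; case: (odd (absz q)); case: (odd (absz p)).
by rewrite !inE => /or4P[/eqP->|/eqP->|/eqP->|/orP[/eqP->|/eqP->]];
  rewrite /= !mul0r ?addr0 ?add0r.
Qed.

(** The one-dimensional characters give four independent relations between the
five remaining coefficients, the two-dimensional one gives the fifth. *)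
Lemma sep_elliptic x0 : x0 \in S -> elliptic x0 -> r x0 = 0.
Proof.
move=> x0S ex0.
pose GX a b c (k : nat * nat * nat) : rat :=
  (-1) ^+ (if k == (3, 0, 0)%N then ~~ a (+) ~~ b else
           if k == (3, 1, 0)%N then c (+) ~~ b else
           if k == (4, 2, 0)%N then c (+) ~~ a else false).
have eX a b c : ell_sum (3, 0, 0)%N * GX a b c (3, 0, 0)%N + ell_sum (3, 1, 0)%N * GX a b c (3, 1, 0)%N +
  ell_sum (4, 0, 0)%N * GX a b c (4, 0, 0)%N + ell_sum (4, 1, 0)%N * GX a b c (4, 1, 0)%N +
  ell_sum (4, 2, 0)%N * GX a b c (4, 2, 0)%N = 0.
  rewrite -[RHS](hX a b c); apply/esym/elliptic_sum => -[[p q] [[s e] f]] ex.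
  rewrite /char1 (bigD1 tt) //= big1 ?addr0; last by case.
  rewrite mulr1 /GX /line_char /=; congr (_ ^+ _); move: ex; rewrite /elliptic /=.
  by case: s; case: e; case: f => //= _; case: (odd (absz q)); case: (odd (absz p));
    case: a; case: b; case: c.
pose GY (k : nat * nat * nat) : rat :=
  if k == (4, 0, 0)%N then 2%:R else if k == (4, 1, 0)%N then - 2%:R else 0.
have eY : ell_sum (3, 0, 0)%N * GY (3, 0, 0)%N + ell_sum (3, 1, 0)%N * GY (3, 1, 0)%N +
  ell_sum (4, 0, 0)%N * GY (4, 0, 0)%N + ell_sum (4, 1, 0)%N * GY (4, 1, 0)%N +
  ell_sum (4, 2, 0)%N * GY (4, 2, 0)%N = 0.
  rewrite -[RHS]hY; apply/esym/elliptic_sum => -[[p q] [[s e] f]] ex.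
  rewrite /char1 big_bool /GY /plane_char /=; move: ex; rewrite /elliptic /=.
  by case: s; case: e; case: f => //= _; case: (odd (absz q)); case: (odd (absz p)).
have := (eX true true true, eX true true false, eX true false true,
  eX true false false, eX false true true, eY) => {eX eY}.
rewrite /GX /GY /= !expr0 !expr1 => -[[[[[e1 e2] e3] e4] e5] e6].
have A0 k : k \in [:: (3,0,0); (3,1,0); (4,0,0); (4,1,0); (4,2,0)]%N -> ell_sum k = 0.
  by rewrite !inE => /or4P[/eqP->|/eqP->|/eqP->|/orP[/eqP->|/eqP->]]; lra.
have : cls_inv x0 \in [:: (3,0,0); (3,1,0); (4,0,0); (4,1,0); (4,2,0)]%N.
  move: x0 ex0 {x0S} => [[p q] [[s e] f]]; rewrite /elliptic /= !inE.
  by case: s; case: e; case: f => //= _; case: (odd (absz q)); case: (odd (absz p)).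
move/A0; rewrite /ell_sum big_mkcond (single uS' x0S) ?eqxx //.
by move=> x xS xx0; case: eqP => // /(cls_inv_in xS x0S) e; rewrite e eqxx in xx0.
Qed.

Lemma separation x0 : x0 \in S -> r x0 = 0.
Proof.
by move=> xS; case: (boolP (elliptic x0)) => [/(sep_elliptic xS)|/(nonelliptic_r0 xS)].
Qed.
End Separation.

(** * Linear independence in the cocenter *)

Local Notation K := {fraction {poly int}}.
Local Notation u := (tofrac 'X : K).

(** [r] is the value at v = 1 of the rational function [f], regular there. As a
relation it is compatible with the ring operations, so traces can be evaluated
without choosing fractions. *)
Definition spec1 (f : K) (r : rat) : Prop :=
  exists p s : {poly int},
    [/\ s.[1] != 0, f * tofrac s = tofrac p & r * (s.[1])%:~R = (p.[1])%:~R].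

Lemma spec1_0 r : spec1 0 r -> r = 0.
Proof.
move=> [p [s [s0]]]; rewrite mul0r => /esym/eqP; rewrite tofrac_eq0 => /eqP ->.
by rewrite horner0 => /eqP; rewrite mulf_eq0 intr_eq0 (negbTE s0) orbF => /eqP.
Qed.

Lemma spec1_poly (p : {poly int}) : spec1 (tofrac p) (p.[1])%:~R.
Proof.
by exists p, 1; rewrite hornerC oner_eq0 tofrac1 !mulr1.
Qed.

Lemma spec1D f r g t : spec1 f r -> spec1 g t -> spec1 (f + g) (r + t).
Proof.
move=> [p [s [s0 h1 h2]]] [p' [s' [s0' h1' h2']]]; exists (p * s' + p' * s), (s * s').
rewrite !hornerE mulf_neq0 //; split=> //.
  by rewrite tofracD !tofracM -h1 -h1'; ring.
by rewrite !(intrD, intrM) -h2 -h2'; ring.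
Qed.

Lemma spec1M f r g t : spec1 f r -> spec1 g t -> spec1 (f * g) (r * t).
Proof.
move=> [p [s [s0 h1 h2]]] [p' [s' [s0' h1' h2']]]; exists (p * p'), (s * s').
rewrite !hornerE mulf_neq0 //; split=> //.
  by rewrite !tofracM -h1 -h1'; ring.
by rewrite !intrM -h2 -h2'; ring.
Qed.

Lemma spec1V f r : r != 0 -> spec1 f r -> spec1 f^-1 r^-1.
Proof.
move=> r0 [p [s [s0 h1 h2]]].
have p0 : p.[1] != 0 by rewrite -(intr_eq0 rat) -h2 mulf_neq0 // intr_eq0.
have fp0 : tofrac p != 0 :> K.
  by rewrite tofrac_eq0; apply: contraNneq p0 => ->; rewrite horner0.
have f0 : f != 0 by apply: contraNneq fp0 => f0; rewrite -h1 f0 mul0r.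
exists s, p; split; [exact: p0|by rewrite -h1 mulKf|by rewrite -h2 mulKf].
Qed.

Lemma horner_nat n : (n%:R : {poly int}).[1] = n%:R.
Proof. by rewrite hornerMn hornerC. Qed.

Lemma spec1_nat n : spec1 n%:R n%:R.
Proof.
have := spec1_poly n%:R; rewrite horner_nat.
have -> : tofrac (n%:R : {poly int}) = n%:R :> K by exact: rmorph_nat.
have -> : (n%:R : int)%:~R = n%:R :> rat by exact: rmorph_nat.
by [].
Qed.

Lemma spec1_1 : spec1 1 1. Proof. exact: spec1_nat 1%N. Qed.

Lemma spec1_zero : spec1 0 0. Proof. exact: spec1_nat 0%N. Qed.

Lemma spec1N f r : spec1 f r -> spec1 (- f) (- r).
Proof.
move=> h; have hm1 : spec1 (-1) (-1).
  have := spec1_poly (-1); rewrite hornerN hornerC.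
  have -> : tofrac (-1 : {poly int}) = -1 :> K by exact: rmorphN1.
  by rewrite rmorphN1.
by have := spec1M hm1 h; rewrite !mulN1r.
Qed.

Lemma spec1X f r n : spec1 f r -> spec1 (f ^+ n) (r ^+ n).
Proof. by move=> h; elim: n => [|n IH]; rewrite ?expr0 ?exprS; [exact: spec1_1|exact: spec1M]. Qed.

Lemma spec1_exprz f r n : r != 0 -> spec1 f r -> spec1 (f ^ n) (r ^ n).
Proof.
move=> r0 h; case: n => n; first exact: spec1X.
by rewrite !NegzE -!exprnN; apply: spec1V; [rewrite expf_neq0|exact: spec1X].
Qed.

Lemma spec1_u : spec1 u 1.
Proof. by have := spec1_poly 'X; rewrite hornerX. Qed.

Lemma spec1_sum (J : Type) (s : seq J) (f : J -> K) (g : J -> rat) :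
  (forall j, spec1 (f j) (g j)) -> spec1 (\sum_(j <- s) f j) (\sum_(j <- s) g j).
Proof.
move=> h; elim: s => [|j s IH]; first by rewrite !big_nil; exact: spec1_zero.
by rewrite !big_cons; apply: spec1D.
Qed.

Lemma spec1_sign (b : bool) : spec1 ((-1) ^+ b) ((-1) ^+ b).
Proof. by apply: spec1X; apply: spec1N; exact: spec1_1. Qed.

Lemma spec1_opw (X : rep_pattern) (c : gen -> pidx X -> K) (c' : gen -> pidx X -> rat)
    x m m' k :
  (forall i k, spec1 (c i k) (c' i k)) -> (forall k, spec1 (m k) (m' k)) ->
  spec1 (opw u c x m k) (opw 1 c' x m' k).
Proof.
move=> hc hm; rewrite /opw; elim: (word x) k => [|i r IH] k //=.
have hu := spec1_u; have hui := spec1V (oner_neq0 _) hu.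
rewrite /op; case: (pside i k) => [||b].
- apply: spec1D; last exact: spec1M.
  by apply: spec1M => //; apply: spec1D => //; apply: spec1N.
- exact: spec1M.
- by apply: spec1M => //; case: b => //; apply: spec1N.
Qed.

Section Uniqueness.
Variables (H : algType laurent) (T : ext_affine -> H) (HT : hecke_algebra T).
Local Notation TT := (Tm T).

Lemma lval_frac (a : laurent) : exists pn : {poly int} * nat, lval a * u ^+ pn.2 = tofrac pn.1.
Proof. by case: a => f /= h; have /asboolP[p [n e]] := h; exists (p, n). Qed.

Lemma u1_neq0 n : tofrac (('X - 1) ^+ n) != 0 :> K.
Proof. by rewrite tofrac_eq0 expf_neq0 // polyXsubC_eq0. Qed.

Variables (S : seq elt) (g : elt -> laurent).
Hypothesis hg : commutator_submodule (\sum_(x <- S) g x *: TT x).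

Definition gnum (x : elt) : {poly int} := (projT1 (cid (lval_frac (g x)))).1.
Definition gden (x : elt) : nat := (projT1 (cid (lval_frac (g x)))).2.
Lemma gnumE x : lval (g x) * u ^+ gden x = tofrac (gnum x).
Proof. by rewrite /gnum /gden; case: cid. Qed.

(** If all coefficients of a relation in the cocenter are divisible by
(v - 1)^n, then the quotients, evaluated at v = 1, give a relation between the
characters of the group. *)
Lemma trace_at_1 (X : rep_pattern) (chi : pidx X -> elt -> K) (chi' : pidx X -> elt -> rat)
    n (p' : elt -> {poly int}) :
  is_rep u (fun i k => chi k (gen_elt i)) -> is_cocycle chi' ->
  (forall i k, spec1 (chi k (gen_elt i)) (chi' k (gen_elt i))) ->
  (forall x, x \in S -> gnum x = p' x * ('X - 1) ^+ n) ->
  \sum_(x <- S) ((p' x).[1])%:~R * char1 chi' x = 0.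
Proof.
move=> hR hC hs hp; apply: spec1_0.
have t0 := rho_tr_csub HT hR hg.

rewrite (lform_sum _ _ _ (rho_tr_form HT _)) in t0.
have e : \sum_(x <- S) lval (g x) * rho_tr HT (fun i k => chi k (gen_elt i)) (TT x) =
  tofrac (('X - 1) ^+ n) * \sum_(x <- S) (tofrac (p' x) * (u ^+ gden x)^-1 *
      \sum_k opw u (fun i k => chi k (gen_elt i)) x (@delta X k) k).
  rewrite mulr_sumr big_seq [RHS]big_seq; apply: eq_bigr => x xS; rewrite rho_trT !mulrA; congr (_ * _).
  have un : u ^+ gden x != 0 by rewrite expf_neq0 // fracX_neq0.
  by apply: (mulIf un); rewrite gnumE divfK // hp // tofracM mulrC.
rewrite e in t0; move/eqP: t0; rewrite mulf_eq0 (negbTE (u1_neq0 n)) /= => /eqP <-.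
apply: spec1_sum => x; apply: spec1M.
  rewrite -[X in spec1 _ X]mulr1; apply: spec1M; first exact: spec1_poly.
  have hu : spec1 (u ^+ gden x) 1 by have := spec1X (gden x) spec1_u; rewrite expr1n.
  by have := spec1V (oner_neq0 _) hu; rewrite invr1.
apply: spec1_sum => k; rewrite -(opw_cocycle x (fun j => (j == k)%:R) k hC).
by apply: spec1_opw => // j; rewrite /delta; case: eqP => _; [exact: spec1_1|exact: spec1_zero].
Qed.

Hypothesis uS : uniq (map cls_inv S).

Lemma nat_unit (F : numFieldType) (z : nat) : (0 < z)%N -> z%:R != 0 :> F.
Proof. by move=> z0; rewrite pnatr_eq0 -lt0n. Qed.

Lemma nat_unitK (z : nat) : (0 < z)%N -> z%:R != 0 :> K.
Proof.
move=> z0; apply/eqP => e; have := spec1_0 (r := z%:R); rewrite -e => /(_ (spec1_nat z)).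
by apply/eqP; exact: nat_unit.
Qed.

(** The parameters of the representations range over the positive integers, which
are units in the fraction field and keep their values at v = 1. *)
Lemma values_at_1 n (p' : elt -> {poly int}) :
  (forall x, x \in S -> gnum x = p' x * ('X - 1) ^+ n) -> forall x, x \in S -> (p' x).[1] = 0.
Proof.
move=> hp x xS; apply/eqP; rewrite -(intr_eq0 rat); apply/eqP.
pose r y : rat := ((p' y).[1])%:~R.
apply: (@separation S r uS) xS => [y z y0 z0|d z z0|z z0|a b c|].
- apply: (trace_at_1 (princ_rep fracX_neq0 (nat_unitK y0) (nat_unitK z0)) _ _ hp).
    by apply: princ_cocycle; exact: nat_unit.
  by move=> i k; apply: spec1M; apply: spec1_exprz; (try exact: nat_unit); exact: spec1_nat.
- apply: (trace_at_1 (levi1_rep d fracX_neq0 (nat_unitK z0)) _ _ hp).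
    by apply: levi1_cocycle; exact: nat_unit.
  move=> i k; apply: spec1M; first exact: spec1_sign.
  by apply: spec1_exprz; [exact: nat_unit|exact: spec1_nat].
- apply: (trace_at_1 (levi2_rep fracX_neq0 (nat_unitK z0)) _ _ hp).
    by apply: levi2_cocycle; exact: nat_unit.
  by move=> i k; apply: spec1_exprz; [exact: nat_unit|exact: spec1_nat].
- apply: (trace_at_1 (line_rep a b c fracX_neq0) (line_cocycle rat a b c) _ hp).
  by move=> i k; rewrite /line_char; case: (gen_elt i).2 => [[? ?] ?]; exact: spec1_sign.
- apply: (trace_at_1 (plane_rep fracX_neq0) (plane_cocycle rat) _ hp).
  by move=> i k; rewrite /plane_char; case: (gen_elt i).2 => [[? ?] ?]; exact: spec1_sign.
Qed.

Lemma gnum_div n : exists p' : elt -> {poly int},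
  forall x, x \in S -> gnum x = p' x * ('X - 1) ^+ n.
Proof.
elim: n => [|n [p' hp]]; first by exists gnum => x _; rewrite expr0 mulr1.
have hq x : exists q : {poly int}, x \in S -> p' x = q * ('X - 1).
  case: (boolP (x \in S)) => [xS|_]; last by exists 0.
  have /factor_theorem[q ->] : root (p' x) 1 by apply/eqP; exact: (values_at_1 hp).
  by exists q; rewrite polyC1.
exists (fun x => projT1 (cid (hq x))) => x xS; case: cid => q /= /(_ xS) e.
by rewrite hp // e exprS mulrA.
Qed.

(** A nonzero polynomial is not divisible by (v - 1)^n for n its size. *)
Lemma cocenter_free x : x \in S -> g x = 0.
Proof.
move=> xS; have gnum0 : gnum x = 0.
  apply/eqP/negPn/negP => gnum0; have [p' /(_ x xS) e] := gnum_div (size (gnum x)).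
  have p0 : p' x != 0 by apply: contraNneq gnum0 => p0; rewrite e p0 mul0r.
  have := congr1 (fun p : {poly int} => size p) e; rewrite /= size_mul //; last first.
    by rewrite expf_neq0 // polyXsubC_eq0.
  rewrite -polyC1 size_exp_XsubC; have : (0 < size (p' x))%N by rewrite size_poly_gt0.
  by move: (size (p' x)) (size (gnum x)) => a b; lia.
have := gnumE x; rewrite gnum0 tofrac0 => /eqP; rewrite mulf_eq0 expf_eq0.
rewrite (negbTE fracX_neq0) andbF orbF => /eqP e; exact: val_inj.
Qed.
End Uniqueness.

(** * Conjugacy classes *)

Definition conjugate (x y : elt) : Prop := exists g, dec y = (dec x ^ g)%g.

Lemma conjugate_sym x y : conjugate x y -> conjugate y x.
Proof. by move=> [g e]; exists g^-1%g; rewrite e conjgK. Qed.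
Lemma conjugate_trans y x z : conjugate x y -> conjugate y z -> conjugate x z.
Proof. by move=> [g e] [g' e']; exists (g * g')%g; rewrite conjgM -e. Qed.

Lemma conjugate_elt h x y : mule h y = mule x h -> conjugate x y.
Proof.
by move=> e; exists (dec h); rewrite conjgE -dec_mul -e dec_mul mulKg.
Qed.

Lemma dec_conj_gen i x : dec (conj_gen i x) = (dec x ^ dec (gen_elt i))%g.
Proof.
rewrite conjgE /conj_gen /rmul_gen dec_mul dec_lmul_gen -mulgA; congr (_ * _)%g.
apply: (@mulgI _ (dec (gen_elt i))); rewrite mulgV -dec_mul -dec1; congr dec; by case: i.
Qed.

Lemma conjugate_gen i x : conjugate x (conj_gen i x).
Proof. by exists (dec (gen_elt i)); exact: dec_conj_gen. Qed.

Lemma cls_inv_conj i x : cls_inv (conj_gen i x) = cls_inv x.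
Proof.
case: x => [[p q] [[[] []] []]]; case: i; rewrite /cls_inv /= /actp /actq /=;
  congr (_, _, _); clear; (try lia); do 2?case: ifP; lia.
Qed.

(** Every element is a product of generators, and conjugation by a generator
preserves the invariant. *)
Lemma cls_inv_conjugate x y : conjugate x y -> cls_inv x = cls_inv y.
Proof.
move=> [g]; rewrite -[g]encK; move: (enc g) => h.
elim: {h}(len h) {-2}h (erefl (len h)) x y => [|n IH] h lh x y.
  have [->|->] := lenE0 lh; first by rewrite dec1 conjg1 => /dec_injective ->.
  by rewrite -dec_conj_gen => /dec_injective ->; rewrite cls_inv_conj.
have [i di] : exists i, desc i h by apply: desc_ex; rewrite lh.
rewrite -[h](lmul_genK i) dec_lmul_gen conjgM -dec_conj_gen => e.
rewrite -(cls_inv_conj i x); apply: (IH _ _ _ _ e).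
by move: (desc_len di); rewrite lh => -[].
Qed.

(** A representative of the class with invariant [k]. *)
Definition normal_form (k : nat * nat * nat) : elt :=
  let: (t, a, b) := k in
  match t with
  | 0%N => (((a - b)./2)%N%:Z, b%:Z, (false, false, false))
  | 1%N => (a%:Z - b%:Z, b%:Z, (true, false, false))
  | 2%N => ((a./2)%N%:Z, (odd a)%:Z, (false, false, true))
  | 3%N => (0, a%:Z, (true, true, false))
  | _ => (if a == 1%N then 1 else 0, if a == 2%N then 1 else 0, (false, true, true))
  end.

(** Conjugacy in coordinates; [h] is the conjugating element. *)
Lemma conjugate_by (h : elt) x y :
  (h.1.1 + actp h.2 y.1.1 y.1.2 = x.1.1 + actp x.2 h.1.1 h.1.2 /\
   h.1.2 + actq h.2 y.1.1 y.1.2 = x.1.2 + actq x.2 h.1.1 h.1.2) ->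
  mulw h.2 y.2 = mulw x.2 h.2 -> conjugate x y.
Proof. by move=> [e1 e2] e3; apply: (@conjugate_elt h); apply: triple_eq. Qed.

Lemma normal_form_transl p q : conjugate (p, q, (false, false, false)) (normal_form (cls_inv (p, q, (false, false, false)))).
Proof.
pose h (k : bool * bool * bool) : elt := (0, 0, k).
have sel k : 0 + actp k (normal_form (cls_inv (p, q, idw))).1.1 (normal_form (cls_inv (p, q, idw))).1.2 = p + 0 /\
   0 + actq k (normal_form (cls_inv (p, q, idw))).1.1 (normal_form (cls_inv (p, q, idw))).1.2 = q + 0 ->
   conjugate (p, q, idw) (normal_form (cls_inv (p, q, idw))).
  by move=> e; apply: (@conjugate_by (h k)) => //; case: k {e} => [[[] []] []].
move: sel; rewrite /= /actp /actq /= => sel.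
case: (lerP `|q| `|2 * p + q|) => h1; case: (lerP 0 q) => h2; case: (lerP 0 (2 * p + q)) => h3.
- apply: (sel (false, false, false)); rewrite /=; lia.
- apply: (sel (false, true, false)); rewrite /=; lia.
- apply: (sel (false, false, true)); rewrite /=; lia.
- apply: (sel (false, true, true)); rewrite /=; lia.
- apply: (sel (true, false, false)); rewrite /=; lia.
- apply: (sel (true, true, false)); rewrite /=; lia.
- apply: (sel (true, false, true)); rewrite /=; lia.
- apply: (sel (true, true, true)); rewrite /=; lia.
Qed.

Lemma normal_form_s1 p q : conjugate (p, q, (true, false, false)) (normal_form (cls_inv (p, q, (true, false, false)))).
Proof.
case: (lerP 0 (p + q)) => h1.
  by apply: (@conjugate_by (- (q %/ 2)%Z, 0, (false, false, false))); rewrite //= /actp /actq /=; lia.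
by apply: (@conjugate_by (- ((q + 1) %/ 2)%Z, 0, (false, true, true))); rewrite //= /actp /actq /=; lia.
Qed.

Lemma normal_form_s2 p q : conjugate (p, q, (false, false, true)) (normal_form (cls_inv (p, q, (false, false, true)))).
Proof.
case: (lerP 0 (2 * p + q)) => h1.
  by apply: (@conjugate_by (0, (q %/ 2)%Z, (false, false, false))); rewrite //= /actp /actq /=; lia.
by apply: (@conjugate_by (0, ((q + 1) %/ 2)%Z, (false, true, true))); rewrite //= /actp /actq /=; lia.
Qed.

Lemma normal_form_rot p q : conjugate (p, q, (true, true, false)) (normal_form (cls_inv (p, q, (true, true, false)))).
Proof.
by apply: (@conjugate_by (- (q %/ 2)%Z, p + 2 * (q %/ 2)%Z, (false, false, false)));
  rewrite //= /actp /actq /=; lia.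
Qed.

Lemma normal_form_opp p q : conjugate (p, q, (false, true, true)) (normal_form (cls_inv (p, q, (false, true, true)))).
Proof.
rewrite /cls_inv; case oq: (odd (absz q)); case op: (odd (absz p)); rewrite /normal_form /=.
- by apply: (@conjugate_by (((p - 1) %/ 2)%Z, ((q + 1) %/ 2)%Z, (false, false, true))); rewrite //= /actp /actq /=; lia.
all: by apply: (@conjugate_by ((p %/ 2)%Z, (q %/ 2)%Z, (false, false, false))); rewrite //= /actp /actq /=; lia.
Qed.

Lemma conjugate_normal_form x : conjugate x (normal_form (cls_inv x)).
Proof.
have red i y : y = conj_gen i x -> conjugate y (normal_form (cls_inv y)) -> conjugate x (normal_form (cls_inv x)).
  by move=> ey h; rewrite -(cls_inv_conj i x) -ey; apply: conjugate_trans h; rewrite ey; exact: conjugate_gen.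
case: x red => [[p q] [[[] []] []]] red.
- by apply: (red S2); [reflexivity|exact: normal_form_s1].
- exact: normal_form_rot.
- by apply: (red S1); [reflexivity|exact: normal_form_rot].
- exact: normal_form_s1.
- exact: normal_form_opp.
- by apply: (red S1); [reflexivity|exact: normal_form_s2].
- exact: normal_form_s2.
- exact: normal_form_transl.
Qed.

Lemma cls_invP x y : cls_inv x = cls_inv y <-> conjugate x y.
Proof.
split=> [e|]; last exact: cls_inv_conjugate.
by apply: conjugate_trans (conjugate_normal_form x) _; rewrite e; apply: conjugate_sym; exact: conjugate_normal_form.
Qed.

Definition class_of (x : elt) : set ext_affine := [set (dec x ^ g)%g | g in setT].

Lemma class_ofE x y : class_of x (dec y) <-> cls_inv x = cls_inv y.
Proof.
split=> [[g _ e]|/cls_invP[g e]]; last by exists g.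
by apply/cls_invP; exists g.
Qed.

Lemma class_of_conj x : conj_class (class_of x).
Proof. by exists (dec x). Qed.

Lemma class_of_eq x y : class_of x = class_of y <-> cls_inv x = cls_inv y.
Proof.
split=> [e|e]; first by apply/class_ofE; rewrite e; apply/class_ofE.
by apply/seteqP; split => w; rewrite -[w]encK => /class_ofE h; apply/class_ofE; rewrite -h e.
Qed.

Lemma conj_classP O : conj_class O -> exists x, O = class_of x.
Proof. by move=> [w ->]; exists (enc w); rewrite /class_of encK. Qed.

Lemma class_of_mem O x : conj_class O -> O (dec x) -> O = class_of x.
Proof. by move=> /conj_classP[y ->] /class_ofE e; apply/class_of_eq. Qed.

(** * Class polynomials from reductions *)

Lemma min_length_ex O : conj_class O -> exists x, min_length_elt O x.
Proof.
move=> [x0 eO].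
pose P n := `[< exists y, O y /\ ext_length y = n >].
have exP : exists n, P n.
  exists (ext_length x0); apply/asboolP; exists x0; split=> //.
  by rewrite eO; exists 1%g; rewrite ?conjg1.
case: (ex_minnP exP) => n /asboolP[y [Oy <-]] hn.
exists y; split=> // z Oz; apply: hn; apply/asboolP; by exists z.
Qed.

Lemma min_repr : exists r : set ext_affine -> ext_affine,
  forall O, conj_class O -> min_length_elt O (r O).
Proof.
have h O : exists x, conj_class O -> min_length_elt O x.
  have [cO|nO] := pselect (conj_class O); last by exists 1%g.
  by have [x hx] := min_length_ex cO; exists x.
by exists (fun O => projT1 (cid (h O))) => O cO; case: cid => x /=; exact.
Qed.

Lemma ceq_sum_seq (H : algType laurent) (I : eqType) (r : seq I) (F G : I -> H) :
  (forall i, i \in r -> ceq (F i) (G i)) -> ceq (\sum_(i <- r) F i) (\sum_(i <- r) G i).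
Proof.
move=> h; rewrite /ceq -sumrB big_seq.
by apply: (big_ind (@commutator_submodule H)) => [||i /h //]; [exact: csub0|exact: csubD].
Qed.

Section ClassPoly.
Variables (H : algType laurent) (T : ext_affine -> H) (HT : hecke_algebra T).
Local Notation TT := (Tm T).

(** The difference of two solutions is a relation between the T_x of minimal
length representatives of distinct classes. *)
Lemma class_polynomials_uniq w f f' :
  class_polynomials T w f -> class_polynomials T w f' -> f = f'.
Proof.
move=> [fin1 nc1 c1] [fin2 nc2 c2]; have [r hr] := min_repr.
have [s1 e1] := (finite_seqP _).1 fin1; have [s2 e2] := (finite_seqP _).1 fin2.
pose s := undup (s1 ++ s2).
have us : uniq s := undup_uniq _.
have out1 O : O \notin s -> f O = 0.
  rewrite mem_undup mem_cat negb_or => /andP[h _]; apply/eqP/negPn/negP => h'.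
  by have : [set` s1] O by [rewrite -e1]; rewrite /= (negbTE h).
have out2 O : O \notin s -> f' O = 0.
  rewrite mem_undup mem_cat negb_or => /andP[_ h]; apply/eqP/negPn/negP => h'.
  by have : [set` s2] O by [rewrite -e2]; rewrite /= (negbTE h).
have inc O : O \in s -> conj_class O.
  rewrite mem_undup mem_cat => /orP[h|h]; apply: contrapT => nO.
    have : [set` s1] O by [].
    by rewrite -e1 /= nc1 // eqxx.
  have : [set` s2] O by [].
  by rewrite -e2 /= nc2 // eqxx.
have sumE (k : set ext_affine -> laurent) : (forall O, O \notin s -> k O = 0) ->
    \sum_(O \in conj_class) k O *: T (r O) = \sum_(O <- s) k O *: T (r O).
  by move=> hk; apply: fsum_seq => // O _ hO; rewrite hk // scale0r.
pose S := [seq enc (r C) | C <- s].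
have clsr O : O \in s -> class_of (enc (r O)) = O.
  move=> /inc cO; apply/esym/class_of_mem => //; rewrite encK; exact: (hr _ cO).1.
pose g x := f (class_of x) - f' (class_of x).
have hg : commutator_submodule (\sum_(x <- S) g x *: TT x).
  have -> : \sum_(x <- S) g x *: TT x =
      \sum_(O <- s) f O *: T (r O) - \sum_(O <- s) f' O *: T (r O).
    rewrite -sumrB big_map big_seq [RHS]big_seq; apply: eq_bigr => O Os.
    by rewrite /g clsr // scalerBl /Tm encK.
  rewrite -(sumE f) // -(sumE f') //.
  have := csubD (csubZ (-1) (c1 r hr)) (c2 r hr).
  by rewrite scaleN1r opprB addrA subrK.
have uS : uniq (map cls_inv S).
  rewrite -map_comp map_inj_in_uniq // => O O' Os O's /= e.
  by rewrite -[O]clsr // -[O']clsr //; apply/class_of_eq.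
apply/funext => O; case: (boolP (O \in s)) => Os; last by rewrite out1 // out2.
have := cocenter_free HT hg uS (map_f (fun O => enc (r O)) Os).
by rewrite /g clsr // => /eqP; rewrite subr_eq0 => /eqP.
Qed.

(** [TT x] represents the basis element T_O of the cocenter, O the class of [x],
whatever minimal length representative is chosen. *)
Definition good (x : elt) : Prop :=
  forall y, min_length_elt (class_of x) (dec y) -> ceq (TT x) (TT y).

(** The element of the Hecke algebra described by a list of pairs (d, x), where
(d, x) stands for h^d T_x. *)
Definition expand (l : seq (nat * elt)) : H := \sum_(t <- l) hv ^+ t.1 *: TT t.2.

(** A reduction of [T w] to elements of minimal length determines the class
polynomials: collect the terms that lie in each class. *)
Lemma class_poly_sum w l : ceq (T w) (expand l) -> (forall t, t \in l -> good t.2) ->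
  forall O, class_poly T w O = \sum_(t <- l | `[< O = class_of t.2 >]) hv ^+ t.1.
Proof.
move=> hw hl; set f := fun O => \sum_(t <- l | `[< O = class_of t.2 >]) hv ^+ t.1.
suff hf : class_polynomials T w f.
  move=> O; rewrite -/(f O); congr (_ O); apply: xget_unique => // f' hf'.
  exact: class_polynomials_uniq hf' hf.
have f0 O : (forall t, t \in l -> O <> class_of t.2) -> f O = 0.
  by move=> h; rewrite /f big_seq_cond big1 // => t /andP[tl /asboolP]; move: (h t tl).
pose s := undup [seq class_of t.2 | t <- l].
have out O : O \notin s -> f O = 0.
  move=> h; apply: f0 => t tl e; move/negP: h; apply; rewrite mem_undup e.
  exact: (map_f (fun t => class_of t.2)).
split.
- apply: sub_finite_set (cardinality.finite_seq s) => // O /= hO.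
  by apply: contraT => /out e; rewrite e eqxx in hO.
- by move=> O nO; apply: f0 => t _ e; apply: nO; rewrite e; exact: class_of_conj.
move=> r hr; rewrite (@fsum_seq _ _ _ _ s) ?undup_uniq //; last 2 first.
- by move=> O; rewrite mem_undup => /mapP[t _ ->]; exact: class_of_conj.
- by move=> O _ /out ->; rewrite scale0r.
rewrite -/(ceq _ _); apply: (ceq_trans hw); rewrite /expand.
have -> : \sum_(O <- s) f O *: T (r O) = \sum_(t <- l) hv ^+ t.1 *: T (r (class_of t.2)).
  under eq_bigr do rewrite /f big_mkcond scaler_suml.
  rewrite exchange_big big_seq [RHS]big_seq; apply: eq_bigr => t tl.
  rewrite (bigD1_seq (class_of t.2)) ?undup_uniq //=; last first.
    by rewrite mem_undup (map_f (fun t => class_of t.2)).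
  rewrite asboolT // big1 ?addr0 // => O /eqP hO.
  by case: asboolP => // e; rewrite scale0r.
apply: ceq_sum_seq => t tl; apply: ceqZ; rewrite -[r _]encK; apply: (hl t tl).
by rewrite encK; apply: hr; exact: class_of_conj.
Qed.
End ClassPoly.

(** * Elements of minimal length *)

(** Conjugation by the successive letters of [r] does not change the length. *)
Fixpoint stable (r : seq gen) (x : elt) : Prop :=
  if r is i :: r' then len (conj_gen i x) = len x /\ stable r' (conj_gen i x) else True.

Section Reductions.
Variables (H : algType laurent) (T : ext_affine -> H) (HT : hecke_algebra T).
Local Notation TT := (Tm T).
Local Notation good := (good T).

Lemma ceq_path r x y : stable r x -> foldl (fun z i => conj_gen i z) x r = y ->
  ceq (TT x) (TT y).
Proof.
elim: r x => [|i r IH] x /=; first by move=> _ ->; exact: ceq_refl.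
by move=> [h1 h2] e; apply: (ceq_trans (ceq_conj HT h1)); exact: IH.
Qed.

Lemma min_length_bound x y : min_length_elt (class_of x) (dec y) -> cls_inv y = cls_inv x /\ (len y <= len x)%N.
Proof.
move=> [/class_ofE e h]; split=> //; have := h (dec x); rewrite !ext_lengthE; apply.
exact/class_ofE.
Qed.

Ltac solve_path r := apply: (@ceq_path r);
  [rewrite /= /actp /actq /=; repeat (apply: conj; [lia|]); exact: I
  |apply: triple_eq => //; rewrite /= /actp /actq /=; lia].

Lemma good_path x y r : good x -> stable r x -> foldl (fun z i => conj_gen i z) x r = y ->
  good y.
Proof.
move=> gx sr e z hz; have := ceq_path sr e => /ceq_sym h; apply: (ceq_trans h).
apply: gx; suff -> : class_of x = class_of y by [].
apply/class_of_eq; rewrite -e; clear; elim: r x => //= i r IH x.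
by rewrite -IH cls_inv_conj.
Qed.

(** The elements of minimal length in O'_(6k+3) are the four listed ones; they are
linked by one conjugation each. *)
Lemma good_s3 (k : nat) : good (-1 - 2 * k%:Z, 2 * k%:Z + 2, (true, true, true)).
Proof.
set x : elt := (_, _, _).
have hl : len x = (6 * k + 3)%N by rewrite /=; lia.
have hk : cls_inv x = (1, 2 * k + 1, 0)%N by rewrite /=; congr (_, _, _); lia.
move=> [[p q] [[s e] f]] /min_length_bound[]; rewrite hl hk /x {x hl hk}.
case: s; case: e; case: f => //= -[h1 h2] h3.
  have [ep|ep] : p = - (2 * k%:Z + 1) \/ p = 2 * k%:Z + 1 by clear -h1; lia.
    have eq : q = 2 * k%:Z + 2 by clear -h2 h3 ep; lia.
    clear -HT ep eq; solve_path (Nil gen).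
  have eq : q = - (2 * k%:Z) by clear -h2 h3 ep; lia.
  clear -HT ep eq; solve_path [:: S1].
have [eq|eq] : q = - (2 * k%:Z + 1) - p \/ q = 2 * k%:Z + 1 - p by clear -h1; lia.
  have ep : p = 1 by clear -h2 h3 eq; lia.
  clear -HT ep eq; solve_path [:: S2].
have ep : p = 1 by clear -h2 h3 eq; lia.
clear -HT ep eq; solve_path [:: S0].
Qed.

(** For k > 0 the class O'_(6k+1) has eight elements of minimal length, linked by
the indicated conjugations; for k = 0 it has only s1. *)
Lemma good_s1 (k : nat) : good (0, - (2 * k%:Z), (true, false, false)).
Proof.
set x : elt := (_, _, _).
have hl : len x = (6 * k + 1)%N by rewrite /=; lia.
have hk : cls_inv x = (1, 2 * k, 0)%N by rewrite /=; congr (_, _, _); lia.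
move=> [[p q] [[s e] f]] /min_length_bound[]; rewrite hl hk /x {x hl hk}.
case: s; case: e; case: f => //= -[h1 h2] h3.
  have [ep|ep] : p = - (2 * k%:Z) \/ p = 2 * k%:Z by clear -h1; lia.
    have [eq|eq] : q = 2 * k%:Z \/ q = 2 * k%:Z + 2 by clear -h2 h3 ep; lia.
      have k0 : (0 < k)%N by clear -h3 ep eq; lia.
      clear -HT k0 ep eq; solve_path [:: S2].
    have k0 : (0 < k)%N by clear -h3 ep eq; lia.
    clear -HT k0 ep eq; solve_path [:: Tau; S0].
  have k0 : (0 < k)%N by clear -h2 h3 ep; lia.
  have [eq|eq] : q = - (2 * k%:Z) \/ q = - (2 * k%:Z) + 2 by clear -h2 h3 ep k0; lia.
    clear -HT k0 ep eq; solve_path [:: S2; S1].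
  clear -HT k0 ep eq; solve_path [:: S0].
have [eq|eq] : q = - (2 * k%:Z) - p \/ q = 2 * k%:Z - p by clear -h1; lia.
  have [ep|[ep k0]] : p = 0 \/ p = 2 /\ (0 < k)%N by clear -h2 h3 eq; lia.
    clear -HT ep eq; solve_path (Nil gen).
  clear -HT k0 ep eq; solve_path [:: S2; S1; S0].
have [ep|[ep k0]] : p = 0 \/ p = 2 /\ (0 < k)%N by clear -h2 h3 eq; lia.
  clear -HT ep eq; solve_path [:: Tau].
clear -HT k0 ep eq; solve_path [:: S2; S0].
Qed.

(** The class O_(4k+1) has eight elements of minimal length; both choices of [c]
are needed, as the reduction of glide reflections ends in either of them. *)
Lemma good_s2 (k : nat) (c : bool) : (0 < k)%N ->
  good (- k%:Z - c%:Z, 2 * c%:Z, (false, false, true)).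
Proof.
move=> k0; have main : good (- k%:Z, 0, (false, false, true)).
  move=> [[p q] [[s e] f]] /min_length_bound[].
  case: s; case: e; case: f => //= -[h1] h3.
    have [eq|eq] : q = 2 * k%:Z \/ q = - (2 * k%:Z) by clear -h1; lia.
      have [ep|ep] : p = - k%:Z \/ p = - k%:Z + 1 by clear -h3 eq k0; lia.
        clear -HT k0 ep eq; solve_path [:: S0; S1].
      clear -HT k0 ep eq; solve_path [:: Tau].
    have [ep|ep] : p = k%:Z \/ p = k%:Z + 1 by clear -h3 eq k0; lia.
      clear -HT k0 ep eq; solve_path [:: S1].
    clear -HT k0 ep eq; solve_path [:: Tau; S2].
  have [eq|eq] : q = - (2 * k%:Z) - 2 * p \/ q = 2 * k%:Z - 2 * p by clear -h1; lia.
    have [ep|ep] : p = - k%:Z \/ p = - k%:Z - 1 by clear -h3 eq k0; lia.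
      clear -HT k0 ep eq; solve_path (Nil gen).
    clear -HT k0 ep eq; solve_path [:: Tau; S1; S0].
  have [ep|ep] : p = k%:Z \/ p = k%:Z - 1 by clear -h3 eq k0; lia.
    clear -HT k0 ep eq; solve_path [:: S0].
  clear -HT k0 ep eq; solve_path [:: Tau; S1].
case: c => /=.
  by apply: (good_path main (r := [:: Tau; S1; S0])); rewrite /= /actp /actq /=;
    [lia|apply: triple_eq => //=; lia].
by apply: (good_path main (r := [::])) => //; apply: triple_eq => //=; lia.
Qed.

Lemma good_rot : good (-1, 2, (true, false, true)).
Proof.
move=> [[p q] [[s e] f]] /min_length_bound[].
case: s; case: e; case: f => //= -[h1] h3.
  have [[ep eq]|[ep eq]] : (p = 1 /\ q = 0) \/ (p = 0 /\ q = 0) by clear -h1 h3; lia.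
    rewrite ep eq; apply: (@ceq_path [:: S0]); by do ?split.
  rewrite ep eq; apply: (@ceq_path [:: Tau]); by do ?split.
have [[ep eq]|[ep eq]] : (p = 0 /\ q = 0) \/ (p = -1 /\ q = 2) by clear -h1 h3; lia.
  rewrite ep eq; apply: (@ceq_path [:: Tau; S1]); by do ?split.
rewrite ep eq; exact: ceq_refl.
Qed.

(** All conjugates of a translation have the same length, so it can be brought to
the dominant chamber by simple reflections. *)
Lemma transl_nf p q : ceq (TT (p, q, idw)) (TT (normal_form (cls_inv (p, q, idw)))).
Proof.
have st r : all (fun i => if i is (S1 | S2) then true else false) r ->
    forall p q, stable r (p, q, idw).
  elim: r => //= i r IH /andP[hi hr] p' q'; case: i hi => // _.
    split; last by rewrite /conj_gen /rmul_gen /mule /= /actp /actq /=; exact: IH.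
    by rewrite /= /actp /actq /=; lia.
  split; last by rewrite /conj_gen /rmul_gen /mule /= /actp /actq /=; exact: IH.
  by rewrite /= /actp /actq /=; lia.
case: (lerP `|q| `|2 * p + q|) => h1; case: (lerP 0 q) => h2; case: (lerP 0 (2 * p + q)) => h3.
- by apply: (@ceq_path [::]); [exact: st|apply: triple_eq => //=; rewrite /= /actp /actq /=; lia].
- by apply: (@ceq_path [:: S1; S2; S1]); [exact: st|apply: triple_eq => //=; rewrite /= /actp /actq /=; lia].
- by apply: (@ceq_path [:: S2]); [exact: st|apply: triple_eq => //=; rewrite /= /actp /actq /=; lia].
- by apply: (@ceq_path [:: S2; S1; S2; S1]); [exact: st|apply: triple_eq => //=; rewrite /= /actp /actq /=; lia].
- by apply: (@ceq_path [:: S1]); [exact: st|apply: triple_eq => //=; rewrite /= /actp /actq /=; lia].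
- by apply: (@ceq_path [:: S1; S2]); [exact: st|apply: triple_eq => //=; rewrite /= /actp /actq /=; lia].
- by apply: (@ceq_path [:: S2; S1]); [exact: st|apply: triple_eq => //=; rewrite /= /actp /actq /=; lia].
- by apply: (@ceq_path [:: S2; S1; S2]); [exact: st|apply: triple_eq => //=; rewrite /= /actp /actq /=; lia].
Qed.

Lemma good_transl p q : good (p, q, idw).
Proof.
move=> y /min_length_bound[ek _].
have [[p' q'] ey] : exists pq, y = (pq, idw).
  by move: y ek => [[p1 q1] [[[] []] []]] //= _; exists (p1, q1).
apply: (ceq_trans (transl_nf p q)); rewrite -ek ey; apply: ceq_sym; exact: transl_nf.
Qed.
End Reductions.

(** * Reduction of rotations and reflections *)

Local Open Scope nat_scope.
(** The pairs (degree, invariant) occurring in the reduction of a rotation: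
O_2 in degree 0, O'_(6i+3) with i < n in degree 1, O'_(6i+1) and O_(4i+1) with
0 < i < m in degree 1, and the translation classes of A Lambda1 + B Lambda2
with A, B > 0 and A + B < m in degree 2, whose invariant is
(0, 2 (A + B), 2 B). *)
Definition rot_deg (n m d t a b : nat) : bool :=
  [|| [&& t == 3, a == 0, b == 0, d == 0 & 0 < m],
      [&& t == 1, odd a, b == 0, d == 1 & a < 2 * n],
      [&& (t == 1) || (t == 2), ~~ odd a, b == 0, d == 1 & 0 < a < 2 * m] |
      [&& t == 0, ~~ odd a, ~~ odd b, d == 2 & 0 < b < a] && (a < 2 * m)].

(** The pairs occurring in the reduction of a glide reflection of translation
length j: O_(4j+1) in degree 0 and the classes of (j - i) Lambda1 + i Lambda2,
0 < i <= c, in degree 1. *)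
Definition glide_deg (j c d t a b : nat) : bool :=
  [&& t == 2, a == 2 * j, b == 0 & d == 0] ||
  [&& t == 0, a == 2 * j, ~~ odd b, d == 1 & 0 < b <= 2 * c].

(** The pairs occurring in the reduction of a reflection: O'_1 in degree 0, those
of the rotations one degree higher, and the classes of i Lambda2 with
0 < i < e in degree 1. *)
Definition refl_deg (n m e d t a b : nat) : bool :=
  [|| [&& t == 1, a == 0, b == 0 & d == 0],
      (0 < d) && rot_deg n m d.-1 t a b |
      [&& t == 0, a == b, ~~ odd a, d == 1 & 0 < a < 2 * e]].

Local Open Scope ring_scope.

Section Lists.
Variables (H : algType laurent) (T : ext_affine -> H) (HT : hecke_algebra T).
Local Notation TT := (Tm T).
Local Notation good := (good T).

(** [TT x] reduces to elements of minimal length, and exactly the pairs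
(degree, invariant) satisfying [P] occur. A positive multiplicity
does not change a degree. *)
Definition expansion (x : elt) (P : nat -> nat -> nat -> nat -> bool) : Prop :=
  exists l : seq (nat * elt), [/\ ceq (TT x) (expand T l), forall t, t \in l -> good t.2 &
    forall d t a b, (exists2 s, s \in l & s.1 = d /\ cls_inv s.2 = (t, a, b)) <-> P d t a b].

Lemma expansion_good x t a b : good x -> cls_inv x = (t, a, b) ->
  expansion x (fun d t' a' b' => [&& d == 0, t' == t, a' == a & b' == b]%N).
Proof.
move=> gx ex; exists [:: (0%N, x)]; split.
- by rewrite /expand big_seq1 expr0 scale1r; exact: ceq_refl.
- by move=> s; rewrite inE => /eqP ->.
move=> d t' a' b'; split.
  by move=> [s]; rewrite inE => /eqP -> [/= <-]; rewrite ex => -[-> -> ->]; rewrite !eqxx.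
by case/and4P=> /eqP-> /eqP-> /eqP-> /eqP->; exists (0%N, x); rewrite ?inE.
Qed.

Lemma expansion_ceq x y P : ceq (TT x) (TT y) -> expansion y P -> expansion x P.
Proof. by move=> h [l [h1 h2 h3]]; exists l; split=> //; exact: ceq_trans h h1. Qed.

Lemma expansion_eq x P Q : (forall d t a b, P d t a b = Q d t a b) -> expansion x P -> expansion x Q.
Proof. by move=> e [l [h1 h2 h3]]; exists l; split=> // d t a b; rewrite -e. Qed.

(** The recursion T_x = T_y + h T_z in terms of the occurring pairs. *)
Lemma expansion_add x y z P Q : ceq (TT x) (TT y + hv *: TT z) -> expansion y P -> expansion z Q ->
  expansion x (fun d t a b => P d t a b || (0 < d)%N && Q d.-1 t a b).
Proof.
move=> h [l [h1 h2 h3]] [l' [h1' h2' h3']].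
exists (l ++ [seq (s.1.+1, s.2) | s <- l']); split.
- apply: (ceq_trans h); rewrite /expand big_cat big_map; apply: ceqD => //.
  under eq_bigr do rewrite /= exprS -scalerA.
  by rewrite -scaler_sumr; exact: ceqZ.
- move=> s; rewrite mem_cat => /orP[/h2//|/mapP[s' /h2' hs ->]//].
move=> d t a b; split.
  move=> [s]; rewrite mem_cat => /orP[sl es|/mapP[s' sl ->] [/= <- es]].
    by apply/orP; left; apply/h3; exists s.
  by apply/orP; right; apply/h3'; exists s'.
case/orP=> [/h3[s sl es]|/andP[d0 /h3'[s sl [e1 e2]]]].
  by exists s; rewrite ?mem_cat ?sl.
exists (s.1.+1, s.2); last by rewrite /= e1 prednK.
by rewrite mem_cat; apply/orP; right; apply/mapP; exists s.
Qed.

Ltac calc := rewrite /= /actp /actq /=; lia.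
Ltac solve_path r := apply: (@ceq_path _ _ HT r); [calc|apply: triple_eq => //; calc].

Lemma expansion_down i x y z P Q : is_refl i -> (len (conj_gen i x)).+2 = len x ->
  conj_gen i x = y -> lmul_gen i x = z -> expansion y P -> expansion z Q ->
  expansion x (fun d t a b => P d t a b || (0 < d)%N && Q d.-1 t a b).
Proof. by move=> ri h <- <-; apply: expansion_add; exact: ceq_down. Qed.

(** Glide reflection by - j along the axis 2b = c, with linear part s2. *)
Definition Vglide (j c : int) : elt := (- j - c, 2 * c, (false, false, true)).

(** Folding at the line b = 0 replaces the axis 2b = - c by 2b = c and splits off
the translation by (- j, c). Folding at a = 1/2, after exchanging the coordinates,
replaces c by 2 - c. The two foldings alternate until the axis is 2b = 0 or
2b = 1, where the length is minimal. *)
Lemma expansion_glide (j : nat) (c : nat) : (c < j)%N ->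
  expansion (Vglide j%:Z (- c%:Z)) (glide_deg j c) /\ expansion (Vglide j%:Z (c%:Z + 1)) (glide_deg j c).
Proof.
have tr a b : (`|b| <= `|a|)%N -> expansion (a - b, 2 * b, idw)
   (fun d t a' b' => [&& d == 0, t == 0, a' == 2 * absz a & b' == 2 * absz b]%N).
  move=> h; apply: expansion_good; first exact: good_transl.
  by congr (_, _, _); lia.
elim: c => [|c IH] ltcj.
  split.
    have := expansion_good (good_s2 HT (c := false) ltcj); rewrite /=.
    move=> /(_ 2 (2 * j) 0)%N h; apply: (expansion_eq _ (expansion_ceq _ (h _))).
    - by move=> d t a b; rewrite /glide_deg; lia.
    - rewrite /Vglide; solve_path (Nil gen).
    - by congr (_, _, _); lia.
  have := expansion_good (good_s2 HT (c := true) ltcj); rewrite /=.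
  move=> /(_ 2 (2 * j) 0)%N h; apply: (expansion_eq _ (expansion_ceq _ (h _))).
  - by move=> d t a b; rewrite /glide_deg; lia.
  - rewrite /Vglide; solve_path (Nil gen).
  - by congr (_, _, _); lia.
have [IH1 IH2] := IH (ltnW ltcj).
split.
  apply: expansion_eq (expansion_down (i := S2) _ _ _ _ IH2 (tr (- j%:Z) (c%:Z + 1) _)) => //.
  - by move=> d t a b; rewrite /glide_deg; lia.
  - by rewrite /Vglide; calc.
  - by apply: triple_eq => //; calc.
  - by apply: triple_eq => //; calc.
  - by clear -ltcj; lia.
apply: (@expansion_ceq _ (j%:Z + c%:Z + 2, - (2 * j%:Z), (false, true, false))).
  by rewrite /Vglide; solve_path [:: S1].
have IH1' : expansion (j%:Z - c%:Z, - (2 * j%:Z), (false, true, false)) (glide_deg j c).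
  by apply: expansion_ceq IH1; rewrite /Vglide; solve_path [:: S1].
have tr' : expansion (j%:Z - c%:Z - 1, - (2 * j%:Z), idw)
   (fun d t a' b' => [&& d == 0, t == 0, a' == 2 * j & b' == 2 * c.+1]%N).
  apply: expansion_good; first exact: good_transl.
  by congr (_, _, _); clear -ltcj; lia.
apply: expansion_eq (expansion_down (i := S0) _ _ _ _ IH1' tr') => //.
- by move=> d t a b; rewrite /glide_deg; lia.
- by calc.
- by apply: triple_eq => //; calc.
- by apply: triple_eq => //; calc.
Qed.

(** Rotations of lengths 6k - 2 and 6k - 4. *)
Definition rotE (k : nat) : elt := (0, 2 * k%:Z, (true, false, true)).
Definition rotF (k : nat) : elt := (1 - 2 * k%:Z, 2 * k%:Z, (true, false, true)).

(** One period of the reduction: [rotE k.+1] folds to a rotation that is conjugate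
under tau to [rotF k.+1], [rotF k.+2] folds to a rotation of length 6k + 6, and
this one to [rotE k.+1]. The reflection parts are minimal of type O'_(6k+3),
minimal of type O'_(6k+7), and a glide reflection of translation length k + 1. *)
Lemma expansion_rot (k : nat) :
  expansion (rotF k.+1) (rot_deg k k.+1) /\ expansion (rotE k.+1) (rot_deg k.+1 k.+1).
Proof.
(* From rotF to rotE, within the same period. *)
have step k' : expansion (rotF k'.+1) (rot_deg k' k'.+1) -> expansion (rotE k'.+1) (rot_deg k'.+1 k'.+1).
  move=> h.
  have h' : expansion (- (2 * k'%:Z), 2 * k'%:Z, (true, true, false)) (rot_deg k' k'.+1).
    by apply: expansion_ceq h; rewrite /rotF; solve_path [:: Tau].
  have g3 := expansion_good (good_s3 HT (k := k')) (t := 1) (a := 2 * k' + 1) (b := 0).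
  apply: expansion_eq (expansion_down (i := S0) _ _ _ _ h' (g3 _)) => //.
  - by move=> d; case: (d) => [|[|[|d']]] [|[|[|[|t]]]] a b; rewrite /rot_deg /=; lia.
  - by rewrite /rotE; calc.
  - by apply: triple_eq => //; calc.
  - by apply: triple_eq => //; calc.
  - by congr (_, _, _); clear; lia.
elim: k => [|k [_ IH]].
  suff h : expansion (rotF 1) (rot_deg 0 1) by split => //; exact: step.
  apply: expansion_eq (expansion_good (good_rot HT) (t := 3) (a := 0) (b := 0) _) => // d t a b.
  by rewrite /rot_deg; lia.
(* The glide reflection split off by the rotation of length 6k + 6. *)
have hU : expansion (1, - (2 * k.+1%:Z), (false, true, false)) (glide_deg k.+1 k).
  have [h _] := expansion_glide (ltnSn k).
  apply: expansion_ceq h; rewrite /Vglide; solve_path [:: S1].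
(* The rotation of length 6k + 6. *)
have hG : expansion (-1, - (2 * k%:Z), (true, false, true)) (fun d t a b => rot_deg k.+1 k.+1 d t a b || (0 < d)%N && glide_deg k.+1 k d.-1 t a b).
  have IH' : expansion (1, - (2 * k.+1%:Z), (true, true, false)) (rot_deg k.+1 k.+1).
    by apply: expansion_ceq IH; rewrite /rotE; solve_path [:: Tau].
  apply: (expansion_down (i := S1) _ _ _ _ IH' hU) => //.
  - by calc.
  - by apply: triple_eq => //; calc.
  - by apply: triple_eq => //; calc.
suff h : expansion (rotF k.+2) (rot_deg k.+1 k.+2) by split => //; exact: step.
apply: (@expansion_ceq _ (2 * k%:Z + 3, - (2 * k.+1%:Z), (true, true, false))).
  by rewrite /rotF; solve_path [:: S1].
have g1 := expansion_good (good_s1 HT (k := k.+1)) (t := 1) (a := 2 * k.+1) (b := 0).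
apply: expansion_eq (expansion_down (i := S0) _ _ _ _ hG (g1 _)) => //.
- by move=> d; case: (d) => [|[|[|d']]] [|[|[|[|t]]]] a b; rewrite /rot_deg /glide_deg /=; lia.
- by calc.
- by apply: triple_eq => //; calc.
- by apply: triple_eq => //; calc.
- by congr (_, _, _); clear; lia.
Qed.

(** The reflections in a - b = k, a - b = - k and a + b = k, of lengths 6k - 1,
6k + 1 and 6k - 3 (for k > 0; [refB 0] is s1). *)
Definition refA (k : nat) : elt := (2 * k%:Z, - (2 * k%:Z), (true, false, false)).
Definition refB (k : nat) : elt := (- (2 * k%:Z), 2 * k%:Z, (true, false, false)).
Definition refC (k : nat) : elt := (0, 2 * k%:Z, (true, true, true)).

(** Folding a + b = k + 1 at a = 1/2 gives a - b = - k; folding a - b = k at b = 0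
gives a + b = k; folding a - b = - k at a = b gives a - b = k. The products split
off are two rotations and the translation by (k, - k). *)
Lemma expansion_ref (k : nat) :
  [/\ expansion (refC k.+1) (refl_deg k k.+1 k.+1), expansion (refA k.+1) (refl_deg k.+1 k.+1 k.+1)
    & expansion (refB k) (refl_deg k k k.+1)].
Proof.
have stepC k' : expansion (refB k') (refl_deg k' k' k'.+1) -> expansion (refC k'.+1) (refl_deg k' k'.+1 k'.+1).
  move=> h; have [hF _] := expansion_rot k'.
  apply: expansion_eq (expansion_down (i := S0) _ _ _ _ h hF) => //.
  - by move=> d; case: (d) => [|[|[|[|d']]]] [|[|[|[|t]]]] a b; rewrite /refl_deg /rot_deg /=; lia.
  - by rewrite /refC; calc.
  - by rewrite /refC /refB; apply: triple_eq => //; calc.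
have stepA k' : expansion (refC k'.+1) (refl_deg k' k'.+1 k'.+1) ->
    expansion (refA k'.+1) (refl_deg k'.+1 k'.+1 k'.+1).
  move=> h; have [_ hE] := expansion_rot k'.
  apply: expansion_eq (expansion_down (i := S2) _ _ _ _ h hE) => //.
  - by move=> d; case: (d) => [|[|[|[|d']]]] [|[|[|[|t]]]] a b; rewrite /refl_deg /rot_deg /=; lia.
  - by rewrite /refA; calc.
  - by rewrite /refA /refC; apply: triple_eq => //; calc.
  - by rewrite /refA /rotE; apply: triple_eq => //; calc.
have stepB k' : expansion (refA k'.+1) (refl_deg k'.+1 k'.+1 k'.+1) ->
    expansion (refB k'.+1) (refl_deg k'.+1 k'.+1 k'.+2).
  move=> h.
  have ht : expansion (2 * k'.+1%:Z, - (2 * k'.+1%:Z), idw)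
     (fun d t a b => [&& d == 0, t == 0, a == 2 * k'.+1 & b == 2 * k'.+1]%N).
    apply: expansion_good; first exact: good_transl.
    by congr (_, _, _); clear; lia.
  apply: expansion_eq (expansion_down (i := S1) _ _ _ _ h ht) => //.
  - by move=> d; case: (d) => [|[|[|[|d']]]] [|[|[|[|t]]]] a b; rewrite /refl_deg /=; lia.
  - by rewrite /refB; calc.
  - by rewrite /refB /refA; apply: triple_eq => //; calc.
  - by rewrite /refB; apply: triple_eq => //; calc.
have hB : expansion (refB k) (refl_deg k k k.+1).
  elim: k => [|k IH]; last exact/stepB/stepA/stepC.
  have g := expansion_good (good_s1 HT (k := 0)) (t := 1) (a := 0) (b := 0).
  apply: expansion_eq (g _) => // d t a b.
  by move: d t => [|[|[|[|d']]]] [|[|[|[|t]]]]; rewrite /refl_deg /rot_deg /=; lia.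
by split=> //; [exact: stepC|exact/stepA/stepC].
Qed.
End Lists.

(** * Degrees and explicit classes *)

Lemma vdeg_monomial (n d : nat) : (0 < n)%N -> vdeg ((hv ^+ d) *+ n) (Some d).
Proof.
move=> n0; exists (n%:R *: 'X^d).
  by rewrite map_polyZ map_polyXn hornerZ hornerXn rmorph_nat mulr_natl.
by rewrite size_scale ?size_polyXn // pnatr_eq0 -lt0n.
Qed.

Lemma vdeg0 : vdeg 0 None.
Proof. by exists 0; rewrite ?size_poly0 // rmorph0 horner0. Qed.

Section Degrees.
Variables (H : algType laurent) (T : ext_affine -> H) (HT : hecke_algebra T).

(** The class polynomial is n h^d, where n counts the terms of the expansion in
that class; n is positive as soon as d occurs. *)
Lemma class_degree x P x0 t a b : expansion T x P -> cls_inv x0 = (t, a, b) ->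
  (forall d, P d t a b -> (forall d', P d' t a b -> d' = d) ->
     vdeg (class_poly T (dec x) (class_of x0)) (Some d)) /\
  ((forall d, ~~ P d t a b) -> vdeg (class_poly T (dec x) (class_of x0)) None).
Proof.
move=> [l [h1 h2 h3]] ek; rewrite (class_poly_sum HT h1 h2).
have ep (s : nat * elt) : `[< class_of x0 = class_of s.2 >] = (cls_inv s.2 == (t, a, b)).
  by apply/asboolP/eqP => [/class_of_eq <-//|e]; apply/class_of_eq; rewrite e.
under eq_bigl do rewrite ep.
have hP s : s \in l -> cls_inv s.2 = (t, a, b) -> P s.1 t a b.
  by move=> sl es; apply/h3; exists s.
split=> [d Pd hd|hd]; last first.
  rewrite big_seq_cond big1; first exact: vdeg0.
  by move=> s /andP[sl /eqP /(hP _ sl)]; rewrite (negbTE (hd _)).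
rewrite big_seq_cond (eq_bigr (fun=> hv ^+ d)); last first.
  by move=> s /andP[sl /eqP /(hP _ sl) /hd ->].
rewrite -big_seq_cond big_const_seq -[X in vdeg (X _) _]/(iter _ _) iter_addr_0.
apply: vdeg_monomial; rewrite -has_count; have /h3[s sl [_ es]] := Pd.
by apply/hasP; exists s => //; rewrite es.
Qed.
End Degrees.

Lemma class_of_set (x0 : elt) (S : set ext_affine) k :
  (forall y, S (dec y) <-> cls_inv y = k) -> (class_of x0 = S <-> cls_inv x0 = k).
Proof.
move=> hS; split=> [e|e]; first by apply/hS; rewrite -e; apply/class_ofE.
apply/seteqP; split=> w; rewrite -[w]encK; first by move/class_ofE => e'; apply/hS; rewrite -e'.
by move/hS => e'; apply/class_ofE; rewrite e.
Qed.

Lemma t_dec a b w : (t (cv a b) * dec (0, 0, w))%g = dec (a, b, w).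
Proof.
rewrite dec_tcv -dec_mul; congr dec; move: w => [[s e] f].
by apply: triple_eq => //=; rewrite /actp /actq /= ?addr0.
Qed.

Lemma t_s1 a b : (t (cv a b) * s1)%g = dec (a, b, (true, false, false)).
Proof. by rewrite dec_s1 t_dec. Qed.
Lemma t_s2 a b : (t (cv a b) * s2)%g = dec (a, b, (false, false, true)).
Proof. by rewrite dec_s2 t_dec. Qed.
Lemma t_s1s2 a b : (t (cv a b) * s1 * s2)%g = dec (a, b, (true, true, false)).
Proof. by rewrite dec_s1 dec_s2 -mulgA -dec_mul t_dec. Qed.
Lemma t_s2s1 a b : (t (cv a b) * s2 * s1)%g = dec (a, b, (true, false, true)).
Proof. by rewrite dec_s1 dec_s2 -mulgA -dec_mul t_dec. Qed.
Lemma t_s1s2s1 a b : (t (cv a b) * s1 * s2 * s1)%g = dec (a, b, (false, true, false)).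
Proof. by rewrite t_s1s2 dec_s1 -dec_mul; congr dec; apply: triple_eq; rewrite /= /actp /actq /= ?addr0. Qed.
Lemma t_s2s1s2 a b : (t (cv a b) * s2 * s1 * s2)%g = dec (a, b, (true, true, true)).
Proof. by rewrite t_s2s1 dec_s2 -dec_mul; congr dec; apply: triple_eq; rewrite /= /actp /actq /= ?addr0. Qed.

Lemma LambdaE : (Lambda1 = cv 1 0) * (Lambda2 = cv 0 2).
Proof. by split; [exact: Lambda1E|exact: Lambda2E]. Qed.

Lemma O_2E y : O_2 (dec y) <-> cls_inv y = (3, 0, 0)%N.
Proof.
rewrite /O_2 /= !LambdaE; split.
  by move=> [a [b]]; rewrite !cvZ cvD t_s1s2 t_s2s1 => -[] /dec_injective -> /=; congr (_, _, _); lia.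
case: y => [[p q] [[[] []] []]] //= [oq]; exists p, (q %/ 2)%Z; rewrite !cvZ cvD t_s1s2 t_s2s1;
  [left|right]; congr dec; apply: triple_eq => //; lia.
Qed.

Lemma O_4k1E k y : O_4k1 k (dec y) <-> cls_inv y = (2, 2 * k, 0)%N.
Proof.
rewrite /O_4k1 /= !LambdaE; split.
  move=> [e [m]]; rewrite ?cvN ?cvD ?cvZ ?cvD t_s1s2s1 t_s2.
  by case: e; rewrite ?expr0 ?expr1 => -[] /dec_injective -> /=; congr (_, _, _); lia.
have cvE (e : bool) m : ((-1) ^+ e * k%:Z) *: (cv 0 2 - cv 1 0) + m *: cv 1 0 =
    cv (m - negif e k%:Z) (2 * negif e k%:Z) /\
    ((-1) ^+ e * k%:Z) *: cv 1 0 + m *: (cv 0 2 - cv 1 0) = cv (negif e k%:Z - m) (2 * m).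
  by rewrite ?cvN ?cvD ?cvZ ?cvD; case: e; rewrite ?expr0 ?expr1 /=; split; congr cv; lia.
case: y => [[p q] [[[] []] []]] //= [hq].
  exists (q < 0), (p + negif (q < 0) k%:Z); left; have [-> _] := cvE (q < 0) (p + negif (q < 0) k%:Z).
  by rewrite t_s1s2s1; congr dec; apply: triple_eq => //; case: (ltrP q 0) => h /=; lia.
exists (2 * p + q < 0), (q %/ 2)%Z; right; have [_ ->] := cvE (2 * p + q < 0) (q %/ 2)%Z.
by rewrite t_s2; congr dec; apply: triple_eq => //; case: (ltrP (2 * p + q) 0) => h /=; lia.
Qed.

Lemma O'_6k1E k y : O'_6k1 k (dec y) <-> cls_inv y = (1, 2 * k, 0)%N.
Proof.
rewrite /O'_6k1 /= !LambdaE.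
have cvE (e : bool) m : ((-1) ^+ e * k%:Z) *: cv 0 2 + m *: (2 *: cv 1 0 - cv 0 2) =
    cv (2 * m) (2 * negif e k%:Z - 2 * m) /\
    ((-1) ^+ e * k%:Z) *: (2 *: cv 1 0 - cv 0 2) + m *: cv 0 2 =
    cv (2 * negif e k%:Z) (2 * m - 2 * negif e k%:Z).
  by rewrite ?cvZ ?cvN ?cvD ?cvZ ?cvD; case: e; rewrite ?expr0 ?expr1 /=; split; congr cv; lia.
split.
  move=> [e [m]]; have [-> ->] := cvE e m; rewrite t_s1 t_s2s1s2.
  by case: e => -[] /dec_injective -> /=; congr (_, _, _); lia.
case: y => [[p q] [[[] []] []]] //= [hq ho].
  exists (p < 0), ((p + q) %/ 2)%Z; right; have [_ ->] := cvE (p < 0) ((p + q) %/ 2)%Z.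
  by rewrite t_s2s1s2; congr dec; apply: triple_eq => //; case: (ltrP p 0) => h /=; lia.
exists (p + q < 0), (p %/ 2)%Z; left; have [-> _] := cvE (p + q < 0) (p %/ 2)%Z.
by rewrite t_s1; congr dec; apply: triple_eq => //; case: (ltrP (p + q) 0) => h /=; lia.
Qed.

Lemma O'_6k3E k y : O'_6k3 k (dec y) <-> cls_inv y = (1, 2 * k + 1, 0)%N.
Proof.
rewrite /O'_6k3 /= !LambdaE.
have cvE (e : bool) m : (-1) ^+ e *: (k%:Z *: cv 0 2 + cv 1 0) + m *: (2 *: cv 1 0 - cv 0 2) =
    cv (2 * m + negif e 1) (2 * negif e k%:Z - 2 * m) /\
    (-1) ^+ e *: (k%:Z *: (2 *: cv 1 0 - cv 0 2) + cv 1 0) + m *: cv 0 2 =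
    cv (negif e (2 * k%:Z + 1)) (2 * m - 2 * negif e k%:Z).
  by rewrite ?cvZ ?cvN ?cvD ?cvZ ?cvD ?cvZ ?cvD; case: e; rewrite ?expr0 ?expr1 /=; split; congr cv; lia.
split.
  move=> [e [m]]; have [-> ->] := cvE e m; rewrite t_s1 t_s2s1s2.
  by case: e => -[] /dec_injective -> /=; congr (_, _, _); lia.
case: y => [[p q] [[[] []] []]] //= [hq ho].
  exists (p < 0), (((p + q) %/ 2)%Z + (nat_of_bool (p < 0)%R)%:Z); right; have [_ ->] := cvE (p < 0) (((p + q) %/ 2)%Z + (nat_of_bool (p < 0)%R)%:Z).
  by rewrite t_s2s1s2; congr dec; apply: triple_eq => //; case: (ltrP p 0) => h /=; lia.
exists (p + q < 0), ((p %/ 2)%Z + (nat_of_bool (p + q < 0)%R)%:Z); left; have [-> _] := cvE (p + q < 0) ((p %/ 2)%Z + (nat_of_bool (p + q < 0)%R)%:Z).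
by rewrite t_s1; congr dec; apply: triple_eq => //; case: (ltrP (p + q) 0) => h /=; lia.
Qed.

Lemma O_translE (a b : nat) y :
  O_transl (a%:Z *: Lambda1 + b%:Z *: Lambda2) (dec y) <->
  cls_inv y = (0, 2 * (a + b), 2 * b)%N.
Proof.
rewrite /O_transl !LambdaE !cvZ cvD.
have -> : cv (a%:Z * 1 + b%:Z * 0) (a%:Z * 0 + b%:Z * 2) = cv a%:Z (2 * b%:Z) by congr cv; lia.
have kx : cls_inv (a%:Z, 2 * b%:Z, idw) = (0, 2 * (a + b), 2 * b)%N by congr (_, _, _); lia.
split=> [[g /= gW]|].
  have [k ->] := weyl_smat gW; rewrite smat_act dec_tcv => /dec_injective <-.
  by rewrite -kx; move: k => [[[] []] []]; rewrite /actp /actq /=; congr (_, _, _); clear; lia.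
rewrite -kx => /esym/cls_invP[g ey]; exists (lin g^-1%g).
  by case: (g^-1)%g => -[].
rewrite ey conjgE; set x : elt := (_, _, idw); apply: ea_eq; last first.
  have -> : lin (g^-1 * (dec x * g))%g = (lin g)^-1 * (smat idw * lin g) by [].
  by rewrite smat1 mul1r mulVr //; exact: weyl_unit (ea_weyl g).
have -> : transl (g^-1 * (dec x * g))%g =
    - (lin g^-1%g *m transl g) + lin g^-1%g *m (cv a%:Z (2 * b%:Z) + smat idw *m transl g) by [].
by rewrite smat1 mul1mx mulmxDr addrCA addNr addr0.
Qed.

Lemma O_iLambda2E (i : nat) y : O_transl (i%:Z *: Lambda2) (dec y) <->
  cls_inv y = (0, 2 * i, 2 * i)%N.
Proof. by have := O_translE 0 i y; rewrite scale0r add0r add0n. Qed.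

(** * Lattice points of the diamond *)

(** Coordinates of a point of the diamond with respect to Lambda1 and Lambda2. *)
Lemma diamond_coord (a b A B : int) :
  diamond a b (ratv (A *: Lambda1 + B *: Lambda2)) <->
  exists c0 c1 c2 c3 : rat,
    [/\ 0 <= c0, 0 <= c1, 0 <= c2 & 0 <= c3] /\
    [/\ c0 + (c1 + (c2 + c3)) = 1,
        A%:~R = c2 * (a + b)%:~R + c3 * a%:~R &
        B%:~R = c1 * (a%:~R / 2 + b%:~R) + c3 * b%:~R].
Proof.
have vec (c0 c1 c2 c3 : rat) :
    ratv (A *: Lambda1 + B *: Lambda2) = c0 *: 0 +
      (c1 *: ((a%:~R / 2 + b%:~R) *: ratv Lambda2) +
      (c2 *: ((a + b)%:~R *: ratv Lambda1) +
      (c3 *: ratv (a *: Lambda1 + b *: Lambda2) + 0))) <->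
    A%:~R = c2 * (a + b)%:~R + c3 * a%:~R /\
    B%:~R = c1 * (a%:~R / 2 + b%:~R) + c3 * b%:~R.
  rewrite !LambdaE !cvZ !cvD.
  have e2 (x y : rat) : (x * 2 = y * 2) <-> x = y.
    by split=> [|-> //]; apply: mulIf.
  split.
    move/matrixP => h; have := h 0 0; have := h 1 0; rewrite !mxE /= !(intrD, intrM) => h1 h0.
    by split; [move: h0|move: h1]; lra.
  rewrite !(intrD, intrM) => -[h0 h1]; apply/matrixP=> i j; rewrite !mxE /=.
  by case: ifP => _; rewrite !(intrD, intrM); lra.
rewrite /diamond /convex_hull /=; split.
  move=> [c [c0 c1]]; rewrite !big_ord_recl big_ord0 /= => /vec h.
  do 4!eexists; split; last first.
    split; [|exact: h.1|exact: h.2].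
    by rewrite -[RHS]c1 !big_ord_recl big_ord0 addr0.
  by split; exact: c0.
move=> [c0 [c1 [c2 [c3 [[p0 p1 p2 p3] [s h1 h2]]]]]].
exists (fun i : 'I_4 => [:: c0; c1; c2; c3]`_i); split.
- by case=> [[|[|[|[|]]]]].
- by rewrite !big_ord_recl big_ord0 /= addr0.
- by rewrite !big_ord_recl big_ord0 /=; apply/vec.
Qed.

(** For a = 0 the diamond is the triangle with vertices 0, M Lambda2 and M Lambda1. *)
Lemma diamond_0 (M A B : int) : 0 <= M -> 1 <= A -> 1 <= B ->
  diamond 0 M (ratv (A *: Lambda1 + B *: Lambda2)) <-> A + B <= M.
Proof.
move=> M0 A1 B1; rewrite diamond_coord; split.
  move=> [c0 [c1 [c2 [c3 [[p0 p1 p2 p3] [s h1 h2]]]]]].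
  have M0' : 0 <= M%:~R :> rat by rewrite ler0z.
  rewrite -(ler_int rat) intrD h1 h2 !(intrD, mulr0z); nra.
move=> h; have M1 : 0 < M%:~R :> rat by rewrite ltr0z; lia.
have h' : A%:~R + B%:~R <= M%:~R :> rat by rewrite -intrD ler_int.
exists (1 - A%:~R / M%:~R - B%:~R / M%:~R), (B%:~R / M%:~R), (A%:~R / M%:~R), 0.
have A0 : 0 <= A%:~R :> rat by rewrite ler0z; lia.
have B0 : 0 <= B%:~R :> rat by rewrite ler0z; lia.
split; split=> //; try by rewrite divr_ge0 // ltW.
- by rewrite -addrA -opprD -mulrDl subr_ge0 ler_pdivrMr // mul1r.
- by ring.
- by rewrite add0r mul0r addr0 divfK // lt0r_neq0.
- by rewrite mulr0z !mul0r add0r addr0 divfK // lt0r_neq0.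
Qed.

(** For a = -1 the edge from (M - 1/2) Lambda2 to (M - 1) Lambda1 lies above the line
A + B = M - 1 by at most 1/2, so that both cut out the same lattice points. *)
Lemma diamond_N1 (M A B : int) : 0 <= M -> 1 <= A -> 1 <= B ->
  diamond (-1) M (ratv (A *: Lambda1 + B *: Lambda2)) <-> A + B < M.
Proof.
move=> M0 A1 B1; rewrite diamond_coord; split.
  move=> [c0 [c1 [c2 [c3 [[p0 p1 p2 p3] [s h1 h2]]]]]].
  have A1' : 1 <= A%:~R :> rat by rewrite (ler_int _ 1).
  have B1' : 1 <= B%:~R :> rat by rewrite (ler_int _ 1).
  have M0' : 0 <= M%:~R :> rat by rewrite ler0z.
  have z1 : (-1 : int)%:~R = -1 :> rat by [].
  move: h1 h2; rewrite !(intrD, intrM, z1) /= => h1 h2.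
  rewrite -(ltr_int rat) intrD.
  have h3 : A%:~R + B%:~R = (c1 + c2 + c3) * (M%:~R - 1) + c1 / 2 :> rat by rewrite h1 h2; field.
  have M1 : 1 <= M%:~R :> rat.
    rewrite (ler_int _ 1); case: (eqVneq M 0) => [eM|]; last by lia.
    by exfalso; move: h1; rewrite eM mulr0z; lra.
  have l1 : (c1 + c2 + c3) * (M%:~R - 1) <= M%:~R - 1 :> rat by nra.
  have l2 : c1 <= 1 by lra.
  rewrite h3; lra.
move=> h.
have A0 : 1 <= A%:~R :> rat by rewrite (ler_int _ 1).
have B0 : 1 <= B%:~R :> rat by rewrite (ler_int _ 1).
have hM : A%:~R + B%:~R <= M%:~R - 1 :> rat by rewrite -intrD -(intrD _ M (-1)) ler_int; lia.
have M1 : 0 < M%:~R - 1 :> rat by lra.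
have M2 : 0 < M%:~R - 1 / 2 :> rat by lra.
set a2 : rat := A%:~R / (M%:~R - 1); set a1 : rat := B%:~R / (M%:~R - 1 / 2).
have e2 : a2 * (M%:~R - 1) = A%:~R by rewrite divfK // lt0r_neq0.
have e1 : a1 * (M%:~R - 1 / 2) = B%:~R by rewrite divfK // lt0r_neq0.
have p2 : 0 <= a2 by rewrite divr_ge0 //; lra.
have p1 : 0 <= a1 by rewrite divr_ge0 //; lra.
exists (1 - a1 - a2), a1, a2, 0; split; split=> //.
- have : (a1 + a2) * (M%:~R - 1) <= 1 * (M%:~R - 1) by nra.
  by rewrite ler_pM2r // => ?; lra.
- by ring.
- by rewrite intrD -e2; ring.
- by rewrite -e1; field.
Qed.

(** * The proposition *)

(** The relation between length and the bounds of [refl_deg]: reflections in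
a - b = m, in a + b = m, and in a - b = 1 - m. *)
Definition shape (m l n c : nat) : Prop :=
  [\/ [/\ l = 6 * m - 1, n = m & c = m], [/\ l = 6 * m - 3, n = m - 1 & c = m]
    | [/\ l = 6 * m - 5, n = m - 1 & c = m - 1]]%N.

Lemma reflection_exp (H : algType laurent) (T : ext_affine -> H) (HT : hecke_algebra T) y :
  cls_inv y = (1, 0, 0)%N ->
  exists m n c, [/\ (0 < m)%N, shape m (len y) n c & expansion T y (refl_deg n c m)].
Proof.
have hA k := expansion_ref HT k.
case: y => [[p q] [[[] []] []]] //= -[hp hq].
  have {hp} ep : p = 0 by lia.
  have [[k eq]|[k eq]] : (exists k : nat, q = 2 * k.+1%:Z) \/ (exists k : nat, q = - (2 * k%:Z)).
  - case: (lerP q 0) => q0; [right; exists (absz q)./2|left; exists (absz q)./2.-1]; lia.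
  - have [hC _ _] := hA k; exists k.+1, k, k.+1; split=> //.
      by rewrite ep eq; apply: Or32; split; lia.
    by rewrite ep eq.
  - have [hC _ _] := hA k; exists k.+1, k, k.+1; split=> //.
      by rewrite ep eq; apply: Or32; split; lia.
    apply: expansion_ceq hC; rewrite ep eq; apply: (@ceq_path _ _ HT [:: Tau]).
      by rewrite /= /actp /actq /=; lia.
    by apply: triple_eq => //; rewrite /= /actp /actq /=; lia.
have {hp} ep : p = - q by lia.
have [[k eq]|[k eq]] : (exists k : nat, q = - (2 * k.+1%:Z)) \/ (exists k : nat, q = 2 * k%:Z).
- case: (lerP 0 q) => q0; [right; exists (absz q)./2|left; exists (absz q)./2.-1]; lia.
- have [_ h _] := hA k; exists k.+1, k.+1, k.+1; split=> //.
    by rewrite ep eq; apply: Or31; split; lia.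
  by rewrite ep eq opprK.
- have [_ _ h] := hA k; exists k.+1, k, k; split=> //.
    by rewrite ep eq; apply: Or33; split; lia.
  by rewrite ep eq.
Qed.

(** Each class occurs in a single degree. *)
Lemma refl_deg_uniq n c m d d' t a b : refl_deg n c m d t a b -> refl_deg n c m d' t a b -> d' = d.
Proof. by case: t => [|[|[|[|t]]]]; rewrite /refl_deg /rot_deg /=; lia. Qed.

Theorem proposition3p20
  (H : algType laurent) (T : ext_affine -> H) (HT : hecke_algebra T)
  (w : ext_affine) (hw : O'_6k1 0%N w)
  (m : nat) (hm : (1 <= m)%N)
  (hl : ext_length w \in [:: 6 * m - 1; 6 * m - 3; 6 * m - 5]%N)
  (O : set ext_affine) (hO : conj_class O) :
  let: (a, b) := lambda_coord m (ext_length w) in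
  let case3 := exists2 x, Lambda_le a b x & O = O_transl x in
  let case2 := C_classes m (ext_length w) O in
  let case1 := (1 < ext_length w)%N /\
    (O = O_2 \/
     exists2 i : nat, (1 <= i <= m - 1)%N & O = O_transl (i%:Z *: Lambda2)) in
  let case0 := O = O'_6k1 0%N in
  [/\ case3 -> vdeg (class_poly T w O) (Some 3%N),
      case2 -> vdeg (class_poly T w O) (Some 2%N),
      case1 -> vdeg (class_poly T w O) (Some 1%N),
      case0 -> vdeg (class_poly T w O) (Some 0%N) &
      ~ case3 -> ~ case2 -> ~ case1 -> ~ case0 ->
        vdeg (class_poly T w O) None].
Proof.
have [y ey] := dec_surj w; rewrite {w}ey in hw hl *.
rewrite ext_lengthE in hl *.
have [m' [n [c [m0 sh hy]]]] := reflection_exp HT ((O'_6k1E 0 y).1 hw).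
have em : m' = m.
  by move: hl sh; rewrite !inE => /or3P[] /eqP -> [] []; lia.
rewrite {m'}em in m0 sh hy.
have [x0 eO] := conj_classP hO; rewrite {O hO}eO.
case ek: (cls_inv x0) => [[t a0] b0].
have [hdeg hnone] := class_degree HT hy ek.
have deg d : refl_deg n c m d t a0 b0 -> vdeg (class_poly T (dec y) (class_of x0)) (Some d).
  by move=> hd; apply: hdeg => // d'; exact: refl_deg_uniq.
case elam: (lambda_coord m (len y)) => [a b].
(* In terms of the invariant (t, a0, b0) of the class, each case of the statement
   becomes a clause of refl_deg. *)
pose P3 := (t = 0 /\ exists A B, [/\ 0 < A, 0 < B, A + B < c, a0 = 2 * (A + B) & b0 = 2 * B])%N.
have case3P : (exists2 x, Lambda_le a b x & class_of x0 = O_transl x) <-> P3.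
  have dia (A B : nat) : (0 < A)%N -> (0 < B)%N ->
      diamond a b (ratv (A%:Z *: Lambda1 + B%:Z *: Lambda2)) <-> (A + B < c)%N.
    move=> A1 B1; move: elam; rewrite /lambda_coord.
    case: ifP => [/eqP l1|/eqP l1]; last (case: ifP => [/eqP l2|/eqP l2]).
    - case=> <- <-; rewrite diamond_N1; [|lia..].
      by move: sh => [] []; lia.
    - case=> <- <-; rewrite diamond_0; [|lia..].
      by move: sh => [] []; lia.
    case=> <- <-; rewrite diamond_N1; [|lia..].
    by move: sh => [] []; lia.
  split.
    move=> [x [[A [B [A1 B1 ex]]] /= hd] e].
    have eA : A = (absz A)%:Z by lia.
    have eB : B = (absz B)%:Z by lia.
    rewrite ex eA eB in hd e.
    have := (class_of_set _ (O_translE _ _)).1 e; rewrite ek => -[et ea eb].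
    rewrite /P3 et ea eb; split=> //; exists (absz A), (absz B); split=> //; try lia.
    by apply/dia => //; lia.
  move=> [et [A [B [A0 B0 AB ea eb]]]].
  exists (A%:Z *: Lambda1 + B%:Z *: Lambda2).
    split; first by exists A%:Z, B%:Z; split=> //; lia.
    exact/dia.
  by apply/(class_of_set _ (O_translE _ _)); rewrite ek et ea eb.
have setP S k : (forall z, S (dec z) <-> cls_inv z = k) -> (class_of x0 = S <-> (t, a0, b0) = k).
  by move=> hS; rewrite -ek; exact: class_of_set.
have case2P : C_classes m (len y) (class_of x0) <->
    [\/ exists2 i, (0 < i < c)%N & (t, a0, b0) = (2, 2 * i, 0)%N,
        exists2 i, (i < n)%N & (t, a0, b0) = (1, 2 * i + 1, 0)%N
      | exists2 i, (0 < i < c)%N & (t, a0, b0) = (1, 2 * i, 0)%N].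
  have [N3 [N1 [eN h3 h1]]] : exists N3 N1 : int, [/\ class_bounds m (len y) = (N1, N3, N1),
      forall i : nat, (i%:Z <= N3) = (i < n)%N & forall i : nat, (1 <= i%:Z <= N1) = (0 < i < c)%N].
    rewrite /class_bounds; move: sh => [] [el en ec].
    - by rewrite el eqxx; do 2!eexists; split=> // i; lia.
    - rewrite ifF; last by lia.
      by rewrite el eqxx; do 2!eexists; split=> // i; lia.
    rewrite ifF; last by lia.
    by rewrite ifF; [do 2!eexists; split=> // i; lia|lia].
  rewrite /C_classes eN /=; split.
    move=> [[[i hi /(setP _ _ (O_4k1E i)) e]|[i hi /(setP _ _ (O'_6k3E i)) e]]|[i hi /(setP _ _ (O'_6k1E i)) e]].
    - by apply: Or31; exists i; rewrite -?h1.
    - by apply: Or32; exists i; rewrite -?h3.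
    - by apply: Or33; exists i; rewrite -?h1.
  case=> [[i hi e]|[i hi e]|[i hi e]].
  - by left; left; exists i; [rewrite h1|apply/(setP _ _ (O_4k1E i))].
  - by left; right; exists i; [rewrite h3|apply/(setP _ _ (O'_6k3E i))].
  - by right; exists i; [rewrite h1|apply/(setP _ _ (O'_6k1E i))].
have case1P : ((1 < len y)%N /\ (class_of x0 = O_2 \/
     exists2 i : nat, (1 <= i <= m - 1)%N & class_of x0 = O_transl (i%:Z *: Lambda2))) <->
    (1 < len y)%N /\ ((t, a0, b0) = (3, 0, 0)%N \/
      exists2 i, (0 < i < m)%N & (t, a0, b0) = (0, 2 * i, 2 * i)%N).
  split=> -[hy1 h]; split=> //; case: h => [/(setP _ _ O_2E) h|[i hi e]]; (try by left).
  - by right; exists i; [lia|apply/(setP _ _ (O_iLambda2E i))].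
  - by right; exists i; [lia|apply/(setP _ _ (O_iLambda2E i))].
have case0P : class_of x0 = O'_6k1 0 <-> (t, a0, b0) = (1, 0, 0)%N := setP _ _ (O'_6k1E 0).
move: sh => sh.
have c0 : (1 < len y)%N = (0 < c)%N by move: sh => [] []; lia.
move=> case3 case2 case1 case0; split.
- move=> /case3P [et [A [B [A0 B0 AB ea eb]]]]; apply: deg.
  by rewrite et ea eb /refl_deg /rot_deg /=; clear -A0 B0 AB; lia.
- move=> /case2P [] [i hi [et ea eb]]; apply: deg; rewrite et ea eb /refl_deg /rot_deg /=; clear -hi; lia.
- move=> /case1P [hy1 h]; apply: deg; rewrite c0 in hy1.
  by case: h => [[et ea eb]|[i hi [et ea eb]]]; rewrite et ea eb /refl_deg /rot_deg /=;
    [clear -hy1|clear -hi hy1]; lia.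
- by move=> /case0P [et ea eb]; apply: deg; rewrite et ea eb.
(* Conversely every clause of refl_deg belongs to one of the four cases. *)
move=> /case3P n3 /case2P n2 /case1P n1 /case0P n0; apply: hnone => d; apply/negP.
move: n3 n2 n1 n0; rewrite /P3 c0 {hdeg deg setP case3P case2P case1P case0P P3 c0 ek}.
have mc : (c <= m <= c.+1)%N by move: sh => [] []; lia.
move: t => [|[|[|[|t]]]] n3 n2 n1 n0; rewrite /refl_deg /rot_deg /= => hd.
- have [[h1 h2]|[h1 h2]] : (~~ odd a0 /\ ~~ odd b0 /\ 0 < b0 < a0 /\ a0 < 2 * c \/
      a0 = b0 /\ ~~ odd a0 /\ 0 < a0 < 2 * m)%N by clear -hd; lia.
    by apply: n3; split=> //; exists (a0./2 - b0./2)%N, b0./2; clear -h1 h2; split; lia.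
  apply: n1; split; first by clear -h2 mc; lia.
  by right; exists a0./2; [|congr (_, _, _)]; clear -h1 h2; lia.
- have [[h1 h2]|[[h1 [h2 h3]]|[h1 [h2 h3]]]] : (a0 = 0 /\ b0 = 0 \/
     b0 = 0 /\ odd a0 /\ a0 < 2 * n \/ b0 = 0 /\ ~~ odd a0 /\ 0 < a0 < 2 * c)%N by clear -hd; lia.
  + by apply: n0; rewrite h1 h2.
  + by apply: n2; apply: Or32; exists a0./2; [|congr (_, _, _)]; clear -h1 h2 h3; lia.
  + by apply: n2; apply: Or33; exists a0./2; [|congr (_, _, _)]; clear -h1 h2 h3; lia.
- have [h1 [h2 h3]] : (b0 = 0 /\ ~~ odd a0 /\ 0 < a0 < 2 * c)%N by clear -hd; lia.
  by apply: n2; apply: Or31; exists a0./2; [|congr (_, _, _)]; clear -h1 h2 h3; lia.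
- have [h1 [h2 h3]] : (a0 = 0 /\ b0 = 0 /\ 0 < c)%N by clear -hd; lia.
  by apply: n1; split=> //; left; rewrite h1 h2.
by move: hd; clear; lia.
Qed.
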